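(* Suppose that $\Gamma$ is a smooth, bounded curve embedded in $\mathbb{R}^2$, such that $B_r(0)\subset\Gamma^c$, with $re^{i\theta_0}\in\partial B_r(0)\cap\Gamma$. For $k\in(0,\infty)$, $N$ a positive integer, and $\beta\in(0,1)$, there is a constant $M'_{N,\beta}(k)$ so that if $\varphi\in\mathcal{C}^{N,\beta}(\Gamma)$, then $$\left|\int_{\Gamma}G_k(re^{i\theta_0},y)\varphi(y)\,ds(y)-\sum_{l=-N}^{N}\alpha_l J_{|l|}(kr)e^{il\theta_0}\right|\leq M'_{N,\beta}(k)\,r^{N+1}\,\|\varphi\|_{\mathcal{C}^{N,\beta}(\Gamma)}.$$ Here $G_k(x,y)=\frac{i}{4}H^{(1)}_0(k|x-y|)$, and $$\alpha_l=\frac{i}{4}\int_{\Gamma}H^{(1)}_{|l|}(k|y|)\,e^{-il\phi_y}\,\varphi(y)\,ds(y),$$ where $y=|y|e^{i\phi_y}$.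
   Context: $\mathbb{R}^2$ is identified with $\mathbb{C}$. $\Gamma$ is a $C^\infty$ compact embedded (closed) curve separating $\mathbb{R}^2$ into a bounded component $D_-$ and an unbounded component $D_+$; $ds$ is arc length; $\Gamma^c=\mathbb{R}^2\setminus\Gamma$. $B_r(0)$ is the open disk of radius $r$ about $0$, with boundary $\partial B_r(0)$. $J_l$ and $H^{(1)}_l$ are the Bessel and Hankel functions of the first kind of order $l$. $\mathcal{C}^{N,\beta}(\Gamma)$ is the Hölder space of functions with $N$ continuous derivatives whose $N$-th derivative is Hölder continuous of exponent $\beta$, with its usual norm. *)

(* Defs.v *)
From HB Require Import structures.
From mathcomp Require Import all_boot all_order all_algebra.
From mathcomp Require Import all_classical all_reals all_analysis.
From mathcomp Require Import complex.

Set Implicit Arguments.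
Unset Strict Implicit.
Unset Printing Implicit Defensive.

Import Order.TTheory GRing.Theory Num.Theory.
Import numFieldNormedType.Exports.

Local Open Scope classical_set_scope.
Local Open Scope ring_scope.
Local Open Scope complex_scope.

(* The plane is [R[i]]; complex-valued functions of a real variable are
   differentiated and integrated componentwise. *)

(* The modulus as an element of [R]; [`|z|] lives in [R[i]]. *)
Definition cmod {R : realType} (z : R[i]) : R := ComplexField.Normc.normc z.

Definition expi {R : realType} (t : R) : R[i] := cos t +i* sin t.

(* Argument in ]-pi, pi]; [carg 0] is a junk value. *)
Definition carg {R : realType} (z : R[i]) : R :=
  let a := acos (complex.Re z / cmod z) in
  if 0 <= complex.Im z then a else - a.

Definition cderiven {R : realType} (n : nat) (f : R -> R[i]) (s : R) : R[i] :=
  derive1n n (fun t => complex.Re (f t)) s +i* derive1n n (fun t => complex.Im (f t)) s.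

(* [f] is [n] times differentiable on the whole line. *)
Definition cderivable_n {R : realType} (n : nat) (f : R -> R[i]) : Prop :=
  forall (m : nat) (s : R), (m < n)%N ->
    derivable (derive1n m (fun t => complex.Re (f t))) s 1 /\
    derivable (derive1n m (fun t => complex.Im (f t))) s 1.

Definition csmooth {R : realType} (f : R -> R[i]) : Prop :=
  forall n, cderivable_n n f.

(* Lebesgue integral: the integrands below may have a logarithmic
   singularity. *)
Definition cintegral {R : realType} (a b : R) (f : R -> R[i]) : R[i] :=
  (\int[lebesgue_measure]_(s in `[a, b]) complex.Re (f s)) +i*
  (\int[lebesgue_measure]_(s in `[a, b]) complex.Im (f s)).

(* A C^oo compact embedded closed curve is given by an arc-length
   parametrization [gam] of period [L], [L] being its length; the curve itself
   is [range gam]. *)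
Definition smooth_closed_curve {R : realType} (gam : R -> R[i]) (L : R) : Prop :=
  [/\ 0 < L,
      csmooth gam,
      (forall s, gam (s + L) = gam s),
      (forall s, cmod (cderiven 1 gam s) = 1)
    & {in `[0, L[%R &, injective gam}].

(* Integral with respect to arc length. *)
Definition curve_integral {R : realType} (gam : R -> R[i]) (L : R)
    (f : R[i] -> R[i]) : R[i] :=
  cintegral 0 L (fun s => f (gam s)).

Definition curve_derive {R : realType} (gam : R -> R[i]) (n : nat)
    (phi : R[i] -> R[i]) : R -> R[i] :=
  cderiven n (fun s => phi (gam s)).

(* Only the restriction of [phi] to the curve matters.  As [gam] is periodic
   and [s], [t] range over the whole line, the smallest such [A] is the Holder
   constant for the geodesic (arc-length) distance on the curve. *)
Definition holder {R : realType} (gam : R -> R[i]) (N : nat) (beta : R)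
    (phi : R[i] -> R[i]) : Prop :=
  cderivable_n N (fun s => phi (gam s)) /\
  exists A : R, forall s t : R,
    cmod (curve_derive gam N phi s - curve_derive gam N phi t)
      <= A * `|s - t| `^ beta.

Definition curve_sup_norm {R : realType} (f : R -> R[i]) : R :=
  sup [set cmod (f s) | s in [set: R]].

Definition holder_seminorm {R : realType} (beta : R) (f : R -> R[i]) : R :=
  sup [set cmod (f st.1 - f st.2) / `|st.1 - st.2| `^ beta
      | st in [set st : R * R | st.1 != st.2]].

Definition holder_norm {R : realType} (gam : R -> R[i]) (N : nat) (beta : R)
    (phi : R[i] -> R[i]) : R :=
  (\sum_(j < N.+1) curve_sup_norm (curve_derive gam j phi))
  + holder_seminorm beta (curve_derive gam N phi).

Definition euler_gamma {R : realType} : R :=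
  limn (fun n : nat => (\sum_(1 <= j < n.+1) (j%:R)^-1) - ln n%:R).

(* Digamma function at positive integers: [digammaS n] is psi(n + 1). *)
Definition digammaS {R : realType} (n : nat) : R :=
  (\sum_(1 <= j < n.+1) (j%:R)^-1) - euler_gamma.

Definition besselJ {R : realType} (l : nat) (x : R) : R :=
  limn (series (fun m : nat =>
    (-1) ^+ m / (m`! * (m + l)`!)%:R * (x / 2) ^+ (m.*2 + l))).

(* Bessel function of the second kind, x > 0 (DLMF 10.8.1). *)
Definition besselY {R : realType} (l : nat) (x : R) : R :=
  2 / pi * ln (x / 2) * besselJ l x
  - pi^-1 * (\sum_(m < l) (l - m.+1)`!%:R / m`!%:R
               * (x / 2) ^+ m.*2 / (x / 2) ^+ l)
  - pi^-1 * limn (series (fun m : nat =>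
      (digammaS m + digammaS (m + l)) *
      ((-1) ^+ m / (m`! * (m + l)`!)%:R * (x / 2) ^+ (m.*2 + l)))).

Definition hankel1 {R : realType} (l : nat) (x : R) : R[i] :=
  besselJ l x +i* besselY l x.

(* The value on the diagonal is junk. *)
Definition helmholtzG {R : realType} (k : R) (x y : R[i]) : R[i] :=
  (0 +i* 4^-1) * hankel1 0 (k * cmod (x - y)).

Definition multipole_coeff {R : realType} (gam : R -> R[i]) (L k : R)
    (phi : R[i] -> R[i]) (l : int) : R[i] :=
  (0 +i* 4^-1) * curve_integral gam L (fun y =>
    hankel1 `|l|%N (k * cmod y) * expi (- (l%:~R * carg y)) * phi y).

(* Partial sum over l = -N, ..., N at the point [r * expi theta]; the index
   [j] stands for l = j - N. *)
Definition local_expansion {R : realType} (gam : R -> R[i]) (L k : R)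
    (phi : R[i] -> R[i]) (N : nat) (r theta : R) : R[i] :=
  \sum_(j < N.*2.+1) let l : int := j%:Z - N%:Z in
    multipole_coeff gam L k phi l
    * (besselJ `|l|%N (k * r))%:C * expi (l%:~R * theta).

Definition odisk {R : realType} (r : R) : set R[i] := [set z | cmod z < r].

(* Main.v *)
Require Import Defs.
From mathcomp Require Import all_boot all_order all_algebra.
From mathcomp Require Import all_classical all_reals all_analysis.
From mathcomp Require Import measurable_realfun complex.
From mathcomp Require Import ring lra zify.
Set Implicit Arguments.
Unset Strict Implicit.
Unset Printing Implicit Defensive.
Import Order.TTheory GRing.Theory Num.Theory.
Import numFieldNormedType.Exports.
Local Open Scope classical_set_scope.
Local Open Scope ring_scope.
Local Open Scope complex_scope.

(** The sum in the theorem is the truncation of Graf's addition theorem,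
    integrated against phi. Estimating the discarded terms one by one would
    require bounds on the coefficients of all orders; the proof is instead a
    Taylor argument along the radius from the centre to the boundary point.

    Write A_p(z) for the outgoing multipole H_p(k|z|) (conj z / |z|)^p and
    w_l(t) for the regular wave of order l at the point t x0 of the radius. The
    classical recurrences for Bessel functions say that the derivative of A_p
    in the direction d is (k / 2) (conj d A_(p-1) - d A_(p+1)), and the regular
    waves obey the same rule ([multipole_der]). Let f_p(t) be the layer
    potential with kernel A_p at t x0, and let E_(p,n)(t) be f_p(t) minus the
    sum of f_(p+l)(0) w_l(t) over |l| < n. The ladder relations give
    E_(p,n+1)(0) = 0 and E_(p,n+1)' = (k / 2) (conj x0 E_(p-1,n) - x0 E_(p+1,n))
    up to boundary terms of the same size ([remainder_der]). As |x0| = r, each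
    integration along the radius gains a factor r, and N + 1 of them give the
    claim for E_(0,N+1) ([remainder_le]).

    The induction starts from E_(p,0) = f_p, which has to be bounded by the
    Holder norm of the density for |p| <= N + 1, uniformly in t < 1. This is
    where smoothness enters ([potentialZ_le]). The curve has unit speed, so an
    integration by parts along it trades one order of the kernel for one
    derivative of the density ([potential_raise]). This leaves the logarithmic
    kernel of order 0 and the kernel of order 1, for which a Holder continuous
    density suffices ([potential1_le]). Negative orders follow by reflecting
    the curve ([potentialN]). The bounds are uniform in t because the chord-arc
    inequality ([chord_arc]) compares the kernels with explicit singularities
    of the line, and uniform in the position of the centre because the kernels
    only depend on differences.

    Finally t tends to 1 by dominated convergence ([potential0_boundary]), and
    polar coordinates identify the products f_l(0) w_l(1) with the terms of the
    expansion ([multipole_besH_hankel], [regular_wave_besselJ]). *)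

(** * Complex numbers and complex functions of a real variable *)

Section ComplexArithmetic.
Variable R : realType.
Implicit Types (x y z w : R[i]) (a b : R).

Lemma cReD x y : complex.Re (x + y) = complex.Re x + complex.Re y.
Proof. by case: x y => [? ?] [? ?]. Qed.
Lemma cImD x y : complex.Im (x + y) = complex.Im x + complex.Im y.
Proof. by case: x y => [? ?] [? ?]. Qed.
Lemma cReN x : complex.Re (- x) = - complex.Re x.
Proof. by case: x. Qed.
Lemma cImN x : complex.Im (- x) = - complex.Im x.
Proof. by case: x. Qed.
Lemma cReM x y : complex.Re (x * y) =
  complex.Re x * complex.Re y - complex.Im x * complex.Im y.
Proof. by case: x y => [? ?] [? ?]. Qed.
Lemma cImM x y : complex.Im (x * y) =
  complex.Re x * complex.Im y + complex.Im x * complex.Re y.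
Proof. by case: x y => [? ?] [? ?]. Qed.
Lemma cReJ x : complex.Re (conjc x) = complex.Re x.
Proof. by case: x. Qed.
Lemma cImJ x : complex.Im (conjc x) = - complex.Im x.
Proof. by case: x. Qed.

Definition ReImE := (cReD, cImD, cReN, cImN, cReM, cImM, cReJ, cImJ).

Lemma complex_ext x y :
  complex.Re x = complex.Re y -> complex.Im x = complex.Im y -> x = y.
Proof. by case: x y => [? ?] [? ?] /= -> ->. Qed.

Lemma cmod0 : cmod (0 : R[i]) = 0.
Proof. exact: ComplexField.Normc.normc0. Qed.
Lemma cmod1 : cmod (1 : R[i]) = 1.
Proof. exact: ComplexField.Normc.normc1. Qed.
Lemma cmodM x y : cmod (x * y) = cmod x * cmod y.
Proof. exact: ComplexField.Normc.normcM. Qed.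
Lemma cmodV x : cmod x^-1 = (cmod x)^-1.
Proof. exact: ComplexField.Normc.normcV. Qed.
Lemma cmodN x : cmod (- x) = cmod x.
Proof. exact: normcN. Qed.
Lemma cmodD x y : cmod (x + y) <= cmod x + cmod y.
Proof. exact: le_normcD. Qed.
Lemma cmodB x y : cmod (x - y) <= cmod x + cmod y.
Proof. by rewrite -(cmodN y) cmodD. Qed.
Lemma cmod_ge0 x : 0 <= cmod x.
Proof. by case: x => a b; rewrite /cmod /= sqrtr_ge0. Qed.
Lemma cmod_eq0 x : (cmod x == 0) = (x == 0).
Proof.
apply/eqP/eqP => [|->]; last exact: cmod0.
exact: ComplexField.Normc.eq0_normc.
Qed.
Lemma cmod_gt0 x : (0 < cmod x) = (x != 0).
Proof. by rewrite lt_def cmod_ge0 andbT cmod_eq0. Qed.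
Lemma cmodX x n : cmod (x ^+ n) = cmod x ^+ n.
Proof. by elim: n => [|n IH]; rewrite ?expr0 ?cmod1// !exprS cmodM IH. Qed.
Lemma cmodJ x : cmod (conjc x) = cmod x.
Proof. by case: x => a b; rewrite /cmod /= sqrrN. Qed.
Lemma cmodC a : cmod a%:C = `|a|.
Proof. by rewrite /cmod /= expr0n addr0 sqrtr_sqr. Qed.
Lemma cmod_sqr x : cmod x ^+ 2 = complex.Re x ^+ 2 + complex.Im x ^+ 2.
Proof. by case: x => a b; rewrite /cmod /= sqr_sqrtr// addr_ge0 ?sqr_ge0. Qed.
Lemma mul_conjc x : x * conjc x = (cmod x ^+ 2)%:C.
Proof.
by apply: complex_ext; rewrite !ReImE /= ?cmod_sqr; ring.
Qed.
Lemma Re_le_cmod x : `|complex.Re x| <= cmod x.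
Proof.
rewrite -(@ler_pXn2r _ 2)// ?nnegrE ?cmod_ge0// cmod_sqr real_normK ?num_real//.
by rewrite lerDl sqr_ge0.
Qed.
Lemma Im_le_cmod x : `|complex.Im x| <= cmod x.
Proof.
rewrite -(@ler_pXn2r _ 2)// ?nnegrE ?cmod_ge0// cmod_sqr real_normK ?num_real//.
by rewrite lerDr sqr_ge0.
Qed.
Lemma cmod_le_ReIm x : cmod x <= `|complex.Re x| + `|complex.Im x|.
Proof.
rewrite -(@ler_pXn2r _ 2)// ?nnegrE ?cmod_ge0 ?addr_ge0// cmod_sqr sqrrD.
rewrite !real_normK ?num_real//.
by rewrite addrAC lerDl mulrn_wge0// mulr_ge0.
Qed.
(** Rotating a number onto the positive real axis reduces estimates of complex
    integrals and increments to real ones. *)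
Lemma cmod_rotation z : exists u : R[i], cmod u = 1 /\ cmod z = complex.Re (u * z).
Proof.
have [->|z0] := eqVneq z 0.
  by exists 1; rewrite cmod1 mulr0 cmod0.
exists (conjc z * ((cmod z)^-1)%:C); split.
  rewrite cmodM cmodJ cmodC ger0_norm ?invr_ge0 ?cmod_ge0// divff//.
  by rewrite cmod_eq0.
rewrite mulrAC [conjc z * z]mulrC mul_conjc -rmorphM /= expr2 -mulrA divff ?mulr1//.
by rewrite cmod_eq0.
Qed.

End ComplexArithmetic.

Section ComplexCalculus.
Variable R : realType.
Implicit Types (f g : R -> R[i]) (s t : R).

Definition cder f s (d : R[i]) : Prop :=
  is_derive s 1 (fun t => complex.Re (f t)) (complex.Re d) /\
  is_derive s 1 (fun t => complex.Im (f t)) (complex.Im d).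

Definition ccont f : Prop :=
  continuous (fun t => complex.Re (f t)) /\ continuous (fun t => complex.Im (f t)).

Lemma cder_cst (c : R[i]) s : cder (fun=> c) s 0.
Proof. by split; apply: is_derive_cst. Qed.

Lemma cder_eq f s d d' : cder f s d -> d = d' -> cder f s d'.
Proof. by move=> ? <-. Qed.

Lemma cder_ext f g s d : f =1 g -> cder f s d -> cder g s d.
Proof. by move=> /funext ->. Qed.

Lemma cderD f g s d e : cder f s d -> cder g s e ->
  cder (fun t => f t + g t) s (d + e).
Proof.
move=> [f1 f2] [g1 g2]; split.
- under eq_fun do rewrite cReD.
  by rewrite cReD; apply: is_deriveD.
- under eq_fun do rewrite cImD.
  by rewrite cImD; apply: is_deriveD.
Qed.

Lemma cderN f s d : cder f s d -> cder (fun t => - f t) s (- d).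
Proof.
move=> [f1 f2]; split.
- under eq_fun do rewrite cReN.
  by rewrite cReN; apply: is_deriveN.
- under eq_fun do rewrite cImN.
  by rewrite cImN; apply: is_deriveN.
Qed.

Lemma cderB f g s d e : cder f s d -> cder g s e ->
  cder (fun t => f t - g t) s (d - e).
Proof. by move=> df dg; apply: cderD => //; exact: cderN. Qed.

Lemma cderM f g s d e : cder f s d -> cder g s e ->
  cder (fun t => f t * g t) s (d * g s + f s * e).
Proof.
move=> [f1 f2] [g1 g2]; split.
- under eq_fun do rewrite cReM.
  apply: is_derive_eq; rewrite !ReImE /= /GRing.scale /=; ring.
- under eq_fun do rewrite cImM.
  apply: is_derive_eq; rewrite !ReImE /= /GRing.scale /=; ring.
Qed.

Lemma cderZ (c : R[i]) f s d : cder f s d -> cder (fun t => c * f t) s (c * d).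
Proof.
move=> df; apply: (cder_eq (cderM (cder_cst c s) df)).
by rewrite mul0r add0r.
Qed.

Lemma cderJ f s d : cder f s d -> cder (fun t => conjc (f t)) s (conjc d).
Proof.
move=> [f1 f2]; split.
- under eq_fun do rewrite cReJ.
  by rewrite cReJ.
- under eq_fun do rewrite cImJ.
  by rewrite cImJ; apply: is_deriveN.
Qed.

Lemma cderX f s d n : cder f s d ->
  cder (fun t => f t ^+ n) s (n%:R * d * f s ^+ n.-1).
Proof.
move=> df; elim: n => [|n IH].
  by rewrite !mul0r; under [X in cder X]funext do rewrite expr0; exact: cder_cst.
have -> : (fun t => f t ^+ n.+1) = (fun t => f t * f t ^+ n).
  by apply/funext => t; rewrite exprS.
apply: (cder_eq (cderM df IH)); case: n {IH} => [|n] /=.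
  by rewrite expr0; ring.
by rewrite exprS -[n.+2]addn1 natrD; ring.
Qed.

Lemma cder_real (f : R -> R) s d : is_derive s 1 f d -> cder (fun t => (f t)%:C) s d%:C.
Proof. by move=> df; split => //=; exact: is_derive_cst. Qed.

Lemma cder_comp (q : R -> R[i]) (v : R -> R) s (d : R[i]) (e : R) :
  cder q (v s) d -> is_derive s 1 v e -> cder (fun t => q (v t)) s (e%:C * d).
Proof.
move=> [q1 q2] dv; split.
- rewrite cReM /= mul0r subr0 mulrC.
  exact: (@is_derive1_comp _ (fun t => complex.Re (q t)) v).
- rewrite cImM /= mul0r addr0 mulrC.
  exact: (@is_derive1_comp _ (fun t => complex.Im (q t)) v).
Qed.

Lemma cder_uniq f s d e : cder f s d -> cder f s e -> d = e.
Proof.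
move=> [[_ d1] [_ d2]] [[_ e1] [_ e2]]; apply: complex_ext.
- by rewrite -d1 -e1.
- by rewrite -d2 -e2.
Qed.

Lemma cder_shift f s a d : cder f (s + a) d -> cder (fun t => f (t + a)) s d.
Proof.
move=> df; have dv : is_derive s 1 (fun t : R => t + a) 1.
  by apply: is_derive_eq; rewrite addr0.
by apply: (cder_eq (cder_comp (v := fun t => t + a) df dv)); rewrite mul1r.
Qed.

Lemma cder_cont f : (forall s, exists d, cder f s d) -> ccont f.
Proof.
move=> df; split => s; have [d [[d1 _] [d2 _]]] := df s.
- by apply: differentiable_continuous; apply/derivable1_diffP.
- by apply: differentiable_continuous; apply/derivable1_diffP.
Qed.

Lemma ccontD f g : ccont f -> ccont g -> ccont (fun t => f t + g t).
Proof.
move=> [f1 f2] [g1 g2]; split => s.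
- by under [X in continuous_at _ X]funext do rewrite cReD; apply: cvgD; [exact: f1|exact: g1].
- by under [X in continuous_at _ X]funext do rewrite cImD; apply: cvgD; [exact: f2|exact: g2].
Qed.

Lemma ccontM f g : ccont f -> ccont g -> ccont (fun t => f t * g t).
Proof.
move=> [f1 f2] [g1 g2]; split => s.
- under [X in continuous_at _ X]funext do rewrite cReM.
  by apply: cvgB; apply: cvgM; [exact: f1|exact: g1|exact: f2|exact: g2].
- under [X in continuous_at _ X]funext do rewrite cImM.
  by apply: cvgD; apply: cvgM; [exact: f1|exact: g2|exact: f2|exact: g1].
Qed.

Lemma ccont_cst (c : R[i]) : ccont (fun=> c).
Proof. by split => s; exact: cvg_cst. Qed.

Lemma ccontB f g : ccont f -> ccont g -> ccont (fun t => f t - g t).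
Proof.
move=> cf cg; have -> : (fun t => f t - g t) = (fun t => f t + (-1) * g t).
  by apply/funext => t; rewrite mulN1r.
by apply: ccontD => //; apply: ccontM => //; exact: ccont_cst.
Qed.

(** Mean value inequality: the real mean value theorem applies to the real part
    of f after the rotation that makes its increment positive. *)
Lemma cder_incr_le f (f' : R -> R[i]) (B a b : R) : a <= b ->
  (forall s, a <= s <= b -> cder f s (f' s)) ->
  (forall s, a <= s <= b -> cmod (f' s) <= B) ->
  cmod (f b - f a) <= B * (b - a).
Proof.
rewrite le_eqVlt => /predU1P[-> _ _|ab df f'B]; first by rewrite !subrr cmod0 mulr0.
have [u [u1 ->]] := cmod_rotation (f b - f a).
pose F s := complex.Re (u * f s).
have dF s : s \in `]a, b[ -> is_derive s 1 F (complex.Re (u * f' s)).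
  rewrite in_itv/= => /andP[/ltW as_ /ltW sb].
  by have [] := cderZ u (df s _); first by rewrite as_ sb.
have cF : {within `[a, b], continuous F}.
  apply: derivable_within_continuous => s; rewrite in_itv /= => /df /(cderZ u)[[]].
  by [].
have [c cab] := MVT ab dF cF.
have -> : complex.Re (u * (f b - f a)) = F b - F a by rewrite mulrBr cReD cReN.
move=> ->; rewrite ler_wpM2r ?subr_ge0 ?(ltW ab)//.
apply: (le_trans (ler_norm _)); apply: (le_trans (Re_le_cmod _)).
rewrite cmodM u1 mul1r f'B//; move: cab; rewrite in_itv /= => /andP[/ltW-> /ltW->//].
Qed.

End ComplexCalculus.

(** * Componentwise integrals *)

Section ComplexIntegral.
Variable R : realType.
Notation mu := (@lebesgue_measure R).
Implicit Types (f g : R -> R[i]) (a b s t : R).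

Lemma continuous_itv_integrable (h : R -> R) a b : continuous h ->
  mu.-integrable `[a, b] (EFin \o h).
Proof.
move=> ch; apply: continuous_compact_integrable; first exact: segment_compact.
exact: continuous_subspaceT.
Qed.

Lemma cintegralD a b f g : ccont f -> ccont g ->
  cintegral a b (fun s => f s + g s) = cintegral a b f + cintegral a b g.
Proof.
move=> [f1 f2] [g1 g2]; apply: complex_ext; rewrite ?cReD ?cImD /=.
- rewrite -RintegralD//; try exact: continuous_itv_integrable.
  by apply: eq_Rintegral => s _; rewrite cReD.
- rewrite -RintegralD//; try exact: continuous_itv_integrable.
  by apply: eq_Rintegral => s _; rewrite cImD.
Qed.

Definition cintegrable a b f : Prop :=
  mu.-integrable `[a, b] (EFin \o (fun s => complex.Re (f s))) /\
  mu.-integrable `[a, b] (EFin \o (fun s => complex.Im (f s))).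

Lemma ccont_integrable a b f : ccont f -> cintegrable a b f.
Proof. by move=> [f1 f2]; split; exact: continuous_itv_integrable. Qed.

Lemma cintegrableZl a b (c : R[i]) f : cintegrable a b f ->
  cintegral a b (fun s => c * f s) = c * cintegral a b f.
Proof.
move=> [I1 I2].
have mI := measurable_itv `[a, b] : measurable (`[a, b]%classic : set (measurableTypeR R)).
have Z1 e : mu.-integrable `[a, b] (EFin \o (fun s => e * complex.Re (f s))).
  exact: (integrableZl mI e I1).
have Z2 e : mu.-integrable `[a, b] (EFin \o (fun s => e * complex.Im (f s))).
  exact: (integrableZl mI e I2).
apply: complex_ext; [rewrite [RHS]cReM | rewrite [RHS]cImM]; rewrite /cintegral /=.
- by rewrite -!RintegralZl// -RintegralB//; apply: eq_Rintegral => s _; rewrite cReM.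
- by rewrite -!RintegralZl// -RintegralD//; apply: eq_Rintegral => s _; rewrite cImM.
Qed.

Lemma cintegralZ a b (c : R[i]) f : ccont f ->
  cintegral a b (fun s => c * f s) = c * cintegral a b f.
Proof. by move=> cf; apply: cintegrableZl; exact: ccont_integrable. Qed.

Lemma cintegralB a b f g : ccont f -> ccont g ->
  cintegral a b (fun s => f s - g s) = cintegral a b f - cintegral a b g.
Proof.
move=> cf cg; have -> : (fun s => f s - g s) = (fun s => f s + (-1) * g s).
  by apply/funext => s; rewrite mulN1r.
rewrite cintegralD//; last by apply: ccontM => //; exact: ccont_cst.
by rewrite cintegralZ// mulN1r.
Qed.

Lemma Rintegral_derivative a b (h H : R -> R) : a < b -> continuous h ->
  (forall s, is_derive s 1 H (h s)) -> \int[mu]_(s in `[a, b]) h s = H b - H a.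
Proof.
move=> ab ch dH.
have cH : continuous H.
  by move=> s; apply: differentiable_continuous; apply/derivable1_diffP; case: (dH s).
rewrite /Rintegral (@continuous_FTC2 _ h H a b)//.
- exact: continuous_subspaceT.
- split.
  + by move=> s _; have [] := dH s.
  + by apply: cvg_at_right_filter; exact: cH.
  + by apply: cvg_at_left_filter; exact: cH.
- by move=> s _; rewrite derive1E; case: (dH s).
Qed.

Lemma cintegral_derivative a b (f F : R -> R[i]) : a < b -> ccont f ->
  (forall s, cder F s (f s)) -> cintegral a b f = F b - F a.
Proof.
move=> ab [f1 f2] dF; apply: complex_ext; rewrite ?cReD ?cImD ?cReN ?cImN /=.
- exact: (Rintegral_derivative ab f1 (fun s => (dF s).1)).
- exact: (Rintegral_derivative ab f2 (fun s => (dF s).2)).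
Qed.

(** The primitive H is supplied along with h so that, in the applications, the
    bound is read off from the size of H and not from an integral. *)
Lemma cintegral_le a b f (h H : R -> R) : a < b -> ccont f -> continuous h ->
  (forall s, is_derive s 1 H (h s)) ->
  (forall s, a <= s <= b -> cmod (f s) <= h s) ->
  cmod (cintegral a b f) <= H b - H a.
Proof.
move=> ab cf ch dH fh.
have [u [u1 ->]] := cmod_rotation (cintegral a b f).
rewrite -cintegralZ// -(Rintegral_derivative ab ch dH) /=.
have [c1 _] := ccontM (ccont_cst u) cf.
apply: le_Rintegral => //; try exact: continuous_itv_integrable.
move=> s /=; rewrite in_itv /= => sab.
apply: (le_trans (ler_norm _)); apply: (le_trans (Re_le_cmod _)).
by rewrite cmodM u1 mul1r fh.
Qed.

End ComplexIntegral.

(** * Entire power series *)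

Section EntireSeries.
Variable R : realType.
Implicit Types (c d : nat -> R) (v s t : R).

(** A one-constructor inductive and not a bare limit, so that applying lemmas
    never unfolds the convergence into a statement about filters. *)
Variant psum c v s : Prop :=
  Psum of (fun n => \sum_(0 <= m < n) c m * v ^+ m) @ \oo --> s.

Definition fast c := exists C : R, forall m, `|c m| <= C / m`!%:R.

Lemma psum_uniq c v s t : psum c v s -> psum c v t -> s = t.
Proof. by move=> [h1] [h2]; apply: cvg_unique h1 h2. Qed.

Lemma psumE c v s : psum c v s -> limn (pseries c v) = s.
Proof. by move=> [h]; apply/cvg_lim => //; exact: h. Qed.

Lemma psumD c d v s t : psum c v s -> psum d v t -> psum (fun m => c m + d m) v (s + t).
Proof.
move=> [h1] [h2]; split; rewrite [X in X @ \oo --> _](_ : _ = (fun n =>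
  \sum_(0 <= m < n) c m * v ^+ m + \sum_(0 <= m < n) d m * v ^+ m)).
  exact: cvgD.
by apply/funext => n; rewrite -big_split; apply: eq_bigr => i _; rewrite mulrDl.
Qed.

Lemma psumZ c v s (a : R) : psum c v s -> psum (fun m => a * c m) v (a * s).
Proof.
move=> [h1]; split; rewrite [X in X @ \oo --> _](_ : _ =
  (fun n => a * \sum_(0 <= m < n) c m * v ^+ m)).
  by apply: cvgM => //; exact: cvg_cst.
by apply/funext => n; rewrite mulr_sumr; apply: eq_bigr => i _; rewrite mulrA.
Qed.

Definition shift_coef c m := if m is m'.+1 then c m' else 0.

Lemma psum_shift c v s : psum c v s -> psum (shift_coef c) v (v * s).
Proof.
move=> [h]; split; rewrite -cvg_shiftS.
rewrite [X in X @ \oo --> _](_ : _ =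
  (fun n => v * \sum_(0 <= m < n) c m * v ^+ m)).
  by apply: cvgM => //; exact: cvg_cst.
apply/funext => n /=; rewrite big_nat_recl//= mul0r add0r mulr_sumr.
by apply: eq_bigr => i _; rewrite exprS mulrCA.
Qed.

Lemma psum_delta (a v : R) : psum (fun m => if m is 0%N then a else 0) v a.
Proof.
split; rewrite -cvg_shiftS [X in X @ \oo --> _](_ : _ = (fun=> a)).
  exact: cvg_cst.
apply/funext => n /=; rewrite big_nat_recl//= expr0 mulr1 big1 ?addr0//.
by move=> i _; rewrite mul0r.
Qed.

Lemma fast_term_le c C v m : (forall m, `|c m| <= C / m`!%:R) ->
  `|c m * v ^+ m| <= C * exp_coeff `|v| m.
Proof.
by move=> hC; rewrite normrM normrX /exp_coeff /= mulrA mulrAC ler_wpM2r ?exprn_ge0.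
Qed.

Lemma fast_normed_cvg c v : fast c -> cvgn (series (fun m => `|c m * v ^+ m|)).
Proof.
move=> [C hC]; apply: (@series_le_cvg _ _ (fun m => C * exp_coeff `|v| m)).
- by move=> n; exact: normr_ge0.
- by move=> n; apply: le_trans (fast_term_le v n hC).
- by move=> n; exact: fast_term_le.
- by apply: is_cvg_seriesZ; exact: is_cvg_series_exp_coeff.
Qed.

Lemma fast_psum c v : fast c -> psum c v (limn (pseries c v)).
Proof.
move=> fc; have h := @normed_cvg R R^o (fun m => c m * v ^+ m) (fast_normed_cvg fc).
by split; exact: h.
Qed.

(** Comparison with the exponential series, term by term. *)
Lemma fast_psum_le c : fast c ->
  exists C : R, forall v, `|limn (pseries c v)| <= C * expR `|v|.
Proof.
move=> fc; have [C hC] := fc; exists C => w.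
have h := @lim_series_norm R R^o (fun m => c m * w ^+ m) (fast_normed_cvg fc).
apply: le_trans h _.
have -> : C * expR `|w| = limn (series (C *: exp_coeff `|w|)).
  by rewrite lim_seriesZ//; exact: is_cvg_series_exp_coeff.
apply: lim_series_le; first exact: fast_normed_cvg.
  by apply: is_cvg_seriesZ; exact: is_cvg_series_exp_coeff.
by move=> n; exact: fast_term_le.
Qed.

Lemma fast_diffs c : fast c -> fast (pseries_diffs c).
Proof.
move=> [C hC]; exists C => m; rewrite /pseries_diffs normrM ger0_norm//.
apply: le_trans (ler_wpM2l _ (hC m.+1)) _ => //.
by rewrite factS natrM invfM mulrCA mulVKf// pnatr_eq0.
Qed.

Lemma is_derive_pseries c v : fast c ->
  is_derive v 1 (fun x => limn (pseries c x)) (limn (pseries (pseries_diffs c) v)).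
Proof.
move=> fc; apply: (@pseries_snd_diffs _ c (`|v| + 1)).
- by have [h] := fast_psum (`|v| + 1) fc; exact: cvgP h.
- by have [h] := fast_psum (`|v| + 1) (fast_diffs fc); exact: cvgP h.
- by have [h] := fast_psum (`|v| + 1) (fast_diffs (fast_diffs fc)); exact: cvgP h.
- by rewrite [ltRHS]ger0_norm ?ltrDl// addr_ge0.
Qed.

End EntireSeries.
Arguments fast_psum {R c} v _.

(** * Bessel functions as functions of v = (x / 2)^2 *)

Section BesselSeries.
Variable R : realType.
Implicit Types (l m : nat) (v : R).

Definition besA_coef l m : R := (-1) ^+ m / (m`! * (m + l)`!)%:R.
Definition besB_coef l m : R := (digammaS m + digammaS (m + l)) * besA_coef l m.

(** [besA l v] and [besY l v] are the functions J_l(x) / u^l and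
    pi * Y_l(x) / u^l of v = u^2, where u = x / 2. *)
Definition besA l v : R := limn (pseries (besA_coef l) v).
Definition besB l v : R := limn (pseries (besB_coef l) v).
Definition besY l v : R :=
  ln v * besA l v - \sum_(m < l) (l - m.+1)`!%:R / m`!%:R * v ^- (l - m) - besB l v.

Let fact_neq0 m : m`!%:R != 0 :> R.
Proof. by rewrite pnatr_eq0 -lt0n fact_gt0. Qed.

Let natS_neq0 m : m.+1%:R != 0 :> R.
Proof. by rewrite pnatr_eq0. Qed.

Lemma besA_coef_norm l m : `|besA_coef l m| = (m`!%:R)^-1 / (m + l)`!%:R.
Proof.
rewrite /besA_coef normrM normrX normrN1 expr1n mul1r natrM invfM ger0_norm//.
Qed.

Lemma besA_coef_fast l : fast (besA_coef l).
Proof.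
exists 1 => m; rewrite besA_coef_norm mul1r ler_piMr// ?invr_ge0//.
by rewrite invf_le1 ?ler1n ?ltr0n ?fact_gt0.
Qed.

(** Linear growth is all that is needed: one factorial in the coefficients of
    [besB] absorbs it. *)
Lemma digammaS_le m : `|digammaS m : R| <= m%:R + `|euler_gamma|.
Proof.
apply: le_trans (ler_normB _ _) _; rewrite lerD2r ger0_norm; last first.
  by apply: sumr_ge0 => i _; rewrite invr_ge0.
elim: m => [|m IH]; first by rewrite big_geq.
rewrite big_nat_recr//= -[leRHS]natr1 lerD//.
by rewrite invf_le1 ?ltr0n// ler1n.
Qed.

Lemma digammaS_S m : digammaS m.+1 = digammaS m + (m.+1%:R)^-1 :> R.
Proof. by rewrite /digammaS big_nat_recr//= addrAC. Qed.

Lemma besB_coef_fast l : fast (besB_coef l).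
Proof.
pose E := `|euler_gamma : R|; exists (2 + 2 * E) => m.
rewrite /besB_coef normrM besA_coef_norm mulrCA [leRHS]mulrC ler_wpM2l ?invr_ge0//.
have f0 : 0 < (m + l)`!%:R :> R by rewrite ltr0n fact_gt0.
rewrite ler_pdivrMr//; apply: le_trans (ler_normD _ _) _.
apply: le_trans (lerD (digammaS_le _) (digammaS_le _)) _; rewrite -/E.
have h1 : (m + l)%:R <= (m + l)`!%:R :> R.
  by rewrite ler_nat; case: (m + l)%N => // n; rewrite factS leq_pmulr// fact_gt0.
have h2 : m%:R <= (m + l)%:R :> R by rewrite ler_nat leq_addr.
have h3 : E <= E * (m + l)`!%:R by rewrite ler_peMr ?normr_ge0// ler1n fact_gt0.
set F := (m + l)`!%:R in f0 h1 h3 *; lra.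
Qed.

Lemma besA_diffs l : pseries_diffs (besA_coef l) = (fun m => -1 * besA_coef l.+1 m).
Proof.
apply/funext => m; rewrite /pseries_diffs /besA_coef addSnnS factS !natrM exprS.
have := natS_neq0 m; have := fact_neq0 m; have := fact_neq0 (m + l.+1).
move: m.+1%:R m`!%:R (m + l.+1)`!%:R => M a b b0 a0 M0.
by field; rewrite M0 a0 b0.
Qed.

(** In the variable v the factor u^l disappears and raising the order becomes a
    plain differentiation. *)
Lemma besA_der l v : is_derive v 1 (besA l) (- besA l.+1 v).
Proof.
apply: is_derive_eq; first exact: (is_derive_pseries v (besA_coef_fast l)).
rewrite besA_diffs -[RHS]mulN1r.
exact: (psumE (psumZ (-1) (fast_psum v (besA_coef_fast l.+1)))).
Qed.

(** The part of the derivative of [besB l] coming from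
    psi(m + 2) - psi(m + 1) = 1 / (m + 1). *)
Let besD_coef l m : R := (-1) ^+ m / (m.+1`! * (m + l.+1)`!)%:R.

Let besD_fast l : fast (besD_coef l).
Proof.
exists 1 => m; rewrite /besD_coef normrM normrX normrN1 expr1n ger0_norm ?invr_ge0//.
rewrite !mul1r lef_pV2 ?posrE ?ltr0n ?muln_gt0 ?fact_gt0// ler_nat.
by rewrite -[leqLHS]muln1 leq_mul ?fact_gt0// factS leq_pmull.
Qed.

Let besD l v : v != 0 -> limn (pseries (besD_coef l) v) = (l`!%:R^-1 - besA l v) / v.
Proof.
move=> v0; apply: (mulfI v0); rewrite mulrCA divff// mulr1.
have h1 := psum_shift (fast_psum v (besD_fast l)).
have h2 := psumD (psum_delta (l`!%:R^-1 : R) v) (psumZ (-1) (fast_psum v (besA_coef_fast l))).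
rewrite -[X in _ + X]mulN1r; apply: (psum_uniq h1); rewrite (_ : shift_coef _ = fun m =>
  (if m is 0%N then l`!%:R^-1 else 0) + -1 * besA_coef l m)//.
apply/funext => -[|m]/=.
  by rewrite /besA_coef expr0 fact0 mul1n add0n !mul1r mulN1r subrr.
by rewrite /besA_coef /besD_coef add0r addSnnS exprS mulrA !mulN1r opprK.
Qed.

Lemma besB_diffs l :
  pseries_diffs (besB_coef l) = (fun m => -1 * besB_coef l.+1 m + -1 * besD_coef l m).
Proof.
apply/funext => m; rewrite /pseries_diffs /besB_coef.
have -> : besD_coef l m = (m.+1%:R)^-1 * besA_coef l.+1 m.
  by rewrite /besD_coef /besA_coef factS -mulnA natrM invfM mulrCA.
have := congr1 (fun f => f m) (besA_diffs l); rewrite /pseries_diffs /= => e.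
by rewrite mulrCA e digammaS_S addSnnS; ring.
Qed.

(** The term [besA l v / v] cancels the one produced by the derivative of [ln] in
    [besY], and [(l`! v)^-1] is the new term of the finite sum. *)
Lemma besB_der l v : v != 0 ->
  is_derive v 1 (besB l) (- besB l.+1 v - (l`!%:R^-1 - besA l v) / v).
Proof.
move=> v0; apply: is_derive_eq; first exact: (is_derive_pseries v (besB_coef_fast l)).
rewrite besB_diffs -(besD l v0) -[X in X - _]mulN1r -[X in _ + X]mulN1r.
exact: (psumE (psumD (psumZ (-1) (fast_psum v (besB_coef_fast l.+1)))
  (psumZ (-1) (fast_psum v (besD_fast l))))).
Qed.

Lemma besY_der l v : 0 < v -> is_derive v 1 (besY l) (- besY l.+1 v).
Proof.
move=> v_gt0; have v0 : v != 0 by rewrite gt_eqF.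
have dA := besA_der l v; have dB := besB_der l v0; have dl := is_derive1_ln v_gt0.
have dS : is_derive v 1 (fun v => \sum_(m < l) (l - m.+1)`!%:R / m`!%:R * v ^- (l - m))
    (\sum_(m < l) - ((l - m)`!%:R / m`!%:R * v ^- (l.+1 - m))).
  have -> : (fun v => \sum_(m < l) (l - m.+1)`!%:R / m`!%:R * v ^- (l - m)) =
            \sum_(m < l) (fun v : R => (l - m.+1)`!%:R / m`!%:R * v ^- (l - m)).
    by apply/funext => x; rewrite fct_sumE.
  apply: is_derive_sum => m.
  have vX : v ^+ (l - m) != 0 by rewrite expf_neq0.
  have dX := is_deriveX (l - m) (is_derive_id v (1 : R)).
  rewrite exprfctE in dX; have dV := @is_deriveV R (fun x => x ^+ (l - m)) v _ 1 vX dX.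
  apply: (is_derive_eq (is_deriveZ ((l - m.+1)`!%:R / m`!%:R) dV)).
  have lm : (l - m = (l - m.+1).+1)%N by rewrite subnSK.
  rewrite subSn ?(ltnW (ltn_ord m))// lm factS natrM /GRing.scale /= !exprS ?expr0.
  have := expf_neq0 (l - m.+1) v0; have := fact_neq0 m.
  move: (v ^+ (l - m.+1)) (l - m.+1).+1%:R (l - m.+1)`!%:R m`!%:R => P a b c c0 P0.
  by field; rewrite v0 c0 P0.
rewrite /besY.
have := is_deriveB (is_deriveB (is_deriveM dl dA) dS) dB.
move=> h; apply: (is_derive_eq h); rewrite /GRing.scale /=.
rewrite big_ord_recr/= subnn fact0 subSnn expr1.
under [in RHS]eq_bigr do rewrite subSS.
rewrite sumrN; set S := \sum_(i < l) _.
by field; rewrite v0 fact_neq0.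
Qed.

Lemma besA_rec0 v : besA 0 v = besA 1 v - v * besA 2 v.
Proof.
apply: psumE; rewrite -[X in _ + X]mulN1r.
have h := psumD (fast_psum v (besA_coef_fast 1))
  (psumZ (-1) (psum_shift (fast_psum v (besA_coef_fast 2)))).
rewrite (_ : besA_coef 0 = fun m => besA_coef 1 m + -1 * shift_coef (besA_coef 2) m)//.
apply/funext => -[|m]; first by rewrite /besA_coef /= mulr0 addr0.
rewrite /= /besA_coef addn0 addn1 addn2 !factS !natrM exprS -[m.+2%:R]natr1.
have := natS_neq0 m.+1; have := natS_neq0 m; have := fact_neq0 m.
rewrite -[m.+2%:R]natr1; move: m.+1%:R m`!%:R => M a a0 M0 M1.
by field; rewrite M0 a0 M1.
Qed.

(** The additive 1 is cancelled by the finite sums of [besY 1] and [besY 2]. *)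
Lemma besB_rec0 v : besB 0 v + 1 = besB 1 v - v * besB 2 v.
Proof.
apply: (@psum_uniq _ (fun m => besB_coef 0 m + (if m is 0%N then 1 else 0)) v).
  exact: psumD (fast_psum v (besB_coef_fast 0)) (psum_delta 1 v).
have h := psumD (fast_psum v (besB_coef_fast 1))
  (psumZ (-1) (psum_shift (fast_psum v (besB_coef_fast 2)))).
rewrite -[X in _ + X]mulN1r (_ : (fun m => besB_coef 0 m + _) =
  fun m => besB_coef 1 m + -1 * shift_coef (besB_coef 2) m)//.
apply/funext => -[|m].
  rewrite /besB_coef /besA_coef add0n digammaS_S [shift_coef _ _]/= mulr0 addr0.
  by rewrite add0n !factS !fact0 !muln1 expr0 invr1 !mulr1; ring.
rewrite /= /besB_coef /besA_coef addn0 addn1 addn2 !digammaS_S !factS !natrM exprS.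
have := natS_neq0 m.+1; have := natS_neq0 m; have := fact_neq0 m.
rewrite -[m.+2%:R]natr1; move: m.+1%:R m`!%:R => M a a0 M0 M1.
by field; rewrite M0 a0 M1.
Qed.

Lemma besY_rec0 v : 0 < v -> besY 0 v = besY 1 v - v * besY 2 v.
Proof.
move=> v0; have := besA_rec0 v; have := besB_rec0 v.
rewrite /besY !big_ord_recr !big_ord0 /= !add0r !subn0 !subnn !subnS !fact0 /= !expr1.
rewrite -[1`!]/1%N => hB hA.
have -> : besB 0 v = besB 1 v - v * besB 2 v - 1 by rewrite -hB addrK.
by rewrite hA; field; rewrite gt_eqF.
Qed.

(** Differentiating the three-term relation of order l gives that of order
    l + 1, so only the case l = 0 needs the coefficients. *)
Lemma three_term_relation (q : nat -> R -> R) :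
  (forall l v, 0 < v -> is_derive v 1 (q l) (- q l.+1 v)) ->
  (forall v, 0 < v -> q 0 v = q 1 v - v * q 2 v) ->
  forall l v, 0 < v -> q l v = l.+1%:R * q l.+1 v - v * q l.+2 v.
Proof.
move=> dq q0; elim=> [|l IH] v v0; first by rewrite mul1r q0.
have h1 : is_derive v 1 (fun x => l.+1%:R * q l.+1 x - x * q l.+2 x)
    (l.+1%:R * - q l.+2 v - (q l.+2 v + v * - q l.+3 v)).
  have d1 := dq l.+1 v v0; have d2 := dq l.+2 v v0.
  apply: is_derive_eq; rewrite /GRing.scale /=; ring.
have h2 : is_derive v 1 (q l) (l.+1%:R * - q l.+2 v - (q l.+2 v + v * - q l.+3 v)).
  apply: near_eq_is_derive h1; near=> x; rewrite IH//.
  by near: x; exact: lt_nbhsr.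
have [_ e1] := h2; have [_ e2] := dq l v v0.
have e := etrans (esym e2) e1.
by rewrite -[LHS]opprK e -[l.+2]addn1 natrD; ring.
Unshelve. all: by end_near. Qed.

Lemma besY_rec l v : 0 < v -> besY l v = l.+1%:R * besY l.+1 v - v * besY l.+2 v.
Proof. by move=> v0; exact: (three_term_relation besY_der besY_rec0). Qed.

Lemma besA_rec l v : 0 < v -> besA l v = l.+1%:R * besA l.+1 v - v * besA l.+2 v.
Proof.
move=> v0; apply: (@three_term_relation besA _ _ l v v0).
- by move=> j w _; exact: besA_der.
- by move=> w _; exact: besA_rec0.
Qed.

End BesselSeries.

(** * Bounds for Bessel and Hankel functions *)

Section BesselBounds.
Variable R : realType.
Implicit Types (l m : nat) (v : R).

Section Energy.
Variable q : nat -> R -> R.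
Hypothesis q_der : forall l v, 0 < v -> is_derive v 1 (q l) (- q l.+1 v).
Hypothesis q_rec : forall l v, 0 < v -> q l v = l.+1%:R * q l.+1 v - v * q l.+2 v.

Let E v := q 0 v ^+ 2 + v * q 1 v ^+ 2.

Let E_der v : 0 < v -> is_derive v 1 E (- q 1 v ^+ 2).
Proof.
move=> v0; have d0 := q_der 0 v0; have d1 := q_der 1 v0; have r := q_rec 0 v0.
have {}r : v * q 2 v = q 1 v - q 0 v by rewrite r mul1r; ring.
apply: is_derive_eq; rewrite /GRing.scale /=.
transitivity ((-2 * q 1 v) * (v * q 2 v) + q 1 v ^+ 2 - 2 * q 0 v * q 1 v); first by ring.
by rewrite r; ring.
Qed.

(** The Bessel equation dissipates the energy E = q_0^2 + v q_1^2, whence bounds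
    at infinity without any asymptotic expansion. *)
Let E_nincr v w : 0 < v -> v <= w -> E w <= E v.
Proof.
move=> v0; rewrite le_eqVlt => /predU1P[->//|vw].
have dE x : x \in `]v, w[ -> is_derive x 1 E (- q 1 x ^+ 2).
  by rewrite in_itv /= => /andP[vx _]; apply: E_der; exact: lt_trans vx.
have cE : {within `[v, w], continuous E}.
  apply: derivable_within_continuous => x; rewrite in_itv /= => /andP[vx _].
  by have [] := E_der (lt_le_trans v0 vx).
have [x _ e] := MVT vw dE cE.
rewrite -subr_le0 e mulNr oppr_le0 mulr_ge0 ?sqr_ge0// subr_ge0; exact: ltW.
Qed.

Let normr_le_sqr (x C : R) : x ^+ 2 <= C -> `|x| <= 1 + C.
Proof.
move=> h; have := sqr_ge0 (`|x| - 1); rewrite sqrrB1 real_normK ?num_real// => h2.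
by have := normr_ge0 x; lra.
Qed.

(** The energy bounds the orders 0 and 1, and the three-term relation then
    raises the order by induction. *)
Lemma bessel_far_bound (d : R) l : 0 < d ->
  exists C : R, forall v, d <= v -> Num.sqrt v ^+ l * `|q l v| <= C.
Proof.
move=> d0; suff : (exists C : R, forall v, d <= v -> Num.sqrt v ^+ l * `|q l v| <= C)
  /\ (exists C : R, forall v, d <= v -> Num.sqrt v ^+ l.+1 * `|q l.+1 v| <= C) by case.
have vp v : d <= v -> 0 < v by exact: lt_le_trans.
elim: l => [|l [[C hC] [D hD]]].
  split; exists (1 + E d) => v dv; have := E_nincr d0 dv; rewrite {1}/E => h.
  - rewrite expr0 mul1r normr_le_sqr//; apply: le_trans h.
    by rewrite lerDl mulr_ge0 ?sqr_ge0// ltW// vp.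
  - rewrite expr1 -[X in X * _]ger0_norm ?sqrtr_ge0// -normrM normr_le_sqr//.
    rewrite exprMn sqr_sqrtr ?(ltW (vp _ dv))//; apply: le_trans h.
    by rewrite lerDr sqr_ge0.
split; first by exists D.
exists (l.+1%:R * (D / Num.sqrt d) + C) => v dv.
have v0 := vp _ dv; have s0 : 0 < Num.sqrt v by rewrite sqrtr_gt0.
have -> : Num.sqrt v ^+ l.+2 * `|q l.+2 v| =
    Num.sqrt v ^+ l * `|l.+1%:R * q l.+1 v - q l v|.
  rewrite (q_rec l v0) opprB addrC subrK normrM (gtr0_norm v0) mulrA; congr (_ * _).
  by rewrite -[X in _ = _ * X](sqr_sqrtr (ltW v0)) -exprD addn2.
apply: le_trans (ler_wpM2l _ (ler_normB _ _)) _; first by rewrite exprn_ge0 ?sqrtr_ge0.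
rewrite mulrDr lerD ?hC// normrM ger0_norm// mulrCA ler_wpM2l//.
rewrite ler_pdivlMr ?sqrtr_gt0//; apply: le_trans (hD _ dv).
rewrite exprSr mulrAC ler_wpM2r ?mulr_ge0 ?exprn_ge0 ?sqrtr_ge0//.
by rewrite ler_wpM2l ?exprn_ge0 ?sqrtr_ge0// ler_wsqrtr.
Qed.

End Energy.

Lemma besA_far_bound (d : R) l : 0 < d ->
  exists C : R, forall v, d <= v -> Num.sqrt v ^+ l * `|besA l v| <= C.
Proof.
by apply: (bessel_far_bound (q := @besA R)) => [j v _|j v]; [exact: besA_der|exact: besA_rec].
Qed.

Lemma besY_far_bound (d : R) l : 0 < d ->
  exists C : R, forall v, d <= v -> Num.sqrt v ^+ l * `|besY l v| <= C.
Proof. exact: (bessel_far_bound (@besY_der R) (@besY_rec R)). Qed.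

Lemma pseries_near_bound (c : nat -> R) : fast c ->
  exists2 C : R, 0 <= C & forall v, 0 <= v <= 1 -> `|limn (pseries c v)| <= C.
Proof.
move=> /fast_psum_le[C hC]; exists (`|C| * expR 1); first by rewrite mulr_ge0 ?expR_ge0.
move=> v /andP[v0 v1]; apply: le_trans (hC v) _; rewrite ger0_norm//.
apply: le_trans (ler_wpM2r (expR_ge0 _) (ler_norm C)) _.
by rewrite ler_wpM2l// ler_expR.
Qed.

Lemma besA_bounded l : exists2 C : R, 0 <= C & forall v, 0 <= v -> `|besA l v| <= C.
Proof.
have [C C0 hC] := pseries_near_bound (besA_coef_fast R l).
have [D hD] := besA_far_bound l (@ltr01 R).
exists (C + `|D|); first by rewrite addr_ge0.
move=> v v0; have [v1|v1] := leP v 1.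
  by rewrite ler_wpDr// hC// v0.
rewrite ler_wpDl//; apply: le_trans (ler_norm D); apply: le_trans (hD _ (ltW v1)).
rewrite ler_peMl// exprn_ege1// -(sqrtr1 R) ler_wsqrtr//; exact: ltW.
Qed.

(** [hankel1 l x] divided by u^l, as a function of v = u^2 with u = x / 2. *)
Definition besH l v : R[i] := besA l v +i* (pi^-1 * besY l v).

Lemma besH_der l v : 0 < v -> cder (besH l) v (- besH l.+1 v).
Proof.
move=> v0; split; rewrite ?cReN ?cImN /=; first exact: besA_der.
rewrite -mulrN; exact: (is_deriveZ (pi^-1) (besY_der l v0)).
Qed.

Lemma besH_rec l v : 0 < v -> besH l v = l.+1%:R * besH l.+1 v - v%:C * besH l.+2 v.
Proof.
move=> v0; rewrite (_ : l.+1%:R = (l.+1%:R : R)%:C); last by rewrite rmorph_nat.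
apply: complex_ext; rewrite !ReImE /=.
- by rewrite (besA_rec l v0); ring.
- by rewrite (besY_rec l v0); ring.
Qed.

Lemma besH_norm l v : cmod (besH l v) <= `|besA l v| + pi^-1 * `|besY l v|.
Proof.
by apply: le_trans (cmod_le_ReIm _) _; rewrite /= normrM (ger0_norm (x := pi^-1))// invr_ge0 pi_ge0.
Qed.

Lemma besH_far_bound (d : R) l : 0 < d ->
  exists2 C : R, 0 <= C & forall v, d <= v -> Num.sqrt v ^+ l * cmod (besH l v) <= C.
Proof.
move=> d0; have [C hC] := besA_far_bound l d0; have [D hD] := besY_far_bound l d0.
exists (`|C| + pi^-1 * `|D|); first by rewrite addr_ge0// mulr_ge0// invr_ge0 pi_ge0.
move=> v dv; apply: le_trans (ler_wpM2l _ (besH_norm l v)) _.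
  by rewrite exprn_ge0 ?sqrtr_ge0.
rewrite mulrDr mulrCA lerD//; first exact: le_trans (hC v dv) (ler_norm _).
rewrite ler_wpM2l ?invr_ge0 ?pi_ge0//; exact: le_trans (hD v dv) (ler_norm _).
Qed.

(** From exp(e |ln v|) >= e |ln v|. *)
Lemma norm_ln_le_powR (e v : R) : 0 < e -> 0 < v -> v <= 1 -> `|ln v| <= e^-1 * v `^ (- e).
Proof.
move=> e0 v0 v1; rewrite ler0_norm; last by rewrite -ln1 ler_ln ?posrE.
rewrite ler_pdivlMl// /powR gt_eqF//; apply: le_trans (expR_ge1Dx _).
by rewrite mulNr mulrN lerDr.
Qed.

(** The logarithm at the origin is traded for an arbitrarily small negative
    power, which merges with the Holder singularities met below. *)
Lemma besH0_near_bound (e : R) : 0 < e -> exists2 C : R, 0 <= C &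
  forall v, 0 < v -> cmod (besH 0 v) <= C * (v `^ (- e) + 1).
Proof.
move=> e0; have [CA CA0 hA] := pseries_near_bound (besA_coef_fast R 0).
have [CB CB0 hB] := pseries_near_bound (besB_coef_fast R 0).
have [CF CF0 hF] := besH_far_bound 0 (@ltr01 R).
have p0 : 0 <= (pi : R)^-1 by rewrite invr_ge0 pi_ge0.
exists (CF + CA + pi^-1 * (e^-1 * CA + CB)).
  by rewrite !addr_ge0// mulr_ge0// addr_ge0// mulr_ge0// invr_ge0 ltW.
move=> v v0; have P0 : 0 <= v `^ (- e) by exact: powR_ge0.
have [v1|v1] := leP v 1; last first.
  have := hF _ (ltW v1); rewrite expr0 mul1r => h; apply: le_trans h _.
  have K0 : 0 <= CA + pi^-1 * (e^-1 * CA + CB).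
    by rewrite addr_ge0// mulr_ge0// addr_ge0// mulr_ge0// invr_ge0 ltW.
  apply: (@le_trans _ _ (CF + (CA + pi^-1 * (e^-1 * CA + CB)))); first by rewrite lerDl.
  by rewrite -addrA ler_peMr ?lerDr// addr_ge0.
have v01 : 0 <= v <= 1 by rewrite ltW.
apply: le_trans (besH_norm _ _) _; rewrite /besY big_ord0 subr0.
have h1 : `|ln v * besA 0 v - besB 0 v| <= e^-1 * v `^ (- e) * CA + CB.
  apply: le_trans (ler_normB _ _) _; rewrite lerD ?hB// normrM.
  by apply: ler_pM => //; [exact: norm_ln_le_powR|exact: hA].
apply: le_trans (lerD (hA _ v01) (ler_wpM2l p0 h1)) _.
have e1 : 0 <= e^-1 by rewrite invr_ge0 ltW.
move: (v `^ (- e)) P0 (e^-1) e1 (pi^-1) p0 => P P0 f f0 p p0.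
have h2 : 0 <= p * f * CA by rewrite !mulr_ge0.
have h3 : 0 <= p * CB * P by rewrite !mulr_ge0.
have h4 : 0 <= CA * P by rewrite !mulr_ge0.
have h5 : 0 <= CF * P by rewrite !mulr_ge0.
nra.
Qed.

Lemma besH1_near_bound : exists2 C : R, 0 <= C &
  forall v, 0 < v -> cmod (besH 1 v) <= C * (v^-1 + (Num.sqrt v)^-1).
Proof.
have [CA CA0 hA] := pseries_near_bound (besA_coef_fast R 1).
have [CB CB0 hB] := pseries_near_bound (besB_coef_fast R 1).
have [CF CF0 hF] := besH_far_bound 1 (@ltr01 R).
have p0 : 0 <= (pi : R)^-1 by rewrite invr_ge0 pi_ge0.
exists (CF + CA + pi^-1 * (CA + 1 + CB)).
  by rewrite !addr_ge0// mulr_ge0// !addr_ge0.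
move=> v v0; have P0 : 0 <= v^-1 by rewrite invr_ge0 ltW.
have s0 : 0 <= (Num.sqrt v)^-1 by rewrite invr_ge0 sqrtr_ge0.
have D0 : 0 <= CA + pi^-1 * (CA + 1 + CB) by rewrite addr_ge0// mulr_ge0// !addr_ge0.
have [v1|v1] := leP v 1; last first.
  have := hF _ (ltW v1); rewrite expr1 mulrC -ler_pdivlMr ?sqrtr_gt0// => h.
  apply: le_trans h _; rewrite ler_pM// ?lerDr// -addrA lerDl//.
have v01 : 0 <= v <= 1 by rewrite ltW.
have vi : 1 <= v^-1 by rewrite invf_ge1.
apply: (@le_trans _ _ ((CF + CA + pi^-1 * (CA + 1 + CB)) * v^-1)); last first.
  by rewrite ler_wpM2l// ?lerDl// -addrA addr_ge0.
apply: le_trans (besH_norm _ _) _; rewrite /besY big_ord1 subnn fact0 subn0 expr1 divr1 mul1r.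
have hl : `|ln v| <= v^-1.
  have := norm_ln_le_powR (@ltr01 R) v0 v1.
  by rewrite invr1 mul1r powR_inv1// ltW.
have h1 : `|ln v * besA 1 v - v^-1 - besB 1 v| <= v^-1 * CA + v^-1 + CB.
  apply: le_trans (ler_normB _ _) _; rewrite lerD ?hB//.
  apply: le_trans (ler_normB _ _) _; rewrite lerD ?normrM//.
    by apply: ler_pM => //; exact: hA.
  by rewrite normfV ger0_norm// ltW.
apply: le_trans (lerD (hA _ v01) (ler_wpM2l p0 h1)) _.
move: (v^-1) vi (pi^-1) p0 {hl h1 P0 hA hB hF D0} => P P1 p p0.
have h2 : 0 <= p * CB * (P - 1) by rewrite !mulr_ge0// subr_ge0.
have h4 : 0 <= CA * (P - 1) by rewrite !mulr_ge0// subr_ge0.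
have h5 : 0 <= CF * P by rewrite mulr_ge0// (le_trans _ P1).
nra.
Qed.

Lemma besselJE l (x : R) : besselJ l x = (x / 2) ^+ l * besA l ((x / 2) ^+ 2).
Proof.
rewrite /besselJ; set u := x / 2.
have h := psumZ (u ^+ l) (fast_psum (u ^+ 2) (besA_coef_fast R l)).
rewrite -(psumE h); congr (limn (series _)); apply/funext => m.
by rewrite /= /besA_coef -exprM mul2n exprD; ring.
Qed.

Let besB_series l (x : R) : limn (series (fun m : nat =>
      (digammaS m + digammaS (m + l)) *
      ((-1) ^+ m / (m`! * (m + l)`!)%:R * (x / 2) ^+ (m.*2 + l)))) =
  (x / 2) ^+ l * besB l ((x / 2) ^+ 2).
Proof.
set u := x / 2; have h := psumZ (u ^+ l) (fast_psum (u ^+ 2) (besB_coef_fast R l)).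
rewrite -(psumE h); congr (limn (series _)); apply/funext => m.
by rewrite /= /besB_coef /besA_coef -exprM mul2n exprD; ring.
Qed.

Lemma besselYE l (x : R) : 0 < x ->
  besselY l x = pi^-1 * ((x / 2) ^+ l * besY l ((x / 2) ^+ 2)).
Proof.
move=> x0; rewrite /besselY besB_series besselJE; set u := x / 2.
have u0 : 0 < u by rewrite /u divr_gt0.
rewrite /besY lnXn// -[ln u *+ 2]mulr_natl.
have -> : \sum_(m < l) (l - m.+1)`!%:R / m`!%:R * u ^+ m.*2 / u ^+ l =
    u ^+ l * \sum_(m < l) (l - m.+1)`!%:R / m`!%:R * (u ^+ 2) ^- (l - m).
  rewrite mulr_sumr; apply: eq_bigr => m _.
  have e : u ^+ l * u ^+ l = u ^+ m.*2 * (u ^+ 2) ^+ (l - m).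
    by rewrite -exprM -!exprD; congr (u ^+ _); have := ltn_ord m; lia.
  have := expf_neq0 l (lt0r_neq0 u0); have := expf_neq0 (l - m) (expf_neq0 2 (lt0r_neq0 u0)).
  move: e; move: (u ^+ l) (u ^+ m.*2) ((u ^+ 2) ^+ (l - m)) ((l - m.+1)`!%:R / m`!%:R) =>
    a b c d e c0 a0.
  apply: (mulfI a0); apply: (mulIf c0).
  have -> : a * (d * b / a) * c = d * (b * c) by field.
  by rewrite -e; field; rewrite c0.
set S := \sum_(m < l) _; move: (pi^-1) => p; ring.
Qed.

Lemma hankel1E l (x : R) : 0 < x ->
  hankel1 l x = ((x / 2) ^+ l)%:C * besH l ((x / 2) ^+ 2).
Proof.
move=> x0; rewrite /hankel1 besselJE besselYE//.
by apply: complex_ext; rewrite !ReImE /=; ring.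
Qed.

(** For l = 0 the two sides agree even at the origin, where [ln] vanishes. *)
Lemma hankel1_0E (x : R) : 0 <= x -> hankel1 0 x = besH 0 ((x / 2) ^+ 2).
Proof.
rewrite le_eqVlt => /predU1P[<-|x0]; last by rewrite hankel1E// expr0 mul1r.
rewrite /hankel1 /besH besselJE /besselY besB_series /besY !big_ord0 mul0r !expr0n /=.
by rewrite (ln0 (lexx 0)) !mulr0 !mul0r !mul1r !subr0 !sub0r mulrN.
Qed.

End BesselBounds.

(** * Multipoles and their ladder relations *)

Section Ladder.
Variable R : realType.
Implicit Types (l m n : nat) (p : int) (v : R) (z : R[i]).

Lemma besA_at0 l : besA l 0 = l`!%:R^-1 :> R.
Proof.
apply: psumE; have [h] := psum_delta (l`!%:R^-1 : R) 0; split.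
rewrite [X in X @ \oo --> _](_ : _ = (fun n => \sum_(0 <= m < n)
  (if m is 0%N then l`!%:R^-1 else 0) * 0 ^+ m))//.
apply/funext => n; apply: eq_bigr => -[|m] _; last by rewrite !exprS !mul0r !mulr0.
by rewrite /besA_coef !expr0 mul1n add0n !mulr1 mul1r.
Qed.

(** The regular waves are also needed at the centre of the disk, where v = 0. *)
Lemma besA_rec_ge0 l v : 0 <= v -> besA l v = l.+1%:R * besA l.+1 v - v * besA l.+2 v.
Proof.
rewrite le_eqVlt => /predU1P[<-|]; last exact: besA_rec.
by rewrite mul0r subr0 !besA_at0 factS natrM invfM mulVKf// pnatr_eq0.
Qed.

(** [multipole q kap p] is the function of order p attached to a solution q
    of the recurrences: H_p(k|z|) (conj z / |z|)^p for q = [besH] and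
    kap = k / 2, and J_p in place of H_p for q = [besA]. *)
Definition multipole (q : nat -> R -> R[i]) (kap : R) (p : int) (z : R[i]) : R[i] :=
  match p with
  | Posz n => kap%:C ^+ n * conjc z ^+ n * q n ((kap * cmod z) ^+ 2)
  | Negz n => (- kap%:C) ^+ n.+1 * z ^+ n.+1 * q n.+1 ((kap * cmod z) ^+ 2)
  end.

(** The two recurrences at a single point, so that the ladder relations can be
    proved once for [besH], where v > 0, and [besA], where v >= 0. *)
Definition bessel_at (q : nat -> R -> R[i]) v := forall l,
  cder (q l) v (- q l.+1 v) /\ q l v = l.+1%:R * q l.+1 v - v%:C * q l.+2 v.

Lemma bessel_at_besH v : 0 < v -> bessel_at (@besH R) v.
Proof. by move=> v0 l; split; [exact: besH_der|exact: besH_rec]. Qed.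

Lemma bessel_at_besA v : 0 <= v -> bessel_at (fun l v => (besA l v)%:C) v.
Proof.
move=> v0 l; split; first by rewrite -rmorphN; apply: cder_real; exact: besA_der.
by rewrite {1}(besA_rec_ge0 l v0) rmorphB !rmorphM /= rmorph_nat.
Qed.

(** Reflection in the real axis exchanges the orders n and -n. *)
Lemma multipole_Nn q kap n z :
  multipole q kap (- n%:Z) z = (-1) ^+ n * multipole q kap n%:Z (conjc z).
Proof.
case: n => [|n]; first by rewrite oppr0 /= !expr0 !mul1r cmodJ.
rewrite -NegzE /= conjcK cmodJ -[- kap%:C]mulN1r exprMn.
by rewrite !mulrA.
Qed.

Lemma cmod_multipole q kap p z : 0 <= kap ->
  cmod (multipole q kap p z) = (kap * cmod z) ^+ `|p| * cmod (q `|p|%N ((kap * cmod z) ^+ 2)).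
Proof.
move=> k0; case: p => n; rewrite /= !cmodM !cmodX.
- by rewrite cmodJ cmodC ger0_norm// -exprMn.
- by rewrite cmodN cmodC ger0_norm// -exprMn.
Qed.

(** The ladder relations of Bessel functions say that the derivatives d/dz and
    d/d(conj z) shift the order of a multipole by one. *)
Lemma multipole_der q kap p (z : R -> R[i]) t d :
  cder z t d -> bessel_at q ((kap * cmod (z t)) ^+ 2) ->
  cder (fun s => multipole q kap p (z s)) t
    (kap%:C * (conjc d * multipole q kap (p - 1) (z t) - d * multipole q kap (p + 1) (z t))).
Proof.
move=> dz hq; set v := (kap * cmod (z t)) ^+ 2 in hq *.
have vE s : (kap * cmod (z s)) ^+ 2 =
    kap ^+ 2 * (complex.Re (z s) ^+ 2 + complex.Im (z s) ^+ 2).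
  by rewrite exprMn cmod_sqr.
have dv : is_derive t 1 (fun s => (kap * cmod (z s)) ^+ 2)
    (2 * kap ^+ 2 * (complex.Re (z t) * complex.Re d + complex.Im (z t) * complex.Im d)).
  under eq_fun do rewrite vE.
  have [d1 d2] := dz.
  by apply: is_derive_eq; rewrite /GRing.scale /=; ring.
have dvE : (2 * kap ^+ 2 * (complex.Re (z t) * complex.Re d
      + complex.Im (z t) * complex.Im d))%:C =
    kap%:C ^+ 2 * (conjc (z t) * d + z t * conjc d).
  by apply: complex_ext; rewrite !expr2 !ReImE /=; ring.
have vC : v%:C = kap%:C ^+ 2 * (z t * conjc (z t)).
  by rewrite /v exprMn rmorphM rmorphXn /= mul_conjc.
have dq l : cder (fun s => q l ((kap * cmod (z s)) ^+ 2)) t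
    (- (kap%:C ^+ 2 * (conjc (z t) * d + z t * conjc d)) * q l.+1 v).
  have h := @cder_comp R (q l) (fun s => (kap * cmod (z s)) ^+ 2) t _ _ (hq l).1 dv.
  apply: (cder_eq h).
  by rewrite dvE mulrN mulNr.
have dzJ := cderJ dz.
have qrec l : q l v = l.+1%:R * q l.+1 v - v%:C * q l.+2 v by case: (hq l).
case: p => [[|n]|n].
- rewrite (_ : 0%:Z - 1 = Negz 0)// (_ : 0%:Z + 1 = 1%N)// /multipole -/v.
  apply: (cder_eq (cderM (cderZ _ (cderX 0 dzJ)) (dq 0%N))).
  by rewrite !expr0 !expr1; ring.
- rewrite (_ : n.+1%:Z - 1 = n%:Z); last by rewrite -addn1 PoszD addrK.
  rewrite (_ : n.+1%:Z + 1 = n.+2%:Z); last by rewrite -PoszD addn1.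
  apply: (cder_eq (cderM (cderZ _ (cderX n.+1 dzJ)) (dq n.+1))).
  rewrite /= -/v (qrec n) vC !exprS; ring.
- rewrite (_ : Negz n - 1 = Negz n.+1); last by rewrite !NegzE; lia.
  case: n => [|n].
    rewrite (_ : Negz 0 + 1 = 0)// /= -/v (qrec 0%N) vC.
    apply: (cder_eq (cderM (cderZ _ (cderX 1 dz)) (dq 1%N))).
    by rewrite -/v -[1.-1]/0%N !expr1 !expr0; ring.
  rewrite (_ : Negz n.+1 + 1 = Negz n); last by rewrite !NegzE; lia.
  apply: (cder_eq (cderM (cderZ _ (cderX n.+2 dz)) (dq n.+2))).
  rewrite /= -/v (qrec n.+1) vC !exprS; ring.
Qed.

End Ladder.

(** * Periodic functions of Holder class *)

Section HolderClass.
Variable R : realType.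
Variables (beta L : R).
Hypothesis beta01 : 0 < beta < 1.
Implicit Types (f g : R -> R[i]) (j : nat) (s t K : R).

(** The ball of radius K in the L-periodic functions of class C^(j, beta). The
    recursion quantifies over the derivative, so that products and integrations
    by parts need no formula for the higher derivatives. *)
Fixpoint hbnd j K f : Prop :=
  [/\ (forall s, cmod (f s) <= K), (forall s, f (s + L) = f s) &
   match j with
   | 0 => forall s t, cmod (f s - f t) <= K * `|s - t| `^ beta
   | j'.+1 => exists2 f', (forall s, cder f s (f' s)) & hbnd j' K f'
   end].

Lemma hbnd_le j K f s : hbnd j K f -> cmod (f s) <= K.
Proof. by case: j => [|j] []. Qed.

Lemma hbnd_per j K f s : hbnd j K f -> f (s + L) = f s.
Proof. by case: j => [|j] []. Qed.

Lemma hbnd_ge0 j K f : hbnd j K f -> 0 <= K.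
Proof. by move=> /(@hbnd_le _ _ _ 0); apply: le_trans; exact: cmod_ge0. Qed.

Lemma hbnd_mono j K K' f : K <= K' -> hbnd j K f -> hbnd j K' f.
Proof.
move=> KK'; elim: j f => [|j IH] f [h1 h2 h3]; split => //.
- by move=> s; exact: le_trans (h1 s) KK'.
- by move=> s t; apply: le_trans (h3 s t) _; rewrite ler_wpM2r ?powR_ge0.
- by move=> s; exact: le_trans (h1 s) KK'.
- by case: h3 => f' df hf; exists f' => //; exact: IH.
Qed.

Lemma hbndD j K1 K2 f g : hbnd j K1 f -> hbnd j K2 g ->
  hbnd j (K1 + K2) (fun s => f s + g s).
Proof.
elim: j f g => [|j IH] f g [f1 f2 f3] [g1 g2 g3]; split.
- by move=> s; apply: le_trans (cmodD _ _) _; exact: lerD.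
- by move=> s; rewrite f2 g2.
- move=> s t; rewrite opprD addrACA mulrDl.
  by apply: le_trans (cmodD _ _) _; exact: lerD.
- by move=> s; apply: le_trans (cmodD _ _) _; exact: lerD.
- by move=> s; rewrite f2 g2.
- case: f3 g3 => f' df hf [g' dg hg]; exists (fun s => f' s + g' s).
    by move=> s; exact: cderD.
  exact: IH.
Qed.

Lemma powR_beta_ge (x : R) : 0 <= x -> x <= 1 -> x <= x `^ beta.
Proof.
have [b0 b1] := andP beta01.
rewrite le_eqVlt => /predU1P[<- _|x0 x1]; first exact: powR_ge0.
by apply: ger1_powR; rewrite ?x0// ltW.
Qed.

(** For close points the Lipschitz bound is stronger than the Holder one, for
    distant points the sup bound is; 2 K covers both. *)
Lemma hbnd0_of_cder K f f' : (forall s, cmod (f s) <= K) -> (forall s, f (s + L) = f s) ->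
  (forall s, cder f s (f' s)) -> (forall s, cmod (f' s) <= K) -> hbnd 0 (2 * K) f.
Proof.
move=> f1 f2 df f'1; have K0 : 0 <= K by exact: le_trans (cmod_ge0 _) (f1 0).
have K2 : K <= 2 * K by lra.
split => // [s|]; first exact: le_trans (f1 s) K2.
suff lip s t : s <= t -> cmod (f t - f s) <= 2 * K * `|t - s| `^ beta.
  move=> s t; have [st|/ltW ts] := leP s t; last exact: lip.
  by rewrite -cmodN opprB distrC; exact: lip.
move=> st; have h0 : 0 <= t - s by rewrite subr_ge0.
rewrite (ger0_norm h0); have [h1|/ltW h1] := leP (t - s) 1.
  apply: le_trans (@cder_incr_le _ f f' K s t st _ _) _ => //.
  apply: ler_pM => //; exact: powR_beta_ge.
have h2 : 1 <= (t - s) `^ beta.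
  have [b0 _] := andP beta01.
  by rewrite -(powRr0 (t - s)) ler_powR// ltW.
apply: le_trans (cmodB _ _) _; apply: le_trans (lerD (f1 t) (f1 s)) _.
by rewrite -mulr2n -[K *+ 2]mulr_natl ler_peMr// mulr_ge0.
Qed.

Lemma hbnd_down j K f : hbnd j.+1 K f -> hbnd j (2 * K) f.
Proof.
elim: j f => [|j IH] f hf; have K0 := hbnd_ge0 hf; have K2 : K <= 2 * K by lra.
- have [f1 f2 [f' df [f'1 _ _]]] := hf; exact: hbnd0_of_cder df f'1.
- have [f1 f2 [f' df hf']] := hf; split => //.
    by move=> s; exact: le_trans (f1 s) K2.
  by exists f' => //; exact: IH.
Qed.

Lemma hbnd_downs j i K f : hbnd (j + i) K f -> hbnd j (2 ^+ i * K) f.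
Proof.
elim: i K => [|i IH] K; first by rewrite addn0 expr0 mul1r.
by rewrite addnS => /hbnd_down/IH; rewrite mulrA -exprSr.
Qed.

(** Leibniz rule; the constant is uniform in the two factors, which is what
    makes the potential bounds linear in the density. *)
Lemma hbndM j : exists2 C : R, 0 <= C & forall A K f g, hbnd j A f -> hbnd j K g ->
  hbnd j (C * (A * K)) (fun s => f s * g s).
Proof.
elim: j => [|j [C C0 IH]].
  exists 2 => // A K f g hf hg; have A0 := hbnd_ge0 hf; have K0 := hbnd_ge0 hg.
  have AK0 : 0 <= A * K by exact: mulr_ge0.
  have [f1 f2 f3] := hf; have [g1 g2 g3] := hg; split.
  - move=> s; rewrite cmodM; apply: (@le_trans _ _ (A * K)); last by lra.
    by apply: ler_pM; rewrite ?cmod_ge0.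
  - by move=> s; rewrite f2 g2.
  - move=> s t; have -> : f s * g s - f t * g t = f s * (g s - g t) + (f s - f t) * g t by ring.
    have P0 := powR_ge0 `|s - t| beta; apply: le_trans (cmodD _ _) _; rewrite !cmodM.
    have h1 : cmod (f s) * cmod (g s - g t) <= A * (K * `|s - t| `^ beta).
      by apply: ler_pM; rewrite ?cmod_ge0.
    have h2 : cmod (f s - f t) * cmod (g t) <= A * `|s - t| `^ beta * K.
      by apply: ler_pM; rewrite ?cmod_ge0.
    lra.
have C40 : 0 <= 4 * C + 1 by rewrite addr_ge0// mulr_ge0.
exists (4 * C + 1) => // A K f g hf hg; have A0 := hbnd_ge0 hf; have K0 := hbnd_ge0 hg.
have AK0 : 0 <= A * K by exact: mulr_ge0.
have CAK : 0 <= C * (A * K) by exact: mulr_ge0.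
have [f1 f2 [f' df hf']] := hf; have [g1 g2 [g' dg hg']] := hg; split.
- move=> s; rewrite cmodM; apply: (@le_trans _ _ (A * K)); last by nra.
  by apply: ler_pM; rewrite ?cmod_ge0.
- by move=> s; rewrite f2 g2.
- exists (fun s => f' s * g s + f s * g' s); first by move=> s; exact: cderM.
  have h := hbndD (IH _ _ _ _ hf' (hbnd_down hg)) (IH _ _ _ _ (hbnd_down hf) hg').
  by apply: hbnd_mono h; lra.
Qed.

Lemma hbndJ j K f : hbnd j K f -> hbnd j K (fun s => conjc (f s)).
Proof.
elim: j f => [|j IH] f [f1 f2 f3]; split.
- by move=> s; rewrite cmodJ.
- by move=> s; rewrite f2.
- by move=> s t; rewrite -rmorphB cmodJ.
- by move=> s; rewrite cmodJ.
- by move=> s; rewrite f2.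
- case: f3 => f' df hf; exists (fun s => conjc (f' s)); last exact: IH.
  by move=> s; exact: cderJ.
Qed.

Lemma holder_cont (f : R -> R) K :
  (forall s t, `|f s - f t| <= K * `|s - t| `^ beta) -> continuous f.
Proof.
move=> hf s; have [b0 _] := andP beta01.
have hK : 0 <= `|K| + 1 by rewrite addr_ge0.
apply/cvgrPdist_lt => e e0.
pose d := (e / (`|K| + 1)) `^ beta^-1.
have eK : 0 < e / (`|K| + 1) by rewrite divr_gt0// ltr_wpDl.
have d0 : 0 < d by exact: powR_gt0.
near=> t.
have st : `|s - t| < d by near: t; exact: cvgr_dist_lt.
apply: le_lt_trans (hf s t) _.
apply: (@le_lt_trans _ _ (`|K| * `|s - t| `^ beta)).
  by rewrite ler_wpM2r ?powR_ge0// ler_norm.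
apply: (@le_lt_trans _ _ (`|K| * (e / (`|K| + 1)))).
  rewrite ler_wpM2l// (_ : e / (`|K| + 1) = d `^ beta); last first.
    by rewrite /d -powRrM mulVf ?gt_eqF// powRr1// ltW.
  by rewrite ge0_ler_powR ?nnegrE// ltW.
by rewrite mulrA [_ * e]mulrC -mulrA gtr_pMr// ltr_pdivrMr ?mul1r ?ltrDl// ltr_wpDl.
Unshelve. all: by end_near. Qed.

Lemma hbnd_cont j K f : hbnd j K f -> ccont f.
Proof.
case: j => [|j] [f1 f2 f3].
  split; apply: (@holder_cont _ K) => s t.
  - by rewrite -cReN -cReD; apply: le_trans (f3 s t); exact: Re_le_cmod.
  - by rewrite -cImN -cImD; apply: le_trans (f3 s t); exact: Im_le_cmod.
by apply: cder_cont => s; case: f3 => f' df _; exists (f' s).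
Qed.

Lemma cder_per f f' : (forall s, f (s + L) = f s) -> (forall s, cder f s (f' s)) ->
  forall s, f' (s + L) = f' s.
Proof.
move=> pf df s; apply: (@cder_uniq _ f s) => //.
apply: (cder_ext pf); exact/cder_shift/df.
Qed.

(** Reduction to a fundamental domain. *)
Lemma per_floor (T : Type) (f : R -> T) : 0 < L -> (forall s, f (s + L) = f s) ->
  forall s, exists2 t, 0 <= t < L & f s = f t.
Proof.
move=> L0 pf s.
have pfn (n : nat) t : f (t + n%:R * L) = f t.
  elim: n t => [|n IH] t; first by rewrite mul0r addr0.
  by rewrite -natr1 mulrDl mul1r addrA pf IH.
have pfz (n : int) t : f (t + n%:~R * L) = f t.
  case: n => n; first exact: pfn.
  by rewrite NegzE mulrNz mulNr -[LHS](pfn n.+1) -addrA addNr addr0.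
exists (s - (Num.floor (s / L))%:~R * L).
  rewrite subr_ge0 -ler_pdivlMr// floor_le /= ltrBlDr -[X in X + _]mul1r -mulrDl.
  by rewrite -ltr_pdivrMr// addrC -[1]/(1%:~R) -intrD floorD1_gt.
by rewrite -[LHS](pfz (- Num.floor (s / L))) mulrNz mulNr.
Qed.

Lemma per_cont_bounded f : 0 < L -> (forall s, f (s + L) = f s) -> ccont f ->
  exists A : R, forall s, cmod (f s) <= A.
Proof.
move=> L0 pf [f1 f2].
have bd (h : R -> R) : continuous h -> exists M, forall s, s \in `[0, L] -> `|h s| <= M.
  move=> ch; have chn : {within `[0, L], continuous (fun s => `|h s|)}.
    by apply: continuous_subspaceT => s; apply: continuous_comp; [exact: ch|exact: norm_continuous].
  by have [c _ hc] := EVT_max (ltW L0) chn; exists `|h c|.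
have [M1 h1] := bd _ f1; have [M2 h2] := bd _ f2.
exists (M1 + M2) => s; have [t /andP[t0 tL] ->] := per_floor L0 pf s.
have tI : t \in `[0, L] by rewrite in_itv /= t0 ltW.
by apply: le_trans (cmod_le_ReIm _) _; exact: lerD (h1 _ tI) (h2 _ tI).
Qed.

Lemma cderiven_cder n f s : cderivable_n n.+1 f ->
  cder (cderiven n f) s (cderiven n.+1 f s).
Proof.
move=> df; have [d1 d2] := df n s (ltnSn n); split => /=.
- by rewrite derive1E; apply: DeriveDef.
- by rewrite derive1E; apply: DeriveDef.
Qed.

Lemma cderiven_cont n f : cderivable_n n.+1 f -> ccont (cderiven n f).
Proof.
by move=> df; apply: cder_cont => s; exists (cderiven n.+1 f s); exact: cderiven_cder.
Qed.

Lemma cderiven_per n f : (forall s, f (s + L) = f s) -> cderivable_n n f ->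
  forall s, cderiven n f (s + L) = cderiven n f s.
Proof.
move=> pf; elim: n => [|n IH] df s; first by rewrite /cderiven /= pf.
apply: (cder_per (f := cderiven n f)).
- by apply: IH => m t mn; apply: df; exact: ltnW.
- by move=> t; exact: cderiven_cder.
Qed.

Lemma csmooth_hbnd f : 0 < L -> (forall s, f (s + L) = f s) -> csmooth f ->
  forall n j, exists A, hbnd j A (cderiven n f).
Proof.
move=> L0 pf sf n j; elim: j n => [|j IH] n.
  have [A hA] := per_cont_bounded L0 (cderiven_per pf (sf n)) (cderiven_cont (sf n.+1)).
  have [B hB] := per_cont_bounded L0 (cderiven_per pf (sf n.+1)) (cderiven_cont (sf n.+2)).
  exists (2 * (`|A| + `|B|)).
  apply: (@hbnd0_of_cder _ _ (cderiven n.+1 f)).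
  - by move=> s; rewrite ler_wpDr// (le_trans (hA s))// ler_norm.
  - exact: cderiven_per.
  - by move=> s; exact: cderiven_cder.
  - by move=> s; rewrite ler_wpDl// (le_trans (hB s))// ler_norm.
have [A hA] := per_cont_bounded L0 (cderiven_per pf (sf n)) (cderiven_cont (sf n.+1)).
have [B hB] := IH n.+1; exists (`|A| + `|B|); split.
- by move=> s; rewrite ler_wpDr// (le_trans (hA s))// ler_norm.
- exact: cderiven_per.
- exists (cderiven n.+1 f); first by move=> s; exact: cderiven_cder.
  by apply: hbnd_mono hB; rewrite ler_wpDl// ler_norm.
Qed.

Lemma cderiven0 f : cderiven 0 f = f.
Proof. by apply/funext => s; apply: complex_ext. Qed.

Lemma cderivable_hbnd N K f : (forall s, f (s + L) = f s) -> cderivable_n N f ->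
  (forall n s, (n <= N)%N -> cmod (cderiven n f s) <= K) ->
  (forall s t, cmod (cderiven N f s - cderiven N f t) <= K * `|s - t| `^ beta) ->
  hbnd N K f.
Proof.
move=> pf df bf hf; suff h j n : (n + j)%N = N -> hbnd j K (cderiven n f).
  by have := h N 0%N erefl; rewrite cderiven0.
elim: j n => [|j IH] n.
  by rewrite addn0 => ->; split => //; [move=> s; exact: bf|exact: cderiven_per].
move=> nj; have dn : cderivable_n n.+1 f.
  by move=> m s mn; apply: df; apply: leq_trans mn _; rewrite -nj addnS ltnS leq_addr.
split.
- by move=> s; apply: bf; rewrite -nj leq_addr.
- by apply: cderiven_per => // m s mn; apply: dn; exact: ltnW.
- exists (cderiven n.+1 f); first by move=> s; exact: cderiven_cder.
  by apply: IH; rewrite addSnnS.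
Qed.

End HolderClass.

(** * Geometry of closed curves *)

Section CurveGeometry.
Variable R : realType.
Implicit Types (L B s t a : R).

(** The velocity g1 and its Lipschitz constant B, a bound for the curvature, are
    parameters because all the geometric estimates are quantified by B. *)
Record arc_curve (gam g1 : R -> R[i]) (L B : R) : Prop := ArcCurve {
  arc_L : 0 < L;
  arc_per : forall s, gam (s + L) = gam s;
  arc_der : forall s, cder gam s (g1 s);
  arc_unit : forall s, cmod (g1 s) = 1;
  arc_lip : forall s t, cmod (g1 s - g1 t) <= B * `|s - t|;
  arc_inj : {in `[0, L[%R &, injective gam} }.

Variables (gam g1 : R -> R[i]) (L B : R).
Hypothesis gamP : arc_curve gam g1 L B.
Let L0 : 0 < L := arc_L gamP.

Lemma arc_B_ge0 : 0 <= B.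
Proof.
have := le_trans (cmod_ge0 _) (arc_lip gamP 1 0).
by rewrite subr0 normr1 mulr1.
Qed.

Lemma arc_perB s : gam (s - L) = gam s.
Proof. by rewrite -(arc_per gamP (s - L)) subrK. Qed.

Lemma arc_taylor s t : cmod (gam t - gam s - (t - s)%:C * g1 t) <= B * (t - s) ^+ 2.
Proof.
pose h u := gam u - u%:C * g1 t.
have dh u : cder h u (g1 u - g1 t).
  apply: cderB; first exact: arc_der gamP u.
  have di : is_derive u (1 : R) (fun x : R => x) 1 by exact: is_derive_id.
  apply: (cder_eq (cderM (cder_real di) (cder_cst (g1 t) u))).
  by rewrite mulr0 addr0 mul1r.
have -> : gam t - gam s - (t - s)%:C * g1 t = h t - h s.
  by rewrite /h rmorphB /=; ring.
have [st|/ltW ts] := leP s t.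
  have h0 : 0 <= t - s by rewrite subr_ge0.
  rewrite expr2 mulrA; apply: (cder_incr_le st (fun u _ => dh u)) => u /andP[su ut].
  apply: le_trans (arc_lip gamP u t) _; rewrite ler_wpM2l ?arc_B_ge0//.
  by rewrite distrC ger0_norm ?subr_ge0// lerB.
have h0 : 0 <= s - t by rewrite subr_ge0.
rewrite -cmodN opprB -(opprB s t) sqrrN expr2 mulrA.
apply: (cder_incr_le ts (fun u _ => dh u)) => u /andP[tu us].
apply: le_trans (arc_lip gamP u t) _; rewrite ler_wpM2l ?arc_B_ge0//.
by rewrite ger0_norm ?subr_ge0// lerB.
Qed.

(** The chord is (t - s) g1 t up to second order, and g1 t times its own
    conjugate is real, so the imaginary part only sees the curvature: this is
    what makes the double layer kernel of a smooth curve bounded. *)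
Lemma arc_Im s t : `|complex.Im (g1 t * conjc (gam t - gam s))| <= B * (t - s) ^+ 2.
Proof.
have -> : complex.Im (g1 t * conjc (gam t - gam s)) =
    complex.Im (g1 t * conjc (gam t - gam s - (t - s)%:C * g1 t)).
  by rewrite !ReImE /=; ring.
apply: le_trans (Im_le_cmod _) _; rewrite cmodM (arc_unit gamP) mul1r cmodJ.
exact: arc_taylor.
Qed.

Lemma arc_near s t : B * `|t - s| <= 2^-1 -> 2^-1 * `|t - s| <= cmod (gam t - gam s).
Proof.
move=> h; have h1 := arc_taylor s t.
have h2 : `|t - s| <= cmod (gam t - gam s) + B * (t - s) ^+ 2.
  have -> : `|t - s| = cmod ((t - s)%:C * g1 t).
    by rewrite cmodM cmodC (arc_unit gamP) mulr1.
  rewrite -[X in cmod X](subKr (gam t - gam s)).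
  by apply: le_trans (cmodB _ _) _; rewrite lerD2l.
have h3 : B * (t - s) ^+ 2 <= 2^-1 * `|t - s|.
  by rewrite -[(t - s) ^+ 2]real_normK ?num_real// expr2 mulrA ler_wpM2r.
by have := normr_ge0 (t - s); lra.
Qed.

(** On [0, L] this product vanishes exactly at the pairs of parameters of one
    point of the closed curve. *)
Let prod3 s t : R := (s - t) * (s - t - L) * (s - t + L).

(** Compactness: the chord has a positive minimum on the pairs of parameters
    that stay away from the zeros of [prod3]. *)
Let arc_far (d : R) : 0 < d -> exists2 m, 0 < m & forall s t,
  0 <= s <= L -> 0 <= t <= L -> d <= `|prod3 s t| -> m <= cmod (gam s - gam t).
Proof.
move=> d0; pose F (p : R * R) := (complex.Re (gam p.1) - complex.Re (gam p.2)) ^+ 2 +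
  (complex.Im (gam p.1) - complex.Im (gam p.2)) ^+ 2.
have FE s t : F (s, t) = cmod (gam s - gam t) ^+ 2 by rewrite cmod_sqr !ReImE.
have [c1 c2] : ccont gam by apply: cder_cont => s; exists (g1 s); exact: arc_der gamP s.
have cfst : continuous (fun p : R * R => p.1) by move=> p; exact: cvg_fst.
have csnd : continuous (fun p : R * R => p.2) by move=> p; exact: cvg_snd.
have cF : continuous F.
  have co (h : R -> R) : continuous h -> continuous (fun p : R * R => (h p.1 - h p.2) ^+ 2).
    move=> ch p; apply: cvgM; apply: cvgB.
    - exact: (continuous_comp (cfst p) (ch _)).
    - exact: (continuous_comp (csnd p) (ch _)).
    - exact: (continuous_comp (cfst p) (ch _)).
    - exact: (continuous_comp (csnd p) (ch _)).
  by move=> p; apply: cvgD; [exact: (co _ c1 p)|exact: (co _ c2 p)].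
pose G (p : R * R) : R := `|prod3 p.1 p.2|.
have cG : continuous G.
  move=> p; apply: cvg_norm.
  have h1 : (fun p : R * R => p.1 - p.2) @ p --> p.1 - p.2.
    by apply: cvgB; [exact: cfst|exact: csnd].
  apply: cvgM; first apply: cvgM => //.
  - by apply: cvgB => //; exact: cvg_cst.
  - by apply: cvgD => //; exact: cvg_cst.
pose K := (`[0, L] `*` `[0, L]) `&` [set p : R * R | d <= G p].
have cK : compact K.
  apply: compact_closedI; first by apply: compact_setX; exact: segment_compact.
  apply: (preimage_closed (f := G) (D := [set x | d <= x])); last exact: closed_ge.
  by move=> p _; exact: cG.
have [K0|K0] := pselect (K !=set0); last first.
  exists 1 => // s t s0 t0 dst; exfalso; apply: K0; exists (s, t).
  by split => //; split; rewrite /= in_itv /=.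
have [[s0 t0] /set_mem[[/= s0I t0I] dst0] hmin] :=
  compact_EVT_min K0 cK (continuous_subspaceT cF).
have F0 : gam s0 != gam t0.
  apply/eqP => e; move: dst0; rewrite /G /=; apply/negP; rewrite -ltNge.
  suff -> : prod3 s0 t0 = 0 by rewrite normr0.
  move: s0I t0I; rewrite !in_itv /= => /andP[s00 s0L] /andP[t00 t0L].
  rewrite /prod3; have [sL|sL] := eqVneq s0 L; have [tL|tL] := eqVneq t0 L.
  - by rewrite sL tL subrr !mul0r.
  - have -> : t0 = 0.
      apply: (arc_inj gamP); rewrite ?in_itv /= ?lexx ?L0 ?t00 ?lt_def ?t0L ?andbT 1?eq_sym//.
      by rewrite -e sL -[in LHS](add0r L) (arc_per gamP).
    by rewrite sL; ring.
  - have -> : s0 = 0.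
      apply: (arc_inj gamP); rewrite ?in_itv /= ?lexx ?L0 ?s00 ?lt_def ?s0L ?andbT 1?eq_sym//.
      by rewrite e tL -[in LHS](add0r L) (arc_per gamP).
    by rewrite tL; ring.
  - have -> : s0 = t0.
      apply: (arc_inj gamP); rewrite ?in_itv /= ?s00 ?t00 ?lt_def ?s0L ?t0L ?andbT 1?eq_sym//.
    by rewrite subrr !mul0r.
exists (cmod (gam s0 - gam t0)); first by rewrite cmod_gt0 subr_eq0.
move=> s t sI tI dst; rewrite -(@ler_pXn2r _ 2)// ?nnegrE ?cmod_ge0//.
rewrite -!FE; apply: hmin; apply/mem_set; split => //.
Qed.

(** Chord-arc inequality: locally by Taylor expansion, globally by compactness
    and injectivity. As the curve is closed, the arc from s to sg is measured
    to the nearest of the parameters sg, sg - L, sg + L. *)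
Lemma chord_arc : exists2 c, 0 < c & forall s sg, 0 <= s <= L -> 0 <= sg <= L ->
  exists2 a, a \in [:: sg; sg - L; sg + L] & c * `|s - a| <= cmod (gam s - gam sg).
Proof.
have B0 := arc_B_ge0; pose e := (2 * (B + 1))^-1.
have e0 : 0 < e by rewrite invr_gt0; lra.
have [m m0 hm] := arc_far (exprn_gt0 3 e0).
exists (Num.min (2^-1) (m / L)); first by rewrite lt_min invr_gt0 ltr0n /= divr_gt0.
move=> s sg sI sgI.
have near a : a \in [:: sg; sg - L; sg + L] -> `|s - a| <= e ->
    exists2 a, a \in [:: sg; sg - L; sg + L] &
      Num.min (2^-1) (m / L) * `|s - a| <= cmod (gam s - gam sg).
  move=> aI sa; exists a => //; have -> : gam sg = gam a.
    by move: aI; rewrite !inE => /or3P[] /eqP ->; rewrite ?arc_perB ?(arc_per gamP).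
  apply: le_trans (arc_near _); first by rewrite ler_wpM2r// ge_min lexx.
  apply: (@le_trans _ _ ((B + 1) * e)); last first.
    by rewrite /e invfM mulrCA divff ?mulr1// gt_eqF// ltr_wpDl.
  by apply: ler_pM => //; lra.
have [|h1] := leP `|s - sg| e; first by apply: near; rewrite !inE eqxx.
have [|h2] := leP `|s - (sg - L)| e; first by apply: near; rewrite !inE eqxx orbT.
have [|h3] := leP `|s - (sg + L)| e; first by apply: near; rewrite !inE eqxx !orbT.
exists sg; first by rewrite !inE eqxx.
apply: (@le_trans _ _ m).
  apply: (@le_trans _ _ (m / L * L)); last by rewrite divfK// gt_eqF.
  apply: ler_pM => //; rewrite ?le_min ?invr_ge0 ?ler0n ?divr_ge0 ?(ltW m0) ?(ltW L0)//=.
    by rewrite ge_min lexx orbT.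
  by move: sI sgI; rewrite ler_norml => /andP[? ?] /andP[? ?]; lra.
apply: hm => //; rewrite /prod3 !normrM.
have -> : s - sg - L = s - (sg + L) by ring.
have -> : s - sg + L = s - (sg - L) by ring.
have -> : e ^+ 3 = e * e * e by ring.
by apply: ler_pM; rewrite ?mulr_ge0 ?(ltW e0)//; [apply: ler_pM; rewrite ?(ltW e0)//|]; exact: ltW.
Qed.

End CurveGeometry.

(** * Integrals of regularized singularities *)

Section DominatingFunctions.
Variable R : realType.
Variable beta L : R.
Hypothesis beta01 : 0 < beta < 1.
Hypothesis L0 : 0 < L.
Implicit Types (rho u s a : R).

(** The singularity |u|^(beta - 1), regularized at scale rho. *)
Definition sing rho u : R := (rho ^+ 2 + u ^+ 2) `^ ((beta - 1) / 2).

Let H rho u : R := u * sing rho u.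
Let h rho u : R := sing rho u +
  (beta - 1) * u ^+ 2 * (rho ^+ 2 + u ^+ 2) `^ ((beta - 1) / 2 - 1).

Let pos rho u : 0 < rho -> 0 < rho ^+ 2 + u ^+ 2.
Proof. by move=> r0; rewrite ltr_pwDl ?exprn_gt0 ?sqr_ge0. Qed.

Let sing_der rho u e : 0 < rho -> is_derive u 1 (fun u => (rho ^+ 2 + u ^+ 2) `^ e)
  (2 * u * e * (rho ^+ 2 + u ^+ 2) `^ (e - 1)).
Proof.
move=> r0; have dp := is_derive1_powR e (pos u r0).
have dq : is_derive u 1 (fun u => rho ^+ 2 + u ^+ 2) (2 * u).
  by apply: is_derive_eq; rewrite /GRing.scale /=; ring.
have := @is_derive1_comp R (fun x => x `^ e) (fun u => rho ^+ 2 + u ^+ 2) u _ _ dp dq.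
by move=> hd; apply: (is_derive_eq hd); ring.
Qed.

Let H_der rho u : 0 < rho -> is_derive u 1 (H rho) (h rho u).
Proof.
move=> r0; have d1 := sing_der u ((beta - 1) / 2) r0.
have d2 := is_deriveM (is_derive_id u (1 : R)) d1.
apply: (is_derive_eq d2); by rewrite /h /GRing.scale /sing /=; field.
Qed.

Let h_cont rho : 0 < rho -> continuous (h rho).
Proof.
move=> r0 u; have c e : {for u, continuous (fun u : R => (rho ^+ 2 + u ^+ 2) `^ e)}.
  apply: differentiable_continuous; apply/derivable1_diffP.
  by have [] := sing_der u e r0.
apply: cvgD; first exact: c.
apply: cvgM; last exact: c.
by apply: cvgM; [exact: cvg_cst|exact: exprn_continuous].
Qed.

(** The primitive of sing is not elementary, but beta sing lies below h, whose
    primitive H = u sing(u) is. *)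
Let h_ge rho u : 0 < rho -> beta * sing rho u <= h rho u.
Proof.
move=> r0; have [b0 b1] := andP beta01; have p0 := pos u r0.
set y := rho ^+ 2 + u ^+ 2 in p0.
have -> : h rho u = sing rho u + (beta - 1) * (u ^+ 2 / y) * sing rho u.
  have e1 : y `^ ((beta - 1) / 2) = y `^ ((beta - 1) / 2 - 1) * y.
    by rewrite -{3}(powRr1 (ltW p0)) -powRD ?subrK// (gt_eqF p0) implybT.
  by rewrite /h -/y /sing -/y [in RHS]e1 [in LHS]e1; field; rewrite gt_eqF.
have s0 : 0 <= sing rho u by exact: powR_ge0.
have : u ^+ 2 / y <= 1 by rewrite ler_pdivrMr// mul1r /y lerDr sqr_ge0.
have : 0 <= u ^+ 2 / y by rewrite divr_ge0 ?sqr_ge0// ltW.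
move: (u ^+ 2 / y) (sing rho u) s0 => r S S0 rp r1.
have : 0 <= (1 - beta) * (1 - r) * S by rewrite !mulr_ge0// subr_ge0// ltW.
nra.
Qed.

Let H_le rho u : 0 < rho -> `|H rho u| <= 1 + `|u|.
Proof.
move=> r0; have [b0 b1] := andP beta01; have p0 := pos u r0.
rewrite /H normrM (ger0_norm (powR_ge0 _ _)) /sing.
set y := rho ^+ 2 + u ^+ 2 in p0 *.
have [y1|/ltW y1] := leP y 1; last first.
  apply: (@le_trans _ _ (`|u| * 1)); last by rewrite mulr1 lerDr.
  have e0 : (beta - 1) / 2 <= 0 by lra.
  by rewrite ler_wpM2l//; have := ler_powR y1 e0; rewrite powRr0.
apply: (@le_trans _ _ 1); last by rewrite lerDl.
have -> : (beta - 1) / 2 = - ((1 - beta) / 2) by field.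
rewrite powRN -/y ler_pdivrMr ?powR_gt0// mul1r.
apply: (@le_trans _ _ (y `^ 2^-1)); last first.
  by apply: ger_powR; rewrite ?p0//; lra.
rewrite powR12_sqrt ?(ltW p0)// -sqrtr_sqr ler_wsqrtr// /y lerDr sqr_ge0//.
Qed.

Let poisson rho u : R := rho / (rho ^+ 2 + u ^+ 2).

Let poisson_der rho u : 0 < rho ->
  is_derive u 1 (fun u => atan (u / rho)) (poisson rho u).
Proof.
move=> r0; have dl : is_derive u 1 (fun u => u / rho) rho^-1.
  by apply: is_derive_eq; rewrite /GRing.scale /=; ring.
have := @is_derive1_comp R (@atan R) (fun u => u / rho) u _ _ (is_derive1_atan _) dl.
move=> hd; apply: (is_derive_eq hd); rewrite /poisson.
have := pos u r0 => p0; field; rewrite !gt_eqF//= ltr_pwDl ?exprn_gt0 ?sqr_ge0//.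
Qed.

Let poisson_cont rho : 0 < rho -> continuous (poisson rho).
Proof.
move=> r0 u; apply: cvgM; first exact: cvg_cst.
apply: cvgV; first by rewrite gt_eqF// pos.
by apply: cvgD; [exact: cvg_cst|exact: exprn_continuous].
Qed.

(** Both singularities are dominated by functions with explicit primitives, u
    sing(u) / beta and atan(u / rho), and these are bounded independently of
    rho. Only the nearest of the three copies of the base point sg matters, but
    adding up all three avoids distinguishing cases. *)
Lemma dominated_cintegral : exists2 K, 0 <= K & forall rho sg C f,
  0 < rho -> 0 <= sg <= L -> 0 <= C -> ccont f ->
  (forall s, 0 <= s <= L -> exists2 a, a \in [:: sg; sg - L; sg + L] &
     cmod (f s) <= C * (sing rho (s - a) + rho / (rho ^+ 2 + (s - a) ^+ 2) + 1)) ->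
  cmod (cintegral 0 L f) <= C * K.
Proof.
have [b0 b1] := andP beta01; pose K1 := 2 * (beta^-1 * (1 + 2 * L) + 2).
have K10 : 0 <= K1 by rewrite mulr_ge0// addr_ge0// mulr_ge0 ?invr_ge0 ?ltW// addr_gt0// mulr_gt0.
exists (K1 + K1 + K1 + L); first by rewrite !addr_ge0// ltW.
move=> rho sg C f r0 /andP[sg0 sgL] C0 cf hf.
pose ha a s := beta^-1 * h rho (s - a) + poisson rho (s - a).
pose Ha a s := beta^-1 * H rho (s - a) + atan ((s - a) / rho).
have daff a s : is_derive s (1 : R) (fun s : R => s - a) 1.
  by apply: is_derive_eq; rewrite subr0.
have dHa a s : is_derive s 1 (Ha a) (ha a s).
  have d1 := @is_derive1_comp R (H rho) (fun s => s - a) s _ _ (H_der _ r0) (daff a s).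
  have d2 := @is_derive1_comp R (fun u => atan (u / rho)) (fun s => s - a) s _ _
    (poisson_der _ r0) (daff a s).
  have := is_deriveD (is_deriveZ (beta^-1) d1) d2.
  by move=> hd; apply: (is_derive_eq hd); rewrite /GRing.scale /= !mulr1.
have cha a : continuous (ha a).
  move=> s; have c1 : (fun s : R => s - a) @ s --> s - a.
    by apply: cvgB; [exact: cvg_id|exact: cvg_cst].
  apply: cvgD; first (apply: cvgM; first exact: cvg_cst).
  - apply: (@continuous_comp _ _ _ (fun s : R => s - a) (h rho) s c1); exact: h_cont.
  - apply: (@continuous_comp _ _ _ (fun s : R => s - a) (poisson rho) s c1).
    exact: poisson_cont.
have ha0 a s : 0 <= ha a s.
  rewrite addr_ge0 ?divr_ge0 ?(ltW (pos _ r0)) ?(ltW r0)// mulr_ge0 ?invr_ge0 ?(ltW b0)//.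
  by apply: le_trans (h_ge _ r0); rewrite mulr_ge0 ?powR_ge0// ltW.
have hale a s : sing rho (s - a) + rho / (rho ^+ 2 + (s - a) ^+ 2) <= ha a s.
  by rewrite lerD2r ler_pdivlMl// h_ge.
have HaB a s : `|s - a| <= 2 * L -> `|Ha a s| <= beta^-1 * (1 + 2 * L) + 2.
  move=> sa; apply: le_trans (ler_normD _ _) _; apply: lerD.
    rewrite normrM ger0_norm ?invr_ge0 ?(ltW b0)// ler_wpM2l ?invr_ge0 ?(ltW b0)//.
    by apply: le_trans (H_le _ r0) _; rewrite lerD2l.
  rewrite ler_norml (ltW (lt_trans (atan_ltpi2 _) (pihalf_lt2 R))) andbT.
  have := atan_gtNpi2 ((s - a) / rho); have := pihalf_lt2 R; lra.
have HaD a : `|0 - a| <= 2 * L -> `|L - a| <= 2 * L -> Ha a L - Ha a 0 <= K1.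
  move=> /HaB h1 /HaB h2; rewrite /K1.
  have := ler_norm (Ha a L); have := ler_norm (- Ha a 0); rewrite normrN; lra.
pose hh s := C * (ha sg s + ha (sg - L) s + ha (sg + L) s + 1).
pose HH s := C * (Ha sg s + Ha (sg - L) s + Ha (sg + L) s + s).
have dHH s : is_derive s 1 HH (hh s).
  have h4 := is_deriveD (is_deriveD (is_deriveD (dHa sg s) (dHa (sg - L) s)) (dHa (sg + L) s))
    (is_derive_id s (1 : R)).
  exact: (is_deriveZ C h4).
have chh : continuous hh.
  move=> s; apply: cvgM; first exact: cvg_cst.
  apply: cvgD; last exact: cvg_cst.
  by apply: cvgD; [apply: cvgD|]; exact: cha.
apply: le_trans (cintegral_le L0 cf chh dHH _) _.
  move=> s /hf[a aI fa]; apply: le_trans fa _; rewrite ler_wpM2l// lerD2r.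
  apply: le_trans (hale a s) _.
  have := ha0 sg s; have := ha0 (sg - L) s; have := ha0 (sg + L) s.
  by move: aI; rewrite !inE => /or3P[] /eqP ->; lra.
rewrite -mulrBr ler_wpM2l//.
have hA : Ha sg L - Ha sg 0 <= K1 by apply: HaD; rewrite ler_norml; lra.
have hB : Ha (sg - L) L - Ha (sg - L) 0 <= K1 by apply: HaD; rewrite ler_norml; lra.
have hC : Ha (sg + L) L - Ha (sg + L) 0 <= K1 by apply: HaD; rewrite ler_norml; lra.
lra.
Qed.

End DominatingFunctions.

(** * Layer potentials near the curve *)

Section PotentialBounds.
Variable R : realType.
Variables (beta kap : R).
Hypothesis beta01 : 0 < beta < 1.
Hypothesis kap_gt0 : 0 < kap.
Implicit Types (s u rho sg K : R) (x z : R[i]).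

Notation A := (multipole (@besH R) kap).

(** Nontangential position of x near the point of parameter sg: up to the
    constant c, x is as far from the curve as if the curve were a line at
    distance rho. All the bounds below are uniform in x for fixed c. *)
Record above (gam : R -> R[i]) (L c : R) x rho sg : Prop := Above {
  above_rho : 0 < rho;
  above_sg : 0 <= sg <= L;
  above_off : forall s, x != gam s;
  above_le : cmod (x - gam sg) <= rho;
  above_ge : forall s, 0 <= s <= L -> exists2 a, a \in [:: sg; sg - L; sg + L] &
     c * (rho ^+ 2 + (s - a) ^+ 2) <= cmod (x - gam s) ^+ 2 }.

Section Curve.
Variables (gam g1 : R -> R[i]) (L B c : R).
Hypothesis gamP : arc_curve gam g1 L B.
Hypothesis g1_smooth : forall j, exists M, hbnd beta L j M g1.
Hypothesis c_gt0 : 0 < c.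
Let L0 : 0 < L := arc_L gamP.

Definition potential (p : int) (psi : R -> R[i]) x : R[i] :=
  cintegral 0 L (fun s => A p (x - gam s) * psi s).

Let g1_cont : ccont g1.
Proof. by have [M /(hbnd_cont beta01)] := g1_smooth 0. Qed.

Let bessel_off x s : x != gam s -> bessel_at (@besH R) ((kap * cmod (x - gam s)) ^+ 2).
Proof.
move=> xs; apply: bessel_at_besH; rewrite exprn_gt0// mulr_gt0// cmod_gt0.
by rewrite subr_eq0.
Qed.

Lemma multipole_curve_der p x s : x != gam s ->
  cder (fun t => A p (x - gam t)) s
   (kap%:C * (g1 s * A (p + 1) (x - gam s) - conjc (g1 s) * A (p - 1) (x - gam s))).
Proof.
move=> xs; have dz : cder (fun t => x - gam t) s (0 - g1 s).
  by apply: cderB; [exact: cder_cst|exact: arc_der gamP s].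
apply: (cder_eq (multipole_der p dz (bessel_off xs))).
by rewrite sub0r rmorphN; ring.
Qed.

Lemma multipole_curve_cont p x : (forall s, x != gam s) -> ccont (fun s => A p (x - gam s)).
Proof.
by move=> xs; apply: cder_cont => s; eexists; exact: multipole_curve_der.
Qed.

Lemma potential_cont p x psi : (forall s, x != gam s) -> ccont psi ->
  ccont (fun s => A p (x - gam s) * psi s).
Proof. by move=> xs cpsi; apply: ccontM => //; exact: multipole_curve_cont. Qed.

(** Since |g1| = 1, an integration by parts along the curve trades one order of
    the multipole for one derivative of the density. *)
Lemma potential_raise p x psi eta' : (forall s, x != gam s) ->
  ccont psi -> (forall s, psi (s + L) = psi s) -> ccont eta' ->
  (forall s, cder (fun t => conjc (g1 t) * psi t) s (eta' s)) ->
  potential (p + 1) psi x =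
    potential (p - 1) (fun s => conjc (g1 s) * (conjc (g1 s) * psi s)) x
    - (kap^-1)%:C * potential p eta' x.
Proof.
move=> xs cpsi ppsi ceta deta.
have cg : ccont (fun s => conjc (g1 s)).
  case: g1_cont => h1 h2; split=> s;
    [by under [X in continuous_at _ X]funext do rewrite cReJ; exact: h1|
    by under [X in continuous_at _ X]funext do rewrite cImJ; apply: cvgN; exact: h2].
have cg2 : ccont (fun s => conjc (g1 s) * (conjc (g1 s) * psi s)).
  by apply: ccontM => //; exact: ccontM.
have c1 := potential_cont (p + 1) xs cpsi.
have c2 := potential_cont (p - 1) xs cg2.
have c3 := potential_cont p xs ceta.
pose F s := A p (x - gam s) * (conjc (g1 s) * psi s).
have dF s : cder F s (kap%:C * (A (p + 1) (x - gam s) * psi s -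
    A (p - 1) (x - gam s) * (conjc (g1 s) * (conjc (g1 s) * psi s)))
    + A p (x - gam s) * eta' s).
  apply: (cder_eq (cderM (multipole_curve_der p (xs s)) (deta s))).
  have := mul_conjc (g1 s); rewrite (arc_unit gamP) expr1n => e.
  congr (_ + _).
  transitivity (kap%:C * (A (p + 1) (x - gam s) * psi s * (g1 s * conjc (g1 s)) -
    A (p - 1) (x - gam s) * (conjc (g1 s) * (conjc (g1 s) * psi s)))); first by ring.
  by rewrite e mulr1; ring.
have pg s : g1 (s + L) = g1 s by apply: (cder_per (arc_per gamP) (arc_der gamP)).
have FL : F L = F 0.
  by rewrite /F -(add0r L) (arc_per gamP) pg ppsi.
have := cintegral_derivative L0 _ dF; rewrite FL subrr => int0.
have {int0} : kap%:C * (potential (p + 1) psi x -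
    potential (p - 1) (fun s => conjc (g1 s) * (conjc (g1 s) * psi s)) x)
    + potential p eta' x = 0.
  rewrite -int0; last first.
    by apply: ccontD => //; apply: ccontM; [exact: ccont_cst|exact: ccontB].
  rewrite cintegralD//; last by apply: ccontM; [exact: ccont_cst|exact: ccontB].
  by rewrite cintegralZ ?cintegralB//; exact: ccontB.
move=> /eqP; rewrite addr_eq0 => /eqP e.
have k0 : kap%:C != 0 :> R[i] by rewrite -cmod_gt0 cmodC normr_gt0 gt_eqF.
apply: (mulfI k0); rewrite mulrBr mulrA -rmorphM /= divff ?gt_eqF// mul1r.
by rewrite -e; ring.
Qed.

Let sing_le c' v rho u : 0 < c' -> 0 < rho -> c' * (rho ^+ 2 + u ^+ 2) <= v ->
  v `^ ((beta - 1) / 2) <= c' `^ ((beta - 1) / 2) * sing beta rho u.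
Proof.
move=> c0 r0 h; have p0 : 0 < rho ^+ 2 + u ^+ 2 by rewrite ltr_pwDl ?exprn_gt0 ?sqr_ge0.
rewrite /sing -powRM ?(ltW c0) ?(ltW p0)//.
have -> : (beta - 1) / 2 = - ((1 - beta) / 2) by field.
have b1 : 0 <= (1 - beta) / 2 by case/andP: beta01 => ? ?; lra.
have cp : 0 < c' * (rho ^+ 2 + u ^+ 2) by exact: mulr_gt0.
have v0 := lt_le_trans cp h.
rewrite !powRN lef_pV2 ?posrE ?powR_gt0//.
by apply: ge0_ler_powR => //; rewrite nnegrE ltW.
Qed.

Lemma multipole0_le : exists2 C, 0 <= C & forall x rho sg s,
  above gam L c x rho sg -> 0 <= s <= L -> exists2 a, a \in [:: sg; sg - L; sg + L] &
  cmod (A 0 (x - gam s)) <= C * (sing beta rho (s - a) + 1).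
Proof.
have [b0 b1] := andP beta01; have e0 : 0 < (1 - beta) / 2 by lra.
have [C0 C00 hC0] := besH0_near_bound e0.
pose c' := kap ^+ 2 * c; have c'0 : 0 < c' by rewrite mulr_gt0// exprn_gt0.
pose M := c' `^ ((beta - 1) / 2); have M0 : 0 <= M by exact: powR_ge0.
exists (C0 * (M + 1)); first by rewrite mulr_ge0// addr_ge0.
move=> x rho sg s xP /(above_ge xP)[a aI ha]; exists a => //.
have r0 := above_rho xP; have xs := above_off xP.
rewrite cmod_multipole ?(ltW kap_gt0)// expr0 mul1r.
have v0 : 0 < (kap * cmod (x - gam s)) ^+ 2.
  by rewrite exprn_gt0// mulr_gt0// cmod_gt0 subr_eq0.
have hs : ((kap * cmod (x - gam s)) ^+ 2) `^ ((beta - 1) / 2) <= M * sing beta rho (s - a).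
  by apply: sing_le => //; rewrite exprMn /c' -mulrA ler_wpM2l// exprn_ge0// ltW.
have S0 : 0 <= sing beta rho (s - a) by exact: powR_ge0.
have := hC0 _ v0; rewrite (_ : - ((1 - beta) / 2) = (beta - 1) / 2); last by field.
move=> h1; apply: le_trans h1 _; rewrite -mulrA ler_wpM2l//.
move: (sing _ _ _) S0 hs => S S0 hs; apply: le_trans (lerD hs (lexx _)) _.
nra.
Qed.

Lemma potential0_le : exists2 C, 0 <= C & forall x rho sg psi K,
  above gam L c x rho sg -> ccont psi -> (forall s, cmod (psi s) <= K) ->
  cmod (potential 0 psi x) <= C * K.
Proof.
have [C C0 hC] := multipole0_le; have [D D0 hD] := dominated_cintegral beta01 L0.
exists (C * D); first by rewrite mulr_ge0.
move=> x rho sg psi K xP cpsi psiK.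
have K0 : 0 <= K by exact: le_trans (cmod_ge0 _) (psiK 0).
have r0 := above_rho xP; have xs := above_off xP; rewrite mulrAC.
apply: (hD rho sg _ _ r0 (above_sg xP)); [by rewrite mulr_ge0|exact: potential_cont|].
move=> s /(hC _ _ _ _ xP)[a aI ha]; exists a => //.
rewrite cmodM mulrAC; apply: ler_pM; rewrite ?cmod_ge0//.
apply: le_trans ha _; rewrite ler_wpM2l// lerD2r lerDl.
by rewrite divr_ge0 ?(ltW r0)// addr_ge0 ?sqr_ge0.
Qed.

(** The integrand is a derivative along the closed curve. *)
Let zero_loop x : (forall s, x != gam s) ->
  cintegral 0 L (fun s => g1 s * A 1 (x - gam s) - conjc (g1 s) * A (- 1) (x - gam s)) = 0.
Proof.
move=> xs; have k0 : kap%:C != 0 :> R[i] by rewrite -cmod_gt0 cmodC normr_gt0 gt_eqF.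
have dF s := multipole_curve_der 0 (xs s).
have cg : ccont (fun s => conjc (g1 s)) by have [M /hbndJ/(hbnd_cont beta01)] := g1_smooth 0.
have cf : ccont (fun s => g1 s * A 1 (x - gam s) - conjc (g1 s) * A (- 1) (x - gam s)).
  by apply: ccontB; apply: ccontM => //; exact: multipole_curve_cont.
apply: (mulfI k0); rewrite mulr0 -cintegralZ//.
rewrite (cintegral_derivative L0 _ dF).
  by rewrite -[in gam L](add0r L) (arc_per gamP) subrr.
by apply: ccontM => //; exact: ccont_cst.
Qed.

(** The borderline case, where the kernel is of order 1 / distance and the
    density is merely Holder continuous. Write psi = g1 g, with g still Holder
    continuous. Subtracting from g its value at the base point makes the
    integrand integrable. What remains is a constant times the kernel integrated
    against g1; by [zero_loop] it may be symmetrized in g1 and its conjugate,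
    which leaves the imaginary part of g1 / (x - gam), a Poisson kernel up to a
    bounded term. *)
Lemma potential1_le : exists2 C, 0 <= C & forall x rho sg psi K,
  above gam L c x rho sg -> hbnd beta L 0 K psi -> cmod (potential 1 psi x) <= C * K.
Proof.
have [b0 b1] := andP beta01; have B0 := arc_B_ge0 gamP.
have [C1 C10 hC1] := besH1_near_bound R.
have [D D0 hD] := dominated_cintegral beta01 L0.
have [Cm Cm0 hCm] := @hbndM R beta L beta01 0.
have [G hG] := g1_smooth 0; have G0 := hbnd_ge0 hG.
have sc0 : 0 < Num.sqrt c by rewrite sqrtr_gt0.
have kc0 : 0 < kap * c by exact: mulr_gt0.
have ks0 : 0 < kap * Num.sqrt c by exact: mulr_gt0.
pose E := C1 * ((kap * Num.sqrt c)^-1 + 2) + C1 * ((kap * c)^-1 * (1 + B) + 1).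
have E0 : 0 <= E.
  have W1 : 0 <= (kap * Num.sqrt c)^-1 by rewrite invr_ge0 ltW.
  have W2 : 0 <= (kap * c)^-1 by rewrite invr_ge0 ltW.
  by rewrite /E addr_ge0// mulr_ge0// addr_ge0// mulr_ge0// addr_ge0.
exists (E * (Cm * G) * D); first by rewrite !mulr_ge0.
move=> x rho sg psi K xP psiP.
have K0 := hbnd_ge0 psiP; have r0 := above_rho xP; have xs := above_off xP.
pose g s := conjc (g1 s) * psi s; have gP : hbnd beta L 0 (Cm * (G * K)) g.
  by apply: hCm => //; exact: hbndJ.
set K' := Cm * (G * K) in gP; have K'0 := hbnd_ge0 gP.
have -> : E * (Cm * G) * D * K = E * K' * D by rewrite /K'; ring.
clearbody K'.
have cg := hbnd_cont beta01 gP.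
have cgJ : ccont (fun s => conjc (g1 s)) := hbnd_cont beta01 (hbndJ hG).
have cA p : ccont (fun s => A p (x - gam s)) by exact: multipole_curve_cont.
pose F1 s := A 1 (x - gam s) * g1 s * (g s - g sg).
pose F2 s := g1 s * A 1 (x - gam s) + conjc (g1 s) * A (- 1) (x - gam s).
pose F3 s := g1 s * A 1 (x - gam s) - conjc (g1 s) * A (- 1) (x - gam s).
have cF1 : ccont F1.
  by apply: ccontM; [exact: ccontM|apply: ccontB => //; exact: ccont_cst].
have cF2 : ccont F2 by apply: ccontD; exact: ccontM.
have cF3 : ccont F3 by apply: ccontB; exact: ccontM.
have c2 : ccont (fun s => g sg / 2 * F2 s) by apply: ccontM => //; exact: ccont_cst.
have c3 : ccont (fun s => g sg / 2 * F3 s) by apply: ccontM => //; exact: ccont_cst.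
have -> : potential 1 psi x = cintegral 0 L (fun s => F1 s + g sg / 2 * F2 s).
  have -> : potential 1 psi x = cintegral 0 L (fun s => (F1 s + g sg / 2 * F2 s) + g sg / 2 * F3 s).
    congr cintegral; apply/funext => s.
    have -> : psi s = g1 s * g s.
      by rewrite /g mulrA mul_conjc (arc_unit gamP) expr1n mul1r.
    by rewrite /F1 /F2 /F3; field.
  rewrite cintegralD//; last exact: ccontD.
  by rewrite (cintegralZ _ _ _ cF3) zero_loop// mulr0 addr0.
apply: (hD rho sg _ _ r0 (above_sg xP)); [exact: mulr_ge0|exact: ccontD|].
move=> s /(above_ge xP)[a aI ha]; exists a => //.
have gamE : gam sg = gam a.
  by move: aI; rewrite !inE => /or3P[] /eqP ->; rewrite ?(arc_perB gamP) ?(arc_per gamP).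
have gE : g sg = g a.
  have pgB t : g (t - L) = g t by rewrite -[in RHS](subrK L t) (hbnd_per _ gP).
  by move: aI; rewrite !inE => /or3P[] /eqP ->; rewrite ?pgB ?(hbnd_per _ gP).
set z := x - gam s in ha *; set u := s - a in ha *.
have z0 : 0 < cmod z by rewrite cmod_gt0 subr_eq0.
have q0 : 0 < rho ^+ 2 + u ^+ 2 by rewrite ltr_pwDl ?exprn_gt0 ?sqr_ge0.
have v0 : 0 < (kap * cmod z) ^+ 2 by rewrite exprn_gt0// mulr_gt0.
have sv : Num.sqrt ((kap * cmod z) ^+ 2) = kap * cmod z.
  by rewrite sqrtr_sqr ger0_norm// mulr_ge0 ?ltW.
have kz0 : 0 < kap * cmod z by exact: mulr_gt0.
have hH := hC1 _ v0; rewrite sv in hH.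
have S0 : 0 <= sing beta rho u by exact: powR_ge0.
set P := rho / (rho ^+ 2 + u ^+ 2); have P0 : 0 <= P by rewrite divr_ge0 ?ltW.
set h1 := besH 1 ((kap * cmod z) ^+ 2) in hH.
have iz : (cmod z)^-1 <= (Num.sqrt c)^-1 * (Num.sqrt (rho ^+ 2 + u ^+ 2))^-1.
  rewrite -invfM -sqrtrM ?(ltW c_gt0)// lef_pV2 ?posrE ?sqrtr_gt0 ?mulr_gt0//.
  rewrite -[leRHS]ger0_norm ?cmod_ge0// -sqrtr_sqr ler_wsqrtr//.
(* Times the increment of the density, the singularity improves from
   |x - gam s|^(-1) to |x - gam s|^(beta - 1). *)
have bF1 : cmod (F1 s) <= C1 * ((kap * Num.sqrt c)^-1 + 2) * K' * (sing beta rho u + 1).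
  rewrite /F1 -/z (cmodM (A 1 z * g1 s)) (cmodM (A 1 z)) (arc_unit gamP) mulr1.
  rewrite cmod_multipole ?(ltW kap_gt0)// -/h1 expr1.
  have a1 : kap * cmod z * cmod h1 <= C1 * ((kap * cmod z)^-1 + 1).
    apply: le_trans (ler_wpM2l (ltW kz0) hH) _.
    rewrite mulrCA ler_wpM2l// le_eqVlt; apply/orP; left; apply/eqP.
    by field; rewrite !gt_eqF.
  have a2 : cmod (g s - g sg) <= K' * `|u| `^ beta by rewrite gE; case: gP => _ _; exact.
  have a3 : cmod (g s - g sg) <= 2 * K'.
    apply: le_trans (cmodB _ _) _; have := hbnd_le s gP; have := hbnd_le sg gP; lra.
  have a4 : `|u| `^ beta * (Num.sqrt (rho ^+ 2 + u ^+ 2))^-1 <= sing beta rho u.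
    have -> : sing beta rho u = (rho ^+ 2 + u ^+ 2) `^ (beta / 2) *
        (Num.sqrt (rho ^+ 2 + u ^+ 2))^-1.
      rewrite -powR12_sqrt ?(ltW q0)// -powRN -powRD; last by rewrite (gt_eqF q0) implybT.
      by rewrite /sing; congr (_ `^ _); field.
    rewrite ler_wpM2r ?invr_ge0 ?sqrtr_ge0//.
    have -> : `|u| = (u ^+ 2) `^ 2^-1 by rewrite powR12_sqrt ?sqr_ge0// sqrtr_sqr.
    rewrite -powRrM mulrC; apply: ge0_ler_powR; rewrite ?nnegrE ?sqr_ge0 ?(ltW q0)//.
      by rewrite mulr_ge0 ?invr_ge0// ltW.
    by rewrite lerDr sqr_ge0.
  apply: (@le_trans _ _ (C1 * ((kap * cmod z)^-1 * (K' * `|u| `^ beta) + 2 * K'))).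
    apply: le_trans (ler_wpM2r (cmod_ge0 _) a1) _; rewrite -mulrA ler_wpM2l// mulrDl mul1r.
    by rewrite lerD// ler_wpM2l// invr_ge0 ltW.
  rewrite -!mulrA ler_wpM2l//.
  have a5 : (kap * cmod z)^-1 * (K' * `|u| `^ beta) <= (kap * Num.sqrt c)^-1 * K' * sing beta rho u.
    rewrite !invfM -!mulrA ler_wpM2l ?invr_ge0 ?(ltW kap_gt0)// [leRHS]mulrCA [leLHS]mulrCA.
    rewrite ler_wpM2l//; apply: le_trans (ler_wpM2r (powR_ge0 _ _) iz) _.
    by rewrite -mulrA ler_wpM2l ?invr_ge0 ?(ltW sc0)// mulrC.
  apply: le_trans (lerD a5 (lexx _)) _.
  have : 0 <= (kap * Num.sqrt c)^-1 * K' by rewrite mulr_ge0// invr_ge0 ltW.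
  have : 0 <= K' * sing beta rho u by exact: mulr_ge0.
  move: (_^-1) (sing _ _ _) => W S; nra.
(* With the density frozen, only the imaginary part survives. *)
have bF2 : cmod (g sg / 2 * F2 s) <= C1 * ((kap * c)^-1 * (1 + B) + 1) * K' * (P + 1).
  have F2E : F2 s = (kap * 2 * complex.Im (g1 s * conjc z))%:C * 'i * h1.
    rewrite /F2 -/z (_ : A 1 z = kap%:C * conjc z * h1)// (_ : A (- 1) z = - kap%:C * z * h1)//.
    by apply: complex_ext; rewrite !ReImE /=; ring.
  have imz : `|complex.Im (g1 s * conjc z)| <= rho + B * u ^+ 2.
    have -> : z = (x - gam sg) - (gam s - gam a) by rewrite gamE /z; ring.
    rewrite rmorphB mulrBr cImD cImN; apply: le_trans (ler_normB _ _) _; apply: lerD.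
      apply: le_trans (Im_le_cmod _) _; rewrite cmodM (arc_unit gamP) mul1r cmodJ.
      exact: above_le xP.
    exact: arc_Im gamP a s.
  have imz' : `|complex.Im (g1 s * conjc z)| <= cmod z.
    by apply: le_trans (Im_le_cmod _) _; rewrite cmodM (arc_unit gamP) mul1r cmodJ.
  have -> : cmod (g sg / 2 * F2 s) = cmod (g sg) * (kap * `|complex.Im (g1 s * conjc z)| * cmod h1).
    rewrite F2E !cmodM cmodV cmodC !normrM (gtr0_norm kap_gt0) (_ : cmod 'i = 1); last first.
      by rewrite /cmod /= expr0n expr1n add0r sqrtr1.
    rewrite (_ : cmod 2 = 2); last by rewrite -[2](rmorph_nat (real_complex R)) cmodC normr_nat.
    by rewrite normr_nat; field.
  have -> : C1 * ((kap * c)^-1 * (1 + B) + 1) * K' * (P + 1) =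
    K' * (C1 * (((kap * c)^-1 * (1 + B) + 1) * (P + 1))) by ring.
  apply: ler_pM; rewrite ?cmod_ge0 ?mulr_ge0 ?cmod_ge0 ?(ltW kap_gt0)//.
    exact: hbnd_le sg gP.
  set I := `|_| in imz imz' *; have I0 : 0 <= I by exact: normr_ge0.
  have kI : 0 <= kap * I by rewrite mulr_ge0// ltW.
  apply: le_trans (ler_wpM2l kI hH) _; rewrite mulrCA ler_wpM2l// mulrDr.
  have t2 : kap * I * (kap * cmod z)^-1 <= 1.
    by rewrite ler_pdivrMr// mul1r ler_wpM2l// ltW.
  have t1 : kap * I * ((kap * cmod z) ^+ 2)^-1 <= (kap * c)^-1 * (P + B).
    have -> : kap * I * ((kap * cmod z) ^+ 2)^-1 = kap^-1 * (I / cmod z ^+ 2).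
      by field; rewrite !gt_eqF.
    rewrite (invfM kap c) -mulrA ler_wpM2l ?invr_ge0 ?(ltW kap_gt0)//.
    rewrite ler_pdivrMr ?exprn_gt0//.
    apply: (@le_trans _ _ (c^-1 * (P + B) * (c * (rho ^+ 2 + u ^+ 2)))); last first.
      by rewrite ler_wpM2l// mulr_ge0 ?invr_ge0 ?(ltW c_gt0)// addr_ge0.
    have -> : c^-1 * (P + B) * (c * (rho ^+ 2 + u ^+ 2)) = rho + B * (rho ^+ 2 + u ^+ 2).
      by rewrite /P; field; rewrite !gt_eqF.
    apply: le_trans imz _; rewrite lerD2l ler_wpM2l// lerDr sqr_ge0//.
  apply: le_trans (lerD t1 t2) _.
  have W0 : 0 <= (kap * c)^-1 by rewrite invr_ge0 ltW.
  move: (_^-1) W0 => W W0.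
  have : 0 <= W * (B * P) by rewrite mulr_ge0// mulr_ge0.
  have := mulr_ge0 W0 P0; nra.
apply: le_trans (cmodD _ _) _; apply: le_trans (lerD bF1 bF2) _.
rewrite /E.
set X1 := C1 * (_ + 2); set X2 := C1 * (_ + 1).
have X10 : 0 <= X1 * K'.
  by rewrite mulr_ge0// mulr_ge0// addr_ge0// invr_ge0 ltW.
have X20 : 0 <= X2 * K'.
  by rewrite mulr_ge0// mulr_ge0// addr_ge0// mulr_ge0 ?invr_ge0 ?(ltW kc0)// addr_ge0.
clearbody X1 X2 P.
move: (sing _ _ _) S0 => S S0.
have := mulr_ge0 X10 P0; have := mulr_ge0 X20 S0.
lra.
Qed.

(** [potential_raise] reduces order n + 2 to the orders n + 1 and n, so the two
    previous lemmas start a two-step induction. *)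
Lemma potential_le n : exists2 C, 0 <= C & forall x rho sg psi K,
  above gam L c x rho sg -> hbnd beta L n.-1 K psi ->
  cmod (potential n%:Z psi x) <= C * K.
Proof.
suff : (exists2 C, 0 <= C & forall x rho sg psi K,
  above gam L c x rho sg -> hbnd beta L n.-1 K psi ->
  cmod (potential n%:Z psi x) <= C * K) /\ (exists2 C, 0 <= C & forall x rho sg psi K,
  above gam L c x rho sg -> hbnd beta L n K psi ->
  cmod (potential n.+1%:Z psi x) <= C * K) by case.
elim: n => [|n [[C C0 hC] [D D0 hD]]].
  split; last exact: potential1_le.
  have [C C0 hC] := potential0_le; exists C => // x rho sg psi K xP hp.
  by apply: hC xP (hbnd_cont beta01 hp) _ => s; exact: hbnd_le hp.
split; first by exists D.
have [G hG] := g1_smooth n.+1; have G0 := hbnd_ge0 hG.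
have [M M0 hM] := @hbndM R beta L beta01 n.+1.
pose T := 2 ^+ (n.+1 - n.-1) : R; have T0 : 0 <= T by rewrite exprn_ge0.
have k0 : 0 <= kap^-1 by rewrite invr_ge0 ltW.
exists (C * (T * (M * (G * (M * G)))) + kap^-1 * (D * (M * G))).
  by rewrite addr_ge0 ?mulr_ge0.
move=> x rho sg psi K xP hp; have K0 := hbnd_ge0 hp; have xs := above_off xP.
have h1 := hM _ _ _ _ (hbndJ hG) hp.
have h2 := hM _ _ _ _ (hbndJ hG) h1.
have [_ _ [eta' deta heta]] := h1.
have e : n.+2%:Z = n.+1%:Z + 1 by rewrite -PoszD addn1.
rewrite e (potential_raise n.+1%:Z xs (hbnd_cont beta01 hp) _
  (hbnd_cont beta01 heta) deta); last first.
  by move=> s; exact: hbnd_per hp.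
have -> : n.+1%:Z - 1 = n%:Z by rewrite -addn1 PoszD addrK.
have h3 : hbnd beta L n.-1 (T * (M * (G * (M * (G * K)))))
    (fun s => conjc (g1 s) * (conjc (g1 s) * psi s)).
  apply: hbnd_downs => //; rewrite subnKC//.
  by apply: leq_trans (leq_pred n) (leqnSn n).
apply: le_trans (cmodB _ _) _; rewrite cmodM cmodC ger0_norm//.
have i1 := hC _ _ _ _ _ xP h3; have i2 := ler_wpM2l k0 (hD _ _ _ _ _ xP heta).
by apply: le_trans (lerD i1 i2) _; rewrite le_eqVlt; apply/orP; left; apply/eqP; ring.
Qed.

End Curve.
End PotentialBounds.

(** * Differentiation under the integral sign *)

Section DerivativeUnderIntegral.
Variable R : realType.
Notation mu := (@lebesgue_measure R).

Lemma Rintegral_der (a b u v t M : R) (f f' : R -> R -> R) : u < t < v ->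
  (forall x, u < x < v -> continuous (f x)) ->
  (forall x s, u < x < v -> is_derive x 1 (fun y => f y s) (f' x s)) ->
  (forall x s, u < x < v -> a <= s <= b -> `|f' x s| <= M) ->
  is_derive t 1 (fun x => \int[mu]_(s in `[a, b]) f x s)
    (\int[mu]_(s in `[a, b]) f' t s).
Proof.
move=> tI cf df bf.
have mI := measurable_itv `[a, b] : measurable (`[a, b]%classic : set (measurableTypeR R)).
have tI' : (`]u, v[%classic : set R) t by rewrite /= in_itv /=.
have intf x : (`]u, v[%classic : set R) x -> mu.-integrable `[a, b] (EFin \o f x).
  by rewrite /= in_itv /= => xI; apply: continuous_itv_integrable; exact: cf.
have derf x s : (`]u, v[%classic : set R) x -> (`[a, b]%classic : set R) s ->
    derivable (f ^~ s) x 1.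
  by rewrite /= in_itv /= => xI _; have [] := df x s xI.
have intM : mu.-integrable `[a, b] (EFin \o (fun=> `|M|)).
  by apply: continuous_itv_integrable => s; exact: cvg_cst.
have d1 x s : u < x < v -> partial1of2 f x s = f' x s.
  by move=> xI; rewrite partial1of2E; have [_ ->] := df x s xI.
have G_ub x s : (`]u, v[%classic : set R) x -> (`[a, b]%classic : set R) s ->
    `|partial1of2 f x s| <= `|M|.
  rewrite /= !in_itv /= => xI sI; rewrite d1//.
  exact: le_trans (bf _ _ xI sI) (ler_norm M).
have h := derivable_under_integral mI tI' intf derf (fun=> normr_ge0 M) intM G_ub.
apply: DeriveDef; first exact: h.
rewrite -derive1E (differentiation_under_integral mI tI' intf derf (fun=> normr_ge0 M) intM G_ub).
by apply: eq_Rintegral => s _; rewrite d1.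
Qed.

Lemma cintegral_der (a b u v t M : R) (f f' : R -> R -> R[i]) : u < t < v ->
  (forall x, u < x < v -> ccont (f x)) ->
  (forall x s, u < x < v -> cder (fun y => f y s) x (f' x s)) ->
  (forall x s, u < x < v -> a <= s <= b -> cmod (f' x s) <= M) ->
  cder (fun x => cintegral a b (f x)) t (cintegral a b (f' t)).
Proof.
move=> tI cf df bf; split.
- apply: (@Rintegral_der a b u v t M (fun x s => complex.Re (f x s))
    (fun x s => complex.Re (f' x s)) tI).
  + by move=> x /cf[].
  + by move=> x s /(df x s)[].
  + by move=> x s xI sI; apply: le_trans (Re_le_cmod _) _; exact: bf.
- apply: (@Rintegral_der a b u v t M (fun x s => complex.Im (f x s))
    (fun x s => complex.Im (f' x s)) tI).
  + by move=> x /cf[].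
  + by move=> x s /(df x s)[].
  + by move=> x s xI sI; apply: le_trans (Im_le_cmod _) _; exact: bf.
Qed.

End DerivativeUnderIntegral.

(** * Sums over symmetric ranges of orders *)

Section SymmetricSums.
Variable R : realType.
Implicit Type u : int -> R[i].

(** The sum of u over |l| < n, defined by recursion so that passing from n to
    n + 1 adds the two terms l = n and l = -n (a single one if n = 0). *)
Fixpoint symsum n u : R[i] :=
  if n is n'.+1 then
    symsum n' u + (if n' is 0 then u 0 else u n'%:Z + u (- n'%:Z))
  else 0.

Lemma symsum_ext n u1 u2 : u1 =1 u2 -> symsum n u1 = symsum n u2.
Proof. by move=> e; elim: n => //= n ->; case: n => [|n]; rewrite !e. Qed.

Lemma symsum_shiftr n u : symsum n.+1 (fun l => u (l + 1)) =
  symsum n u + (if n is 0 then 0 else u n%:Z) + u n.+1%:Z.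
Proof.
elim: n => [|n IH]; first by rewrite /= !add0r.
rewrite [LHS]/= -/(symsum n.+1 (fun l => u (l + 1))) IH.
have -> : n.+1%:Z + 1 = n.+2%:Z by rewrite -PoszD addn1.
have -> : - n.+1%:Z + 1 = - n%:Z by rewrite -addn1 PoszD opprD subrK.
by case: n {IH} => [|n] /=; rewrite ?oppr0; ring.
Qed.

Lemma symsum_shiftl n u : symsum n.+1 (fun l => u (l - 1)) =
  symsum n u + (if n is 0 then 0 else u (- n%:Z)) + u (- n.+1%:Z).
Proof.
elim: n => [|n IH]; first by rewrite /= sub0r !add0r.
rewrite [LHS]/= -/(symsum n.+1 (fun l => u (l - 1))) IH.
have -> : n.+1%:Z - 1 = n%:Z by rewrite -addn1 PoszD addrK.
have -> : - n.+1%:Z - 1 = - n.+2%:Z by rewrite -opprD -PoszD addn1.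
by case: n {IH} => [|n] /=; rewrite ?oppr0; ring.
Qed.

Lemma symsumE n u : symsum n.+1 u = \sum_(j < n.*2.+1) u (j%:Z - n%:Z).
Proof.
elim: n => [|n IH]; first by rewrite big_ord1 /= add0r subr0.
rewrite [LHS]/= -/(symsum n.+1 u) IH doubleS [in RHS]big_ord_recr [in RHS]big_ord_recl /=.
have -> : (0%N : int) - n.+1%:Z = - n.+1%:Z by rewrite sub0r.
have -> : (bump 0 n.*2.+1 : int) - n.+1%:Z = n.+1%:Z by rewrite /bump /=; lia.
have -> : \sum_(i < n.*2.+1) u ((bump 0 i : int) - n.+1%:Z) =
    \sum_(i < n.*2.+1) u (i%:Z - n%:Z).
  by apply: eq_bigr => i _; congr u; rewrite /bump /=; lia.
by ring.
Qed.

Lemma symsum_cder n (u u' : int -> R -> R[i]) t : (forall l, cder (u l) t (u' l t)) ->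
  cder (fun s => symsum n (u ^~ s)) t (symsum n (u' ^~ t)).
Proof.
move=> du; elim: n => [|n IH]; first exact: cder_cst.
by apply: cderD => //; case: n {IH} => [|n] //; exact: cderD.
Qed.

Lemma symsumZ n (a : R[i]) u : symsum n (fun l => a * u l) = a * symsum n u.
Proof.
elim: n => [|n IH] /=; first by rewrite mulr0.
by rewrite IH; case: n {IH} => [|n]; ring.
Qed.

Lemma symsumB n u1 u2 : symsum n (fun l => u1 l - u2 l) = symsum n u1 - symsum n u2.
Proof. by elim: n => [|n IH] /=; rewrite ?subrr// IH; case: n {IH} => [|n] /=; ring. Qed.

End SymmetricSums.

(** * Expansion along a radius of a tangent disk *)

Section Expansion.
Variable R : realType.
Variables (beta kap : R).
Hypothesis beta01 : 0 < beta < 1.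
Hypothesis kap_gt0 : 0 < kap.
Implicit Types (s t r rho sg K : R) (x e : R[i]) (p l : int) (n : nat).

Notation A := (multipole (@besH R) kap).
Notation J := (multipole (fun (l : nat) (v : R) => (@besA R l v)%:C) kap).

Section ConjugateCurve.
Variables (gam g1 : R -> R[i]) (L B : R).
Hypothesis gamP : arc_curve gam g1 L B.

Lemma arc_curveJ : arc_curve (fun s => conjc (gam s)) (fun s => conjc (g1 s)) L B.
Proof.
split.
- exact: arc_L gamP.
- by move=> s; rewrite (arc_per gamP).
- by move=> s; apply: cderJ; exact: arc_der gamP s.
- by move=> s; rewrite cmodJ (arc_unit gamP).
- by move=> s t; rewrite -rmorphB cmodJ (arc_lip gamP).
- by move=> s t sI tI /(can_inj (@conjcK R)); exact: arc_inj gamP s t sI tI.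
Qed.

Lemma aboveJ c x rho sg : above gam L c x rho sg ->
  above (fun s => conjc (gam s)) L c (conjc x) rho sg.
Proof.
case=> r0 sI xs xle xge; split => //.
- by move=> s; rewrite (inj_eq (can_inj (@conjcK R))).
- by rewrite -rmorphB cmodJ.
- by move=> s /xge[a aI ha]; exists a => //; rewrite -rmorphB cmodJ.
Qed.

(** Hence the bounds for negative orders are those of the conjugate curve. *)
Lemma potentialN n psi x : (forall s, x != gam s) -> ccont psi ->
  potential kap gam L (- n%:Z) psi x =
  (-1) ^+ n * potential kap (fun s => conjc (gam s)) L n%:Z psi (conjc x).
Proof.
move=> xs cpsi; rewrite /potential -cintegralZ.
  by congr cintegral; apply/funext => s; rewrite multipole_Nn rmorphB mulrA.
apply: (potential_cont kap_gt0 arc_curveJ) => // s.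
by rewrite (inj_eq (can_inj (@conjcK R))).
Qed.

End ConjugateCurve.

Variables (gam g1 : R -> R[i]) (L B : R).
Hypothesis gamP : arc_curve gam g1 L B.
Hypothesis g1_smooth : forall j, exists M, hbnd beta L j M g1.

Notation F p psi x := (potential kap gam L p psi x).

Lemma potentialZ_le N c : 0 < c -> exists2 C, 0 <= C & forall p x rho sg psi K,
  (`|p| <= N.+1)%N -> above gam L c x rho sg -> hbnd beta L N K psi ->
  cmod (F p psi x) <= C * K.
Proof.
move=> c0.
have g1J j : exists M, hbnd beta L j M (fun s => conjc (g1 s)).
  by have [M hM] := g1_smooth j; exists M; exact: hbndJ.
suff h m : (m <= N.+2)%N -> exists2 C, 0 <= C & forall p x rho sg psi K,
    (`|p| < m)%N -> above gam L c x rho sg -> hbnd beta L N K psi ->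
    cmod (F p psi x) <= C * K.
  by have [C C0 hC] := h N.+2 (leqnn _); exists C.
elim: m => [|m IH] mN; first by exists 0.
have [C C0 hC] := IH (ltnW mN).
have [D D0 hD] := potential_le beta01 kap_gt0 gamP g1_smooth c0 m.
have [E E0 hE] := potential_le beta01 kap_gt0 (arc_curveJ gamP) g1J c0 m.
pose T := 2 ^+ (N - m.-1) : R; have T0 : 0 <= T by rewrite exprn_ge0.
exists (C + D * T + E * T); first by rewrite !addr_ge0// mulr_ge0.
move=> p x rho sg psi K; rewrite ltnS leq_eqVlt => pm xP hp.
have K0 := hbnd_ge0 hp.
have hm : hbnd beta L m.-1 (T * K) psi.
  by apply: hbnd_downs => //; rewrite subnKC//; case: m {IH hC hD hE T T0 pm} mN.
rewrite !mulrDl -!mulrA; case/orP: pm => [/eqP pm|pm]; last first.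
  by rewrite -addrA ler_wpDr ?(hC p x rho sg)// addr_ge0// !mulr_ge0.
have TK : 0 <= T * K by exact: mulr_ge0.
have d1 : cmod (F m%:Z psi x) <= D * (T * K) by exact: hD xP hm.
have d2 : cmod (F (- m%:Z) psi x) <= E * (T * K).
  rewrite (potentialN gamP)//; [|exact: above_off xP|exact: hbnd_cont hp].
  rewrite cmodM cmodX cmodN cmod1 expr1n mul1r.
  exact: hE (aboveJ xP) hm.
have e1 := mulr_ge0 C0 K0; have e2 := mulr_ge0 D0 TK; have e3 := mulr_ge0 E0 TK.
have [pE|pE] : p = m%:Z \/ p = - m%:Z by clear -pm; lia.
  by rewrite pE; lra.
by rewrite pE; lra.
Qed.

(** The point [x0 + e] of the curve is seen from the centre [e] of the disk in
    the direction x0: the expansions below are in the variable x0. *)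
Record tangent_disk e x0 r sg : Prop := TangentDisk {
  disk_r : 0 < r;
  disk_x0 : cmod x0 = r;
  disk_sg : 0 <= sg <= L;
  disk_touch : gam sg = x0 + e;
  disk_off : forall s, r <= cmod (gam s - e) }.

Lemma segment_dist e x0 r sg t s : tangent_disk e x0 r sg -> -1 < t < 1 ->
  (1 - `|t|) * r <= cmod (t%:C * x0 + e - gam s).
Proof.
move=> dP tI; have h := disk_off dP s.
have : cmod (gam s - e) <= cmod (t%:C * x0 + e - gam s) + cmod (t%:C * x0).
  rewrite -[X in _ <= X + _]cmodN.
  have -> : gam s - e = - (t%:C * x0 + e - gam s) + t%:C * x0 by ring.
  exact: cmodD.
by rewrite cmodM cmodC (disk_x0 dP) mulrBl mul1r; lra.
Qed.

Lemma segment_off e x0 r sg t s : tangent_disk e x0 r sg -> -1 < t < 1 ->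
  t%:C * x0 + e != gam s.
Proof.
move=> dP tI; rewrite -subr_eq0 -cmod_gt0.
apply: lt_le_trans (segment_dist s dP tI).
by rewrite mulr_gt0 ?(disk_r dP)// subr_gt0 ltr_norml.
Qed.

(** The radius reaches the curve nontangentially, since it ends at a nearest
    point; the constant does not depend on the disk. *)
Lemma segment_above : exists2 c, 0 < c & forall e x0 r sg t, tangent_disk e x0 r sg ->
  0 <= t < 1 -> above gam L c (t%:C * x0 + e) ((1 - t) * r) sg.
Proof.
have [c c0 hc] := chord_arc gamP.
exists (Num.min (2^-1) (c ^+ 2 / 8)).
  by rewrite lt_min invr_gt0 ltr0n /= divr_gt0// exprn_gt0.
move=> e x0 r sg t dP /andP[t0 t1]; have r0 := disk_r dP.
have tI : -1 < t < 1 by rewrite t1 andbT; lra.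
have rho0 : 0 < (1 - t) * r by rewrite mulr_gt0// subr_gt0.
have dE : cmod (t%:C * x0 + e - gam sg) = (1 - t) * r.
  rewrite (disk_touch dP) (_ : _ - _ = (t - 1)%:C * x0); last by rewrite rmorphB /=; ring.
  by rewrite cmodM cmodC (disk_x0 dP) distrC ger0_norm// subr_ge0 ltW.
split => //; [exact: disk_sg dP|by move=> s; exact: segment_off dP tI|by rewrite dE|].
move=> s sI; have [a aI ha] := hc s sg sI (disk_sg dP); exists a => //.
set z := t%:C * x0 + e - gam s; set rho := (1 - t) * r in rho0 dE *; set u := s - a.
have h1 : rho <= cmod z by have := segment_dist s dP tI; rewrite ger0_norm.
have h2 : c * `|u| <= cmod z + rho.
  apply: le_trans ha _; rewrite -dE -[X in _ <= X + _]cmodN.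
  have -> : gam s - gam sg = - z + (t%:C * x0 + e - gam sg) by rewrite /z; ring.
  exact: cmodD.
have q1 : rho ^+ 2 <= cmod z ^+ 2 by rewrite ler_pXn2r ?nnegrE ?cmod_ge0 ?(ltW rho0).
have q2 : c ^+ 2 * u ^+ 2 <= 4 * cmod z ^+ 2.
  have h3 : c * `|u| <= 2 * cmod z by lra.
  have : (c * `|u|) ^+ 2 <= (2 * cmod z) ^+ 2.
    by rewrite ler_pXn2r ?nnegrE ?mulr_ge0 ?cmod_ge0 ?(ltW c0).
  rewrite !exprMn real_normK ?num_real//; lra.
rewrite mulrDr; apply: (@le_trans _ _ (2^-1 * rho ^+ 2 + c ^+ 2 / 8 * u ^+ 2)).
  apply: lerD; rewrite ler_wpM2r ?sqr_ge0// ge_min lexx ?orbT//.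
by lra.
Qed.

Lemma multipole_far_le (d : R) p : 0 < d -> exists2 C, 0 <= C &
  forall z, d <= cmod z -> cmod (A p z) <= C.
Proof.
move=> d0; have d1 : 0 < (kap * d) ^+ 2 by rewrite exprn_gt0// mulr_gt0.
have [C C0 hC] := besH_far_bound `|p| d1; exists C => // z dz.
rewrite cmod_multipole ?(ltW kap_gt0)//; apply: le_trans (hC ((kap * cmod z) ^+ 2) _).
  by rewrite sqrtr_sqr ger0_norm// mulr_ge0 ?cmod_ge0 ?(ltW kap_gt0).
have kd : kap * d <= kap * cmod z by rewrite ler_wpM2l// ltW.
by rewrite ler_pXn2r ?nnegrE ?mulr_ge0 ?cmod_ge0 ?(ltW kap_gt0) ?(ltW d0).
Qed.

Lemma potential_der e x0 r sg p psi K t : tangent_disk e x0 r sg -> -1 < t < 1 ->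
  ccont psi -> (forall s, cmod (psi s) <= K) ->
  cder (fun t => F p psi (t%:C * x0 + e)) t
    (kap%:C * (conjc x0 * F (p - 1) psi (t%:C * x0 + e) - x0 * F (p + 1) psi (t%:C * x0 + e))).
Proof.
move=> dP /andP[tm t1] cpsi psiK; have r0 := disk_r dP.
(* For |t| < t2 the points of the radius keep a fixed distance to the curve, so
   the derivatives of the integrand are bounded there. *)
pose t2 := (1 + `|t|) / 2.
have nt1 : `|t| < 1 by rewrite ltr_norml tm.
have t2I : - t2 < t < t2 by rewrite -ltr_norml /t2; lra.
have t21 : t2 < 1 by rewrite /t2; lra.
have wI (x : R) : - t2 < x < t2 -> -1 < x < 1 by move=> /andP[? ?]; lra.
have d0 : 0 < (1 - t2) * r by rewrite mulr_gt0// subr_gt0.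
have [Cm Cm0 hm] := multipole_far_le (p - 1) d0.
have [Cp Cp0 hp] := multipole_far_le (p + 1) d0.
have far (x : R) s : - t2 < x < t2 -> (1 - t2) * r <= cmod (x%:C * x0 + e - gam s).
  move=> xI; apply: le_trans (segment_dist s dP (wI x xI)).
  by rewrite ler_wpM2r ?(ltW r0)// lerD2l lerN2 ltW// ltr_norml.
pose f' (x : R) s := kap%:C * (conjc x0 * A (p - 1) (x%:C * x0 + e - gam s)
   - x0 * A (p + 1) (x%:C * x0 + e - gam s)) * psi s.
have K0 : 0 <= K by exact: le_trans (cmod_ge0 _) (psiK 0).
have xs (x : R) : - t2 < x < t2 -> forall s, x%:C * x0 + e != gam s.
  by move=> xI s; exact: segment_off dP (wI x xI).
have cA q (x : R) : - t2 < x < t2 -> ccont (fun s => A q (x%:C * x0 + e - gam s) * psi s).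
  by move=> xI; apply: (potential_cont kap_gt0 gamP) => //; exact: xs.
have h := @cintegral_der R 0 L (- t2) t2 t (kap * (r * Cm + r * Cp) * K)
  (fun (x : R) s => A p (x%:C * x0 + e - gam s) * psi s) f' t2I _ _ _.
apply: (cder_eq (h _ _ _)).
- by move=> x xI; exact: cA.
- move=> x s xI.
  have dz : cder (fun y : R => y%:C * x0 + e - gam s) x (1 * x0 + 0 - 0).
    apply: cderB; last exact: cder_cst.
    apply: cderD; last exact: cder_cst.
    have di : is_derive x (1 : R) (fun y : R => y) 1 by exact: is_derive_id.
    apply: (cder_eq (cderM (cder_real di) (cder_cst x0 x))).
    by rewrite mulr0 addr0.
  have v0 : 0 < (kap * cmod (x%:C * x0 + e - gam s)) ^+ 2.
    by rewrite exprn_gt0// mulr_gt0// cmod_gt0 subr_eq0 xs.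
  apply: (cder_eq (cderM (multipole_der p dz (bessel_at_besH v0)) (cder_cst (psi s) x))).
  by rewrite mulr0 addr0 subr0 addr0 mul1r.
- move=> x s xI sI; rewrite /f' (cmodM _ (psi s)) (cmodM kap%:C) cmodC (gtr0_norm kap_gt0).
  apply: ler_pM => //; rewrite ?mulr_ge0 ?cmod_ge0 ?(ltW kap_gt0)//.
  rewrite ler_wpM2l ?(ltW kap_gt0)//; apply: le_trans (cmodB _ _) _.
  rewrite (cmodM (conjc x0)) (cmodM x0) cmodJ (disk_x0 dP).
  by apply: lerD; rewrite ler_wpM2l ?(ltW r0)//; [apply: hm|apply: hp]; exact: far.
- rewrite /f' /potential -!cintegralZ -?cintegralB -?cintegralZ//; try exact: cA.
  + by congr cintegral; apply/funext => s; ring.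
  + by apply: ccontB; apply: ccontM; try exact: ccont_cst; exact: cA.
  + by apply: ccontM; [exact: ccont_cst|exact: cA].
  + by apply: ccontM; [exact: ccont_cst|exact: cA].
Qed.

(** J_n vanishes to order n at the origin and is bounded at infinity, so it is
    bounded by a multiple of x^m for every m <= n. *)
Lemma regular_le n m : (m <= n)%N -> exists2 C, 0 <= C &
  forall z, cmod (J n%:Z z) <= C * cmod z ^+ m /\ cmod (J (- n%:Z) z) <= C * cmod z ^+ m.
Proof.
move=> mn; have [C C0 hC] := besA_bounded R n.
have [D hD] := besA_far_bound n (@ltr01 R).
have kp : 0 <= kap ^+ m by rewrite exprn_ge0// ltW.
exists ((C + `|D|) * kap ^+ m); first by rewrite mulr_ge0// addr_ge0.
move=> z; suff h : (kap * cmod z) ^+ n * `|besA n ((kap * cmod z) ^+ 2)| <=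
    (C + `|D|) * kap ^+ m * cmod z ^+ m.
  rewrite !cmod_multipole ?(ltW kap_gt0)// abszN absz_nat cmodC.
  by split.
rewrite -mulrA -exprMn; set x := kap * cmod z.
have x0 : 0 <= x by rewrite mulr_ge0 ?cmod_ge0 ?ltW.
have [x1|/ltW x1] := leP x 1.
  rewrite mulrC; apply: ler_pM; rewrite ?exprn_ge0//.
    by rewrite ler_wpDr// hC// sqr_ge0.
  by apply: ler_wiXn2l.
have x2 : 1 <= x ^+ 2 by rewrite exprn_ege1.
have := hD _ x2; rewrite sqrtr_sqr (ger0_norm x0) => h.
apply: le_trans h _; apply: (@le_trans _ _ ((C + `|D|) * 1)).
  by rewrite mulr1 ler_wpDl// ler_norm.
by rewrite ler_wpM2l ?addr_ge0// exprn_ege1.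
Qed.

Definition regular_wave l x0 t : R[i] := J (- l) (t%:C * x0).

Lemma regular_der l x0 t : cder (regular_wave l x0) t
  (kap%:C * (conjc x0 * regular_wave (l + 1) x0 t - x0 * regular_wave (l - 1) x0 t)).
Proof.
have dz : cder (fun y : R => y%:C * x0) t x0.
  have di : is_derive t (1 : R) (fun y : R => y) 1 by exact: is_derive_id.
  apply: (cder_eq (cderM (cder_real di) (cder_cst x0 t))).
  by rewrite mulr0 addr0 mul1r.
apply: (cder_eq (multipole_der (- l) dz (bessel_at_besA (sqr_ge0 _)))).
rewrite /regular_wave (_ : - l - 1 = - (l + 1)); last by rewrite opprD.
by rewrite (_ : - l + 1 = - (l - 1)); last by rewrite opprB addrC.
Qed.

Lemma regular_wave0 l x0 : regular_wave l x0 0 = (l == 0)%:R.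
Proof.
rewrite /regular_wave mul0r; case: l => [[|n]|n].
- rewrite (_ : - 0%:Z = Posz 0)// /multipole cmod0 mulr0 expr0n besA_at0.
  by rewrite fact0 invr1 !expr0 !mul1r.
- by rewrite -NegzE /multipole [0 ^+ n.+1]exprS mul0r mulr0 mul0r.
- by rewrite NegzE opprK /multipole conjc0 [0 ^+ n.+1]exprS mul0r mulr0 mul0r.
Qed.

Definition remainder p n psi e x0 t : R[i] := F p psi (t%:C * x0 + e)
  - symsum n (fun l => F (p + l) psi e * regular_wave l x0 t).

(** The remainders of all orders satisfy the ladder relations up to the two
    boundary terms of the truncated sum, so each integration along the radius
    gains a factor r. *)
Lemma remainder_der p n psi e x0 r sg K t : tangent_disk e x0 r sg -> -1 < t < 1 ->
  ccont psi -> (forall s, cmod (psi s) <= K) ->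
  let b1 := (if n is 0 then 0 else F (p - 1 + n%:Z) psi e * regular_wave n%:Z x0 t)
     + F (p - 1 + n.+1%:Z) psi e * regular_wave n.+1%:Z x0 t in
  let b2 := (if n is 0 then 0 else F (p + 1 - n%:Z) psi e * regular_wave (- n%:Z) x0 t)
     + F (p + 1 - n.+1%:Z) psi e * regular_wave (- n.+1%:Z) x0 t in
  cder (remainder p n.+1 psi e x0) t
    (kap%:C * (conjc x0 * (remainder (p - 1) n psi e x0 t - b1)
       - x0 * (remainder (p + 1) n psi e x0 t - b2))).
Proof.
move=> dP tI cpsi psiK b1 b2.
pose u' l t := F (p + l) psi e * (kap%:C * (conjc x0 * regular_wave (l + 1) x0 t
   - x0 * regular_wave (l - 1) x0 t)).
have dsum := @symsum_cder R n.+1 (fun l t => F (p + l) psi e * regular_wave l x0 t) u' t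
  (fun l => cderZ _ (regular_der l x0 t)).
apply: (cder_eq (cderB (potential_der p dP tI cpsi psiK) dsum)).
pose U1 l := F (p - 1 + l) psi e * regular_wave l x0 t.
pose U2 l := F (p + 1 + l) psi e * regular_wave l x0 t.
have -> : symsum n.+1 (u'^~ t) = symsum n.+1 (fun l => (kap%:C * conjc x0) * U1 (l + 1)
   - (kap%:C * x0) * U2 (l - 1)).
  apply: symsum_ext => l; rewrite /u' /U1 /U2.
  rewrite (_ : p - 1 + (l + 1) = p + l); last by rewrite addrACA addNr addr0.
  rewrite (_ : p + 1 + (l - 1) = p + l); last by rewrite addrACA subrr addr0.
  by ring.
rewrite symsumB !symsumZ symsum_shiftr symsum_shiftl.
rewrite /remainder /b1 /b2 -/(U1) /U1 /U2.
by case: n {dsum u' b1 b2} => [|n] /=; ring.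
Qed.

Lemma regular_waves_le n m : (m <= n)%N -> exists2 C, 0 <= C & forall e x0 r sg t,
  tangent_disk e x0 r sg -> 0 <= t <= 1 ->
  cmod (regular_wave n%:Z x0 t) <= C * r ^+ m /\
  cmod (regular_wave (- n%:Z) x0 t) <= C * r ^+ m.
Proof.
move=> mn; have [C C0 hC] := regular_le mn; exists C => // e x0 r sg t dP /andP[t0 t1].
have [h1 h2] := hC (t%:C * x0); rewrite /regular_wave opprK.
have h : C * cmod (t%:C * x0) ^+ m <= C * r ^+ m.
  rewrite ler_wpM2l// lerXn2r ?nnegrE ?cmod_ge0 ?(ltW (disk_r dP))//.
  by rewrite cmodM cmodC (disk_x0 dP) ger0_norm// ler_piMl// ltW// (disk_r dP).
by split; [exact: le_trans h2 h|exact: le_trans h1 h].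
Qed.

(** Induction on n: [remainder_der] expresses the derivative of the next
    remainder through remainders of orders p - 1 and p + 1, with a factor
    |x0| = r, and the remainder vanishes at the centre. Each step moves the
    order by one, hence the constraint on |p| + n, at the end of which the
    density has no derivatives left to spend. *)
Lemma remainder_le N n : exists2 C, 0 <= C & forall p psi e x0 r sg K t,
  (`|p| + n <= N.+1)%N -> tangent_disk e x0 r sg -> hbnd beta L N K psi -> 0 <= t < 1 ->
  cmod (remainder p n psi e x0 t) <= C * r ^+ n * K.
Proof.
have [c c0 hc] := segment_above.
have [C0 C00 hC0] := potentialZ_le N c0.
elim: n => [|n [C C_ge0 IH]].
  exists C0 => // p psi e x0 r sg K t pN dP hp tI.
  rewrite /remainder [symsum 0 _]/= subr0 expr0 mulr1.
  by apply: hC0 (hc _ _ _ _ _ dP tI) hp; rewrite addn0 in pN.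
have [D D0 hD] := regular_waves_le (leqnn n).
have [E E0 hE] := regular_waves_le (leqnSn n).
have k0 := ltW kap_gt0.
pose T := C + C0 * D + C0 * E; have T0 : 0 <= T by rewrite !addr_ge0// mulr_ge0.
exists (kap * (T + T)); first by rewrite mulr_ge0// addr_ge0.
move=> p psi e x0 r sg K t pN dP hp /andP[t0 t1].
have K0 := hbnd_ge0 hp; have r0 := ltW (disk_r dP).
have rn : 0 <= r ^+ n by exact: exprn_ge0.
have cpsi := hbnd_cont beta01 hp; have psiK s := hbnd_le s hp.
have wI (x : R) : 0 <= x <= t -> -1 < x < 1.
  by move=> /andP[? ?]; apply/andP; split; lra.
have start : remainder p n.+1 psi e x0 0 = 0.
  rewrite /remainder mul0r add0r.
  have -> : symsum n.+1 (fun l => F (p + l) psi e * regular_wave l x0 0) = F p psi e.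
    elim: (n) => [|m IHm]; first by rewrite /= add0r regular_wave0 eqxx mulr1 addr0.
    rewrite [LHS]/= -/(symsum m.+1 _) IHm !regular_wave0.
    rewrite (_ : (- m.+1%:Z == 0) = false); last by rewrite oppr_eq0.
    by rewrite (_ : (m.+1%:Z == 0) = false)// !mulr0 !addr0.
  by rewrite subrr.
have F0 q : (`|q| <= N.+1)%N -> cmod (F q psi e) <= C0 * K.
  move=> qN; have z1 : 0 <= (0 : R) < 1 by rewrite lexx ltr01.
  by have := hC0 q _ _ _ psi K qN (hc _ _ _ _ 0 dP z1) hp; rewrite mul0r add0r.
have bnd q l (x M : R) : (`|q| <= N.+1)%N -> cmod (regular_wave l x0 x) <= M * r ^+ n ->
    cmod (F q psi e * regular_wave l x0 x) <= C0 * M * (r ^+ n * K).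
  move=> qN hl; rewrite cmodM.
  have -> : C0 * M * (r ^+ n * K) = C0 * K * (M * r ^+ n) by ring.
  by apply: ler_pM; rewrite ?cmod_ge0// F0.
have z0 M : 0 <= M -> cmod (0 : R[i]) <= C0 * M * (r ^+ n * K).
  by move=> M0; rewrite cmod0 !mulr_ge0.
rewrite -[X in cmod X]subr0 -start.
have tK : kap * (T + T) * r ^+ n.+1 * K * (t - 0) <= kap * (T + T) * r ^+ n.+1 * K.
  rewrite subr0 ler_piMr ?(ltW t1)//; apply: mulr_ge0 => //.
  by apply: mulr_ge0; [apply: mulr_ge0 => //; exact: addr_ge0|exact: exprn_ge0].
pose b1 (x : R) := (if n is 0 then 0 else F (p - 1 + n%:Z) psi e * regular_wave n%:Z x0 x)
  + F (p - 1 + n.+1%:Z) psi e * regular_wave n.+1%:Z x0 x.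
pose b2 (x : R) := (if n is 0 then 0 else F (p + 1 - n%:Z) psi e * regular_wave (- n%:Z) x0 x)
  + F (p + 1 - n.+1%:Z) psi e * regular_wave (- n.+1%:Z) x0 x.
pose d (x : R) := kap%:C * (conjc x0 * (remainder (p - 1) n psi e x0 x - b1 x)
  - x0 * (remainder (p + 1) n psi e x0 x - b2 x)).
apply: le_trans _ tK; apply: (@cder_incr_le _ _ d) => // x xI.
  exact: remainder_der dP (wI x xI) cpsi psiK.
rewrite /d.
have x01 : 0 <= x <= 1 by case/andP: xI => ? ?; apply/andP; split; lra.
have x01' : 0 <= x < 1 by case/andP: xI => ? ?; apply/andP; split; lra.
have [hD1 hD2] := hD _ _ _ _ _ dP x01; have [hE1 hE2] := hE _ _ _ _ _ dP x01.
rewrite (cmodM kap%:C) cmodC (gtr0_norm kap_gt0).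
have -> : kap * (T + T) * r ^+ n.+1 * K = kap * (r * (T * (r ^+ n * K)) + r * (T * (r ^+ n * K))).
  by rewrite exprS; ring.
rewrite ler_wpM2l//; apply: le_trans (cmodB _ _) _.
rewrite (cmodM (conjc x0)) (cmodM x0) cmodJ (disk_x0 dP).
have TE : T * (r ^+ n * K) = C * r ^+ n * K + (C0 * D * (r ^+ n * K) + C0 * E * (r ^+ n * K)).
  by rewrite /T; ring.
have i1 : (`|(p - 1)%R| + n <= N.+1)%N by clear -pN; lia.
have i2 : (`|(p + 1)%R| + n <= N.+1)%N by clear -pN; lia.
have i3 : (`|(p - 1 + n.+1%:Z)%R| <= N.+1)%N by clear -pN; lia.
have i4 : (`|(p + 1 - n.+1%:Z)%R| <= N.+1)%N by clear -pN; lia.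
have i5 : (`|(p - 1 + n%:Z)%R| <= N.+1)%N by clear -pN; lia.
have i6 : (`|(p + 1 - n%:Z)%R| <= N.+1)%N by clear -pN; lia.
apply: lerD; rewrite ler_wpM2l// TE; apply: le_trans (cmodB _ _) _; apply: lerD.
- exact: IH i1 dP hp x01'.
- apply: le_trans (cmodD _ _) _; apply: lerD; last exact: bnd.
  by case: (n) hD1 i5 z0 bnd => [|m] hD1 i5 z0 bnd; [exact: z0|exact: bnd].
- exact: IH i2 dP hp x01'.
- apply: le_trans (cmodD _ _) _; apply: lerD; last exact: bnd.
  by case: (n) hD2 i6 z0 bnd => [|m] hD2 i6 z0 bnd; [exact: z0|exact: bnd].
Qed.

End Expansion.

(** * Dominated convergence *)

Section DominatedLimits.
Variable R : realType.
Notation mu := (@lebesgue_measure R).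

Definition ccvg (u : nat -> R[i]) (l : R[i]) : Prop :=
  (fun n => complex.Re (u n)) @ \oo --> complex.Re l /\
  (fun n => complex.Im (u n)) @ \oo --> complex.Im l.

Lemma Rintegral_dominated_cvg (a b : R) (f_ : nat -> R -> R) (f : R -> R)
    (G : R -> \bar R) (A : set R) :
  (forall n, continuous (f_ n)) -> measurable_fun setT f -> countable A ->
  (forall s, a <= s <= b -> ~ A s -> f_ ^~ s @ \oo --> f s) ->
  mu.-integrable `[a, b] G ->
  (forall n s, a <= s <= b -> (`|f_ n s|%:E <= G s)%E) ->
  mu.-integrable `[a, b] (EFin \o f) /\
  (fun n => \int[mu]_(s in `[a, b]) f_ n s) @ \oo --> \int[mu]_(s in `[a, b]) f s.
Proof.
move=> cf_ mf cA cv iG dom.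
have mI := measurable_itv `[a, b] : measurable (`[a, b]%classic : set (measurableTypeR R)).
have h1 n := measurable_int mu (continuous_itv_integrable a b (cf_ n)).
have h2 := (measurable_EFinP (`[a, b]%classic : set (measurableTypeR R)) f).2 (measurable_funTS mf).
have h3 : {ae mu, forall s, (`[a, b]%classic : set R) s ->
    (fun n => (f_ n s)%:E) @ \oo --> (f s)%:E}.
  exists A; split => //; [exact: countable_measurable|exact: countable_lebesgue_measure0|].
  move=> s /= ns; apply: contrapT => nA; apply: ns; rewrite in_itv /= => sI.
  by apply: cvg_EFin; [exact: nearW|exact: cv].
have h4 : {ae mu, forall s n, (`[a, b]%classic : set R) s -> (`|(EFin \o f_ n) s| <= G s)%E}.
  by apply: aeW => s n /=; rewrite in_itv /= => sI; exact: dom.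
have [i1 _ i3] := dominated_convergence mI h1 h2 h3 iG h4.
split => //; apply: fine_cvg; rewrite fineK//.
exact: integrable_fin_num.
Qed.

Lemma cintegral_dominated_cvg (a b : R) (f_ : nat -> R -> R[i]) (f : R -> R[i])
    (G : R -> \bar R) (A : set R) :
  (forall n, ccont (f_ n)) ->
  measurable_fun setT (fun s => complex.Re (f s)) ->
  measurable_fun setT (fun s => complex.Im (f s)) -> countable A ->
  (forall s, a <= s <= b -> ~ A s -> ccvg (f_ ^~ s) (f s)) ->
  mu.-integrable `[a, b] G ->
  (forall n s, a <= s <= b -> ((cmod (f_ n s))%:E <= G s)%E) ->
  cintegrable a b f /\ ccvg (fun n => cintegral a b (f_ n)) (cintegral a b f).
Proof.
move=> cf m1 m2 cA cv iG dom.
have d1 n s (sI : a <= s <= b) : (`|complex.Re (f_ n s)|%:E <= G s)%E.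
  by apply: le_trans (dom n s sI); rewrite lee_fin Re_le_cmod.
have d2 n s (sI : a <= s <= b) : (`|complex.Im (f_ n s)|%:E <= G s)%E.
  by apply: le_trans (dom n s sI); rewrite lee_fin Im_le_cmod.
have [i1 v1] := @Rintegral_dominated_cvg a b (fun n s => complex.Re (f_ n s)) _ _ _
  (fun n => (cf n).1) m1 cA (fun s sI nA => (cv s sI nA).1) iG d1.
have [i2 v2] := @Rintegral_dominated_cvg a b (fun n s => complex.Im (f_ n s)) _ _ _
  (fun n => (cf n).2) m2 cA (fun s sI nA => (cv s sI nA).2) iG d2.
by split.
Qed.

Variables (beta L : R).
Hypothesis beta01 : 0 < beta < 1.
Hypothesis L0 : 0 < L.

Lemma sing_nincr (rho rho' u : R) : 0 < rho -> rho <= rho' -> sing beta rho' u <= sing beta rho u.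
Proof.
move=> r0 rr; rewrite /sing.
have -> : (beta - 1) / 2 = - ((1 - beta) / 2) by field.
have b1 : 0 <= (1 - beta) / 2 by case/andP: beta01 => ? ?; lra.
have p0 : 0 < rho ^+ 2 + u ^+ 2 by rewrite ltr_pwDl ?exprn_gt0 ?sqr_ge0.
have p1 : rho ^+ 2 + u ^+ 2 <= rho' ^+ 2 + u ^+ 2.
  by rewrite lerD2r ler_pXn2r ?nnegrE ?(ltW r0)// (le_trans (ltW r0)).
rewrite !powRN lef_pV2 ?posrE ?powR_gt0//; last exact: lt_le_trans p1.
by apply: ge0_ler_powR; rewrite ?nnegrE ?(ltW p0)// (le_trans (ltW p0)).
Qed.

Lemma sing_cont (rho : R) : 0 < rho -> continuous (sing beta rho).
Proof.
move=> r0 u; have p0 : 0 < rho ^+ 2 + u ^+ 2 by rewrite ltr_pwDl ?exprn_gt0 ?sqr_ge0.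
apply: (@continuous_comp _ _ _ (fun u : R => rho ^+ 2 + u ^+ 2) (fun x => x `^ _)).
  by apply: cvgD; [exact: cvg_cst|exact: exprn_continuous].
apply: differentiable_continuous; apply/derivable1_diffP.
by have [] := is_derive1_powR ((beta - 1) / 2) p0.
Qed.

(** The singularity |s - a|^(beta - 1) is integrable: it is the increasing
    limit of the regularized ones, whose integrals are bounded. *)
Lemma sing_integrable (sg : R) : 0 <= sg <= L -> exists2 G : R -> \bar R,
  mu.-integrable `[0, L] G & forall a rho s, a \in [:: sg; sg - L; sg + L] -> 0 < rho ->
    ((sing beta rho (s - a) + 1)%:E <= G s)%E.
Proof.
move=> sgI; have [K K0 hK] := dominated_cintegral beta01 L0.
(* The majorant is the monotone limit as rho = 1 / (n + 1) tends to 0. *)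
pose rn (n : nat) : R := n.+1%:R^-1.
have rn0 n : 0 < rn n by rewrite invr_gt0.
pose w (a : R) n s := sing beta (rn n) (s - a).
have w0 a n s : 0 <= w a n s by exact: powR_ge0.
have cw a n : continuous (w a n).
  move=> s; apply: (@continuous_comp _ _ _ (fun s : R => s - a) (sing beta (rn n))).
    by apply: cvgB; [exact: cvg_id|exact: cvg_cst].
  by apply: sing_cont.
have wnd a s m n : (m <= n)%N -> w a m s <= w a n s.
  by move=> mn; apply: sing_nincr => //; rewrite lef_pV2 ?posrE// ler_nat.
pose W n s := w sg n s + w (sg - L) n s + w (sg + L) n s + 1.
have cW n : continuous (W n).
  by move=> s; apply: cvgD; last exact: cvg_cst; apply: cvgD; first apply: cvgD; exact: cw.
have W0 n s : 0 <= W n s by rewrite !addr_ge0.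
have WK n : \int[mu]_(s in `[0, L]) W n s <= 3 * K + L.
  have bw a : a \in [:: sg; sg - L; sg + L] -> \int[mu]_(s in `[0, L]) w a n s <= K.
    move=> aI; have cf : ccont (fun s => (w a n s)%:C).
      by split; [exact: cw|move=> s; exact: cvg_cst].
    have := hK (rn n) sg 1 _ (rn0 n) sgI ler01 cf; rewrite mul1r => h.
    apply: le_trans (h _); last first.
      move=> s _; exists a => //; rewrite cmodC ger0_norm// mul1r -addrA lerDl addr_ge0//.
      by rewrite divr_ge0 ?ltW// ltr_pwDl ?exprn_gt0 ?sqr_ge0.
    by apply: le_trans (Re_le_cmod _); exact: ler_norm.
  have iw a : mu.-integrable `[0, L] (EFin \o w a n) by exact: continuous_itv_integrable.
  have i1 : mu.-integrable `[0, L] (EFin \o (fun=> 1 : R)).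
    by apply: continuous_itv_integrable => s; exact: cvg_cst.
  have i2 : mu.-integrable `[0, L] (EFin \o (fun s => w sg n s + w (sg - L) n s)).
    by apply: continuous_itv_integrable => s; apply: cvgD; exact: cw.
  have i3 : mu.-integrable `[0, L] (EFin \o (fun s => w sg n s + w (sg - L) n s + w (sg + L) n s)).
    by apply: continuous_itv_integrable => s; apply: cvgD; first apply: cvgD; exact: cw.
  have e1 : \int[mu]_(s in `[0, L]) (1 : R) = L.
    rewrite (@Rintegral_derivative _ _ _ (fun=> 1) (fun s => s)) ?subr0//.
    by move=> s; exact: cvg_cst.
  rewrite /W RintegralD// RintegralD// RintegralD// e1.
  have := bw sg; have := bw (sg - L); have := bw (sg + L).
  rewrite !inE !eqxx !orbT => /(_ isT) + /(_ isT) + /(_ isT).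
  move: (\int[mu]_(s in _) w sg n s) (\int[mu]_(s in _) w (sg - L) n s)
    (\int[mu]_(s in _) w (sg + L) n s) => x y z; clear; lra.
pose G s := limn (fun n => (W n s)%:E).
have Wnd s : nondecreasing_seq (fun n => (W n s)%:E).
  by move=> m n mn; rewrite lee_fin lerD2r lerD ?wnd// lerD ?wnd.
have mI := measurable_itv `[0, L] : measurable (`[0, L]%classic : set (measurableTypeR R)).
have mW n := measurable_int mu (continuous_itv_integrable 0 L (cW n)).
have WG n s : ((W n s)%:E <= G s)%E.
  rewrite /G (cvg_lim _ (ereal_nondecreasing_cvgn (Wnd s)))//.
  by apply: ereal_sup_ubound; exists n.
exists G; last first.
  move=> a rho s aI rho0.
  have [n hn] : exists n, rn n <= rho.
    exists (Num.truncn rho^-1); rewrite /rn invf_ple ?posrE//.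
    by apply: ltW; rewrite truncnS_gt.
  apply: le_trans (WG n s); rewrite lee_fin /W lerD2r.
  have h : sing beta rho (s - a) <= w a n s by exact: sing_nincr.
  apply: le_trans h _; have := w0 sg n s; have := w0 (sg - L) n s; have := w0 (sg + L) n s.
  by move: aI; rewrite !inE => /or3P[] /eqP ->; lra.
apply/integrableP; split.
  have := @emeasurable_fun_cvg _ _ R (`[0, L]%classic : set (measurableTypeR R))
    (fun n s => (W n s)%:E) G mW.
  by apply=> s _; exact: ereal_nondecreasing_is_cvgn.
have G0 s : (0 <= G s)%E by apply: le_trans (WG 0%N s); rewrite lee_fin.
under eq_integral do rewrite gee0_abs//.
have W0' n s : (`[0, L]%classic : set R) s -> (0 <= (W n s)%:E)%E by rewrite lee_fin.
have Wnd' s : (`[0, L]%classic : set R) s -> nondecreasing_seq (fun n => (W n s)%:E).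
  by move=> _; exact: Wnd.
rewrite (monotone_convergence mu mI mW W0' Wnd').
apply: (@le_lt_trans _ _ (3 * K + L)%:E); last by rewrite ltry.
apply: lime_le.
  apply: ereal_nondecreasing_is_cvgn => m n mn; apply: ge0_le_integral => //.
    exact: W0'.
  by move=> s _; exact: (Wnd s m n mn).
apply: nearW => n.
have := WK n; rewrite /Rintegral -lee_fin fineK//.
apply: integrable_fin_num => //; exact: continuous_itv_integrable.
Qed.

End DominatedLimits.

(** * Passage to the boundary point *)

Section BoundaryValue.
Variable R : realType.
Variables (beta kap : R).
Hypothesis beta01 : 0 < beta < 1.
Hypothesis kap_gt0 : 0 < kap.
Variables (gam g1 : R -> R[i]) (L B : R).
Hypothesis gamP : arc_curve gam g1 L B.
Hypothesis g1_smooth : forall j, exists M, hbnd beta L j M g1.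
Let L0 : 0 < L := arc_L gamP.
Implicit Types (e x : R[i]) (r sg K t : R).

Notation mu := (@lebesgue_measure R).
Notation A := (multipole (@besH R) kap).
Notation F p psi x := (potential kap gam L p psi x).

Let gam_cont : ccont gam.
Proof. by apply: cder_cont => s; exists (g1 s); exact: arc_der gamP s. Qed.

(** The limit kernel is not continuous on the curve, so its measurability has
    to be read off from the explicit form of Y_0. *)
Lemma besH0_measurable : measurable_fun setT (fun v : R => complex.Re (besH 0 v)) /\
  measurable_fun setT (fun v : R => complex.Im (besH 0 v)).
Proof.
have mA : measurable_fun setT (besA 0 : R -> R).
  apply: continuous_measurable_fun => v; apply: differentiable_continuous.
  by apply/derivable1_diffP; case: (besA_der 0 v).
have mB : measurable_fun setT (besB 0 : R -> R).
  apply: continuous_measurable_fun => v; apply: differentiable_continuous.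
  by apply/derivable1_diffP; case: (is_derive_pseries v (besB_coef_fast R 0)).
split; first exact: mA.
rewrite /= /besY; apply: measurable_funM; first exact: measurable_cst.
apply: measurable_funB mB; under [X in measurable_fun _ X]funext do rewrite big_ord0 subr0.
by apply: measurable_funM mA; exact: measurable_ln.
Qed.

Lemma kernel_measurable x psi : ccont psi ->
  measurable_fun setT (fun s => complex.Re (A 0 (x - gam s) * psi s)) /\
  measurable_fun setT (fun s => complex.Im (A 0 (x - gam s) * psi s)).
Proof.
move=> [/continuous_measurable_fun p1 /continuous_measurable_fun p2].
have [m1 m2] := besH0_measurable.
have mv : measurable_fun setT (fun s => (kap * cmod (x - gam s)) ^+ 2).
  apply: continuous_measurable_fun => s.
  have [c1 c2] := ccontB (ccont_cst x) gam_cont.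
  under [X in continuous_at _ X]funext do rewrite exprMn cmod_sqr.
  apply: cvgM; first exact: cvg_cst.
  apply: cvgD.
  - apply: (@continuous_comp _ _ _ (fun s => complex.Re (x - gam s)) (fun y : R => y ^+ 2)).
      exact: c1.
    exact: exprn_continuous.
  - apply: (@continuous_comp _ _ _ (fun s => complex.Im (x - gam s)) (fun y : R => y ^+ 2)).
      exact: c2.
    exact: exprn_continuous.
have k1 := measurableT_comp m1 mv; have k2 := measurableT_comp m2 mv.
have AE s : A 0 (x - gam s) = besH 0 ((kap * cmod (x - gam s)) ^+ 2).
  by rewrite /multipole /= !expr0 !mul1r.
split.
- under [X in measurable_fun _ X]funext do rewrite AE cReM.
  by apply: measurable_funB; apply: measurable_funM.
- under [X in measurable_fun _ X]funext do rewrite AE cImM.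
  by apply: measurable_funD; apply: measurable_funM.
Qed.

Let tn (n : nat) : R := 1 - n.+1%:R^-1.

Let tnI n : 0 <= tn n < 1.
Proof.
rewrite subr_ge0 invf_le1// ?ltr0n// ler1n /= ltrBlDr ltrDl invr_gt0 ltr0n//.
Qed.

Let tn1 : tn @ \oo --> (1 : R).
Proof.
rewrite -[X in _ --> X]subr0; apply: cvgB; first exact: cvg_cst.
exact: cvg_harmonic.
Qed.

Let ccvg_tn (f : R -> R[i]) d : cder f 1 d -> ccvg (fun n => f (tn n)) (f 1).
Proof.
move=> [[d1 _] [d2 _]].
have c (h : R -> R) : derivable h 1 1 -> (fun n => h (tn n)) @ \oo --> h 1.
  move=> /derivable1_diffP/differentiable_continuous ch.
  exact: (cvg_comp tn h tn1 ch).
by split; [exact: (c (fun t => complex.Re (f t)))|exact: (c (fun t => complex.Im (f t)))].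
Qed.

(** Dominated convergence: by [multipole0_le] all the kernels along the radius
    lie below the integrable singularity of [sing_integrable], and they converge
    except at the parameters of the end point. *)
Lemma potential0_boundary psi e x0 r sg K : tangent_disk gam L e x0 r sg ->
  ccont psi -> (forall s, cmod (psi s) <= K) ->
  cintegrable 0 L (fun s => A 0 (x0 + e - gam s) * psi s) /\
  ccvg (fun n => F 0 psi ((tn n)%:C * x0 + e)) (F 0 psi (x0 + e)).
Proof.
move=> dP cpsi psiK; have K0 : 0 <= K by exact: le_trans (cmod_ge0 _) (psiK 0).
have r0 := disk_r dP.
have [c c0 hc] := segment_above gamP.
have [C C0 hC] := multipole0_le beta01 kap_gt0 gam L c0.
have [G iG hG] := sing_integrable beta01 L0 (disk_sg dP).
have tnI' n : -1 < tn n < 1 by have /andP[? ?] := tnI n; apply/andP; split; lra.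
pose f_ n s := A 0 ((tn n)%:C * x0 + e - gam s) * psi s.
have cf n : ccont (f_ n).
  apply: (potential_cont kap_gt0 gamP) => // s; exact: segment_off dP (tnI' n).
have [m1 m2] := kernel_measurable (x0 + e) cpsi.
have mI := measurable_itv `[0, L] : measurable (`[0, L]%classic : set (measurableTypeR R)).
have iCG := integrableZl mI (C * K) iG.
have cA : countable [set sg; sg - L; sg + L].
  by apply/finite_set_countable; rewrite !finite_setU; do !split; exact: finite_set1.
apply: (cintegral_dominated_cvg cf m1 m2 cA _ iCG).
- move=> s sI nA.
  have [c' c'0 hc'] := chord_arc gamP; have [a aI ha] := hc' s sg sI (disk_sg dP).
  have off : 0 < cmod (x0 + e - gam s).
    rewrite -(disk_touch dP) -cmodN opprB; apply: lt_le_trans ha.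
    rewrite mulr_gt0// normr_gt0 subr_eq0; apply: contra_notN nA => /eqP ->.
    by move: aI; rewrite !inE => /or3P[] /eqP ->; [left; left|left; right|right].
  have dz : cder (fun y : R => y%:C * x0 + e - gam s) 1 x0.
    have di : is_derive (1 : R) (1 : R) (fun y : R => y) 1 by exact: is_derive_id.
    apply: (cder_eq (cderB (cderD (cderM (cder_real di) (cder_cst x0 1)) (cder_cst e 1))
      (cder_cst (gam s) 1))).
    by rewrite mulr0 addr0 mul1r addr0 subr0.
  have hq : bessel_at (@besH R) ((kap * cmod (1%:C * x0 + e - gam s)) ^+ 2).
    by apply: bessel_at_besH; rewrite mul1r exprn_gt0// mulr_gt0.
  have := ccvg_tn (cderM (multipole_der 0 dz hq) (cder_cst (psi s) 1)).
  by rewrite mul1r.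
- move=> n s sI; have xP := hc _ _ _ _ _ dP (tnI n).
  have [a aI ha] := hC _ _ _ s xP sI.
  rewrite /f_ cmodM; apply: (@le_trans _ _ (C * K * (sing beta ((1 - tn n) * r) (s - a) + 1))%:E).
    rewrite lee_fin mulrAC; apply: ler_pM; rewrite ?cmod_ge0//.
  by rewrite EFinM lee_wpmul2l ?lee_fin ?mulr_ge0// hG// (above_rho xP).
Qed.

Lemma remainder_boundary N psi e x0 r sg K : tangent_disk gam L e x0 r sg ->
  hbnd beta L N K psi ->
  ccvg (fun n => remainder kap gam L 0 N.+1 psi e x0 (tn n))
    (remainder kap gam L 0 N.+1 psi e x0 1).
Proof.
move=> dP hp.
have [_ [v1 v2]] := potential0_boundary dP (hbnd_cont beta01 hp) (fun s => hbnd_le s hp).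
have [w1 w2] := ccvg_tn (@symsum_cder _ N.+1 (fun l t => F (0 + l) psi e * regular_wave kap l x0 t)
  (fun l t => F (0 + l) psi e * (kap%:C * (conjc x0 * regular_wave kap (l + 1) x0 t
     - x0 * regular_wave kap (l - 1) x0 t))) 1 (fun l => cderZ _ (regular_der kap l x0 1))).
rewrite /remainder mul1r; split.
- under eq_fun do rewrite cReD cReN.
  by rewrite cReD cReN; apply: cvgB; [exact: v1|exact: w1].
- under eq_fun do rewrite cImD cImN.
  by rewrite cImD cImN; apply: cvgB; [exact: v2|exact: w2].
Qed.

(** The limit t -> 1 of [remainder_le]. *)
Lemma expansion_le N : exists2 C, 0 <= C & forall psi e x0 r sg K,
  tangent_disk gam L e x0 r sg -> hbnd beta L N K psi ->
  cmod (F 0 psi (x0 + e) - symsum N.+1 (fun l => F l psi e * regular_wave kap l x0 1))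
    <= C * r ^+ N.+1 * K.
Proof.
have [C C0 hC] := remainder_le beta01 kap_gt0 gamP g1_smooth N N.+1.
exists C => // psi e x0 r sg K dP hp.
rewrite (_ : _ - _ = remainder kap gam L 0 N.+1 psi e x0 1); last first.
  by rewrite /remainder mul1r; congr (_ - _); apply: symsum_ext => l; rewrite add0r.
have [v1 v2] := remainder_boundary dP hp.
have [u [u1 ->]] := cmod_rotation (remainder kap gam L 0 N.+1 psi e x0 1).
rewrite cReM.
have cv : (fun n => complex.Re u * complex.Re (remainder kap gam L 0 N.+1 psi e x0 (tn n))
   - complex.Im u * complex.Im (remainder kap gam L 0 N.+1 psi e x0 (tn n))) @ \oo -->
   complex.Re u * complex.Re (remainder kap gam L 0 N.+1 psi e x0 1)
   - complex.Im u * complex.Im (remainder kap gam L 0 N.+1 psi e x0 1).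
  by apply: cvgB; apply: cvgM => //; exact: cvg_cst.
apply: (ler_cvg_to cv (cvg_cst (C * r ^+ N.+1 * K))); apply: nearW => n.
rewrite -cReM; apply: le_trans (ler_norm _) _; apply: le_trans (Re_le_cmod _) _.
by rewrite cmodM u1 mul1r; apply: hC dP hp (tnI n).
Qed.

End BoundaryValue.

(** * Multipoles in polar coordinates *)

Section PolarForm.
Variable R : realType.
Implicit Types (a x k r : R) (y : R[i]) (l : int) (n : nat).

Lemma cmod_expi a : cmod (expi a) = 1.
Proof. by rewrite /cmod /= cos2Dsin2 sqrtr1. Qed.

Lemma expiN a : expi (- a) = conjc (expi a).
Proof. by rewrite /expi cosN sinN. Qed.

Lemma expiX n a : expi (n%:R * a) = expi a ^+ n.
Proof.
elim: n => [|n IH]; first by rewrite mul0r expr0 /expi cos0 sin0.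
rewrite exprSr -IH -natr1 mulrDl mul1r /expi cosD sinD.
by apply: complex_ext; rewrite !ReImE /=; ring.
Qed.

Lemma polar_form y : y != 0 -> y = (cmod y)%:C * expi (carg y).
Proof.
rewrite -cmod_gt0 => y0; have y1 : cmod y != 0 by rewrite gt_eqF.
set q := complex.Re y / cmod y.
have q1 : -1 <= q <= 1.
  rewrite -ler_norml normrM normfV (gtr0_norm y0) ler_pdivrMr// mul1r.
  exact: Re_le_cmod.
have h : cmod y * Num.sqrt (1 - q ^+ 2) = `|complex.Im y|.
  rewrite -{1}(ger0_norm (ltW y0)) -sqrtr_sqr -sqrtrM ?sqr_ge0// -sqrtr_sqr.
  by congr Num.sqrt; rewrite mulrBr mulr1 -exprMn mulrC divfK// cmod_sqr; ring.
apply: complex_ext; rewrite ?cReM ?cImM /= mul0r ?subr0 ?addr0 /carg -/q; case: ifPn => Iy.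
- by rewrite acosK// mulrC divfK.
- by rewrite cosN acosK// mulrC divfK.
- by rewrite sin_acos// h ger0_norm.
- by rewrite sinN sin_acos// mulrN h ltr0_norm ?opprK// ltNge.
Qed.

(** The sign carried by both factors of the l-th term of the expansion: the
    kernel is evaluated at -y, and [multipole] contains (- kap)^n for negative
    orders. It cancels in the product. *)
Definition wave_sign l : R[i] := if l is Posz n then (-1) ^+ n else 1.

Lemma wave_signK l : wave_sign l * wave_sign l = 1.
Proof. by case: l => n; rewrite /= ?mulr1// -expr2 -exprM mulnC exprM sqrrN !expr1n. Qed.

Lemma multipole_besH_hankel l k y : 0 < k -> y != 0 ->
  multipole (@besH R) (k / 2) l (- y) =
  wave_sign l * (hankel1 `|l|%N (k * cmod y) * expi (- (l%:~R * carg y))).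
Proof.
move=> k0 y0; have c0 : 0 < cmod y by rewrite cmod_gt0.
rewrite hankel1E ?mulr_gt0// (_ : k * cmod y / 2 = k / 2 * cmod y); last by rewrite mulrAC.
have yE := polar_form y0; set E := expi (carg y) in yE.
have yJ : conjc (- y) = - ((cmod y)%:C * conjc E).
  by rewrite {1}yE rmorphN rmorphM /=; congr (- (_ * _)); rewrite oppr0.
have kE n : ((k / 2 * cmod y) ^+ n)%:C = (k / 2)%:C ^+ n * (cmod y)%:C ^+ n.
  by rewrite rmorphXn rmorphM exprMn.
case: l => n; rewrite /multipole /wave_sign cmodN kE.
- rewrite absz_nat expiN expiX -/E yJ (exprNn ((cmod y)%:C * _)) (exprMn _ (cmod y)%:C).
  rewrite (rmorphXn (@conjc R)).
  by move: (besH _ _) ((k / 2)%:C ^+ n) ((cmod y)%:C ^+ n) => *; ring.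
- rewrite NegzE abszN absz_nat mulrNz mulNr opprK expiX -/E {1}yE.
  rewrite -mulN1r -(mulN1r (_ * _)) !exprMn.
  have := expr2 ((-1 : R[i]) ^+ n.+1); rewrite -exprM mulnC exprM sqrrN !expr1n => e.
  move: (besH _ _) ((k / 2)%:C ^+ n.+1) ((cmod y)%:C ^+ n.+1) ((-1) ^+ n.+1) e => h a b c e.
  by transitivity (c * c * (a * b * E ^+ n.+1 * h)); [ring|rewrite -e; ring].
Qed.

Lemma regular_wave_besselJ l k r a :
  regular_wave (k / 2) l (r%:C * expi a) 1 =
  wave_sign l * ((besselJ `|l|%N (k * r))%:C * expi (l%:~R * a)).
Proof.
rewrite besselJE (_ : k * r / 2 = k / 2 * r); last by rewrite mulrAC.
have cE : cmod (r%:C * expi a) = `|r| by rewrite cmodM cmodC cmod_expi mulr1.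
have sE (b : R) : (b * `|r|) ^+ 2 = (b * r) ^+ 2 by rewrite !exprMn real_normK ?num_real.
have kE n (q : R) : ((k / 2 * r) ^+ n * q)%:C = (k / 2)%:C ^+ n * r%:C ^+ n * q%:C.
  by rewrite rmorphM rmorphXn rmorphM exprMn.
have xJ : conjc (r%:C * expi a) = r%:C * conjc (expi a).
  by rewrite rmorphM /=; congr (_ * _); rewrite oppr0.
rewrite /regular_wave mul1r kE; case: l => n.
- rewrite multipole_Nn /multipole cmodJ cE sE conjcK expiX absz_nat /wave_sign exprMn.
  by move: (besA _ _)%:C ((k / 2)%:C ^+ n) (r%:C ^+ n) => *; ring.
- rewrite NegzE opprK /multipole cE sE abszN absz_nat mulrNz mulNr expiN expiX /wave_sign.
  rewrite xJ exprMn rmorphXn.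
  by move: (besA _ _)%:C ((k / 2)%:C ^+ n.+1) (r%:C ^+ n.+1) => *; ring.
Qed.

End PolarForm.

(** * Holder norms and smooth curves *)

Section HolderNorm.
Variable R : realType.
Variables (beta L : R).
Hypothesis beta01 : 0 < beta < 1.
Hypothesis L0 : 0 < L.
Implicit Types (gam : R -> R[i]) (phi : R[i] -> R[i]).

(** A supremum is an upper bound only if it is finite: the derivatives are
    periodic and continuous, hence bounded, and the Holder condition bounds the
    difference quotients. *)
Lemma holder_hbnd gam N phi : (forall s, gam (s + L) = gam s) -> holder gam N beta phi ->
  hbnd beta L N (holder_norm gam N beta phi) (fun s => phi (gam s)).
Proof.
move=> pg [df [A hA]]; rewrite /holder_norm.
pose f s := phi (gam s); have pf s : f (s + L) = f s by rewrite /f pg.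
have cN : ccont (cderiven N f).
  split; apply: (holder_cont beta01 (K := A)) => s t.
  - by rewrite -cReN -cReD; apply: le_trans (hA s t); exact: Re_le_cmod.
  - by rewrite -cImN -cImD; apply: le_trans (hA s t); exact: Im_le_cmod.
have sub n : (n <= N)%N -> cderivable_n n f.
  by move=> nN m s mn; apply: df; exact: leq_trans nN.
have sup_le n s : (n <= N)%N -> cmod (cderiven n f s) <= curve_sup_norm (cderiven n f).
  move=> nN; have cn : ccont (cderiven n f).
    by move: nN; rewrite leq_eqVlt => /predU1P[->//|nN]; apply: cderiven_cont; exact: sub.
  have [M hM] := per_cont_bounded L0 (cderiven_per pf (sub n nN)) cn.
  apply: ub_le_sup; last by exists s.
  by exists M => _ [t _ <-].
have sup_ge0 n : (n <= N)%N -> 0 <= curve_sup_norm (cderiven n f).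
  by move=> nN; apply: le_trans (sup_le n 0 nN); exact: cmod_ge0.
pose S : set R := [set cmod (cderiven N f st.1 - cderiven N f st.2) / `|st.1 - st.2| `^ beta
      | st in [set st : R * R | st.1 != st.2]].
have semi_le s t : s != t ->
    cmod (cderiven N f s - cderiven N f t) / `|s - t| `^ beta
      <= holder_seminorm beta (cderiven N f).
  move=> st; apply: (@ub_le_sup _ S); last by exists (s, t).
  exists A => _ [[s' t'] /= st' <-].
  by rewrite ler_pdivrMr ?hA// powR_gt0// normr_gt0 subr_eq0.
have semi_ge0 : 0 <= holder_seminorm beta (cderiven N f).
  apply: le_trans (semi_le 1 0 (oner_neq0 _)).
  by rewrite divr_ge0 ?cmod_ge0 ?powR_ge0.
have sum_ge0 : 0 <= \sum_(j < N.+1) curve_sup_norm (curve_derive gam j phi).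
  by apply: sumr_ge0 => j _; apply: sup_ge0; rewrite -ltnS.
apply: cderivable_hbnd => // [n s nN|s t].
  apply: le_trans (sup_le n s nN) _; rewrite ler_wpDr//.
  rewrite -ltnS in nN; rewrite (bigD1 (Ordinal nN))//= lerDl.
  by apply: sumr_ge0 => j _; apply: sup_ge0; rewrite -ltnS.
have [->|st] := eqVneq s t.
  by rewrite subrr cmod0 mulr_ge0 ?powR_ge0// addr_ge0.
rewrite -ler_pdivrMr ?powR_gt0 ?normr_gt0 ?subr_eq0//.
by apply: le_trans (semi_le s t st) _; rewrite lerDr.
Qed.

Lemma smooth_curve_arc gam : smooth_closed_curve gam L ->
  exists B, arc_curve gam (cderiven 1 gam) L B /\
    forall j, exists M, hbnd beta L j M (cderiven 1 gam).
Proof.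
move=> [_ sg pg ug ig].
have g1s := csmooth_hbnd beta01 L0 pg sg 1.
have [B hB] := csmooth_hbnd beta01 L0 pg sg 2 0.
exists B; split => //; split => //.
- by move=> s; have := cderiven_cder s (sg 1%N); rewrite cderiven0.
- move=> s t.
  have lip a b : a <= b -> cmod (cderiven 1 gam b - cderiven 1 gam a) <= B * `|b - a|.
    move=> ab; rewrite ger0_norm ?subr_ge0//.
    apply: (cder_incr_le ab (f' := cderiven 2 gam)) => x _; last exact: hbnd_le hB.
    by apply: cderiven_cder; exact: sg.
  have [ts|/ltW st] := leP t s; first exact: lip.
  by rewrite -cmodN opprB distrC; exact: lip.
Qed.

End HolderNorm.

(** * The remainder estimate *)

(* The origin is the expansion centre and r its distance to the curve, so a
   bound in r only has content if the constant does not depend on the position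
   of the curve relative to the centre: it is uniform over all translates
   gam0 + c of the given curve (c = 0 is the curve itself). *)
Theorem theorem2p4 (R : realType) (gam0 : R -> R[i]) (L : R)
  (hgam0 : smooth_closed_curve gam0 L)
  (k : R) (hk : 0 < k) (N : nat) (hN : (0 < N)%N)
  (beta : R) (hbeta : 0 < beta < 1) :
  exists M : R,
    forall (c : R[i]) (r theta0 : R),
      let gam := fun s : R => gam0 s + c in
      let x0 := r%:C * expi theta0 in
      0 < r ->
      odisk r `<=` ~` range gam ->
      range gam x0 ->
      forall phi : R[i] -> R[i],
        holder gam N beta phi ->
        cmod (curve_integral gam L (fun y => helmholtzG k x0 y * phi y)
              - local_expansion gam L k phi N r theta0)
          <= M * r ^+ N.+1 * holder_norm gam N beta phi.
Proof.
have L0 : 0 < L by case: hgam0.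
have [B [gamP g1s]] := smooth_curve_arc hbeta L0 hgam0.
have kap0 : 0 < k / 2 by rewrite divr_gt0.
have [C C0 hC] := expansion_le hbeta kap0 gamP g1s N.
exists (4^-1 * C) => c r a gam x0 r0 off touch phi hphi.
have pg s : gam (s + L) = gam s by rewrite /gam (arc_per gamP).
pose psi s := phi (gam s).
(* The kernels depend on differences only, so gam0 is kept fixed and the centre
   of the expansion is moved to - c. *)
have hpsi : hbnd beta L N (holder_norm gam N beta phi) psi by exact: holder_hbnd.
have cpsi := hbnd_cont hbeta hpsi.
have far s : r <= cmod (gam s).
  by rewrite leNgt; apply/negP => /off; apply; exists s.
have [sg dP] : exists sg, tangent_disk gam0 L (- c) x0 r sg.
  have [s _ sE] := touch; have [t /andP[t0 tL] tE] := per_floor L0 pg s.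
  exists t; split => //.
  - by rewrite cmodM cmodC cmod_expi mulr1 gtr0_norm.
  - by rewrite t0 ltW.
  - by rewrite -sE tE addrK.
  - by move=> u; rewrite opprK; exact: far.
have gam_neq0 s : gam s != 0 by rewrite -cmod_gt0 (lt_le_trans r0)// far.
have negE s : - c - gam0 s = - gam s by rewrite /gam opprD addrC.
have coeffE l : multipole_coeff gam L k phi l = (0 +i* 4^-1) *
    (wave_sign R l * potential (k / 2) gam0 L l psi (- c)).
  have cA : ccont (fun s => multipole (@besH R) (k / 2) l (- c - gam0 s) * psi s).
    apply: (potential_cont kap0 gamP) => // s.
    by rewrite -subr_eq0 negE oppr_eq0.
  rewrite /multipole_coeff /curve_integral /potential -(cintegralZ 0 L (wave_sign R l) cA).
  congr (_ * cintegral _ _ _); apply/funext => s.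
  by rewrite negE multipole_besH_hankel// !mulrA wave_signK mul1r.
have sumE : local_expansion gam L k phi N r a = (0 +i* 4^-1) *
    symsum N.+1 (fun l => potential (k / 2) gam0 L l psi (- c) * regular_wave (k / 2) l x0 1).
  rewrite /local_expansion symsumE mulr_sumr; apply: eq_bigr => j _ /=.
  rewrite coeffE regular_wave_besselJ; set l := (_ - _)%R.
  by rewrite -!mulrA; congr (_ * _); rewrite mulrCA.
have [iF _] := potential0_boundary hbeta kap0 gamP dP cpsi (fun s => hbnd_le s hpsi).
have intE : curve_integral gam L (fun y => helmholtzG k x0 y * phi y) =
    (0 +i* 4^-1) * potential (k / 2) gam0 L 0 psi (x0 - c).
  rewrite /potential -cintegrableZl//; congr cintegral; apply/funext => s.
  rewrite /helmholtzG -mulrA; congr (_ * (_ * _)).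
  rewrite hankel1_0E ?mulr_ge0 ?cmod_ge0 ?(ltW hk)// /multipole /= !expr0 !mul1r.
  by rewrite /gam opprD addrA addrAC [_ * _ / 2]mulrAC.
rewrite intE sumE -mulrBr cmodM.
have -> : cmod (0 +i* 4^-1 : R[i]) = 4^-1.
  by rewrite /cmod /= expr0n add0r sqrtr_sqr ger0_norm.
by rewrite -!mulrA ler_wpM2l// mulrA; exact: hC dP hpsi.
Qed.
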